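(* Let $\Sigma\subset\mathbb{H}^1$ be an area-stationary surface of class $C^1$ in the sub-Riemannian Heisenberg group. Then the regular part $\Sigma\setminus\Sigma_0$ of $\Sigma$ is foliated by horizontal straight lines.
   Context: The Heisenberg group $\mathbb{H}^1$ is the Lie group $\mathbb{R}^3\equiv\mathbb{C}\times\mathbb{R}$ with product $[z,t]*[z',t']=[z+z',t+t'+\mathrm{Im}(z\overline{z}')]$. A basis of left-invariant vector fields is $X=\partial_x+y\,\partial_t$, $Y=\partial_y-x\,\partial_t$, $T=\partial_t$. The horizontal distribution $\mathcal{H}$ is the plane distribution spanned by $X,Y$; a vector or curve is horizontal if it is tangent to $\mathcal{H}$. $g=\langle\cdot,\cdot\rangle$ is the Riemannian metric making $\{X,Y,T\}$ orthonormal. For a $C^1$ surface $\Sigma$ immersed in $\mathbb{H}^1$ with (local) unit normal $N$ with respect to $g$, put $N_h=N-\langle N,T\rangle T$. The singular set is $\Sigma_0=\{p\in\Sigma: T_p\Sigma=\mathcal{H}_p\}=\{N_h=0\}$, and $\Sigma\setminus\Sigma_0$ is the regular part. The sub-Riemannian area is $A(\Sigma)=\int_\Sigma|N_h|\,d\Sigma$, where $d\Sigma$ is the Riemannian area element. $\Sigma$ is area-stationary if, for every $C^1$ vector field $U$ in $\mathbb{H}^1$ with compact support such that $\mathrm{supp}(U)\cap\partial\Sigma=\emptyset$, with associated one-parameter group of diffeomorphisms $\{\varphi_s\}_{s\in\mathbb{R}}$, one has $\frac{d}{ds}\big|_{s=0}A(\varphi_s(\Sigma))=0$ (as usual, if $A(\Sigma)$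 is infinite, this is the derivative of the area of the portion of $\Sigma$ in the support of $U$). A horizontal straight line is a straight line of $\mathbb{R}^3$ that is a horizontal curve, i.e. of the form $s\mapsto(x_0+As,\,y_0+Bs,\,t_0+(Ay_0-Bx_0)s)$. The regular part is foliated by the characteristic curves, that is, the curves in $\Sigma\setminus\Sigma_0$ tangent to the line field $T_p\Sigma\cap\mathcal{H}_p$; the assertion is that these curves are (pieces of) horizontal straight lines.
   Formalization: For surfaces that are immersed but not embedded, area-stationarity is required of each compact portion of each sheet (the literal condition can be vacuous when the boundary is dense); the leaves are taken in the interior of the surface, since at boundary points a leaf need not exist. *)

(* Defs.v *)
From HB Require Import structures.
From mathcomp Require Import all_boot all_order all_algebra.
From mathcomp Require Import ring.
From mathcomp Require Import all_classical all_reals all_analysis.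

Set Implicit Arguments.
Unset Strict Implicit.
Unset Printing Implicit Defensive.
Import Order.TTheory GRing.Theory Num.Theory.
Import numFieldNormedType.Exports.

Local Open Scope classical_set_scope.
Local Open Scope ring_scope.

(* The point [z, t] with z = x + iy is ((x, y), t); tangent vectors at any
   point are identified with elements of the same space R^3. *)
Notation heis R := (R * R * R)%type.
Notation plane R := (R * R)%type.

Section HeisenbergMetric.
Context {R : realType}.
Implicit Types (q v w a b : heis R).

Definition heis_mul q w : heis R :=
  (q.1.1 + w.1.1, q.1.2 + w.1.2,
   q.2 + w.2 + (q.1.2 * w.1.1 - q.1.1 * w.1.2)).

Definition fieldX q : heis R := (1, 0, q.1.2).
Definition fieldY q : heis R := (0, 1, - q.1.1).
Definition fieldT : heis R := (0, 0, 1).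

Definition of_frame q (c : heis R) : heis R :=
  c.1.1 *: fieldX q + c.1.2 *: fieldY q + c.2 *: fieldT.

Definition frame_coord q w : heis R :=
  (w.1.1, w.1.2, w.2 - w.1.1 * q.1.2 + w.1.2 * q.1.1).

Lemma frame_coordK q : cancel (frame_coord q) (of_frame q).
Proof.
case=> [[w1 w2] w3]; rewrite /of_frame /frame_coord /fieldX /fieldY /fieldT /=.
by congr (_, _, _); rewrite /= /GRing.scale /=; ring.
Qed.

Lemma of_frameK q : cancel (of_frame q) (frame_coord q).
Proof.
case=> [[w1 w2] w3]; rewrite /of_frame /frame_coord /fieldX /fieldY /fieldT /=.
by congr (_, _, _); rewrite /= /GRing.scale /=; ring.
Qed.

(* X, Y, T are left-invariant. *)
Lemma heis_mulE q (c : heis R) (s : R) :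
  heis_mul q (s *: c) = q + s *: of_frame q c.
Proof.
case: q c => [[q1 q2] q3] [[c1 c2] c3].
rewrite /heis_mul /of_frame /fieldX /fieldY /fieldT /=.
by congr (_, _, _); rewrite /= /GRing.scale /=; ring.
Qed.

(* The Riemannian metric making X, Y, T orthonormal. *)
Definition metric q v w : R :=
  let c := frame_coord q v in let d := frame_coord q w in
  c.1.1 * d.1.1 + c.1.2 * d.1.2 + c.2 * d.2.

Definition gnorm q v : R := Num.sqrt (metric q v v).

Definition horizontal_plane q : set (heis R) :=
  [set w | exists a b : R, w = a *: fieldX q + b *: fieldY q].

(* Cross product of a and b in the orthonormal frame X, Y, T. *)
Definition gcross q a b : heis R :=
  let c := frame_coord q a in let d := frame_coord q b in
  of_frame q (c.1.2 * d.2 - c.2 * d.1.2,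
              c.2 * d.1.1 - c.1.1 * d.2,
              c.1.1 * d.1.2 - c.1.2 * d.1.1).

Definition unit_normal q a b : heis R :=
  (gnorm q (gcross q a b))^-1 *: gcross q a b.

Definition horizontal_part q v : heis R := v - metric q v fieldT *: fieldT.

Definition area_element q a b : R :=
  Num.sqrt (metric q a a * metric q b b - metric q a b ^+ 2).

(* The density |N_h| dSigma at q of a surface whose coordinate tangent
   vectors at q are a and b. *)
Definition subriem_density q a b : R :=
  gnorm q (horizontal_part q (unit_normal q a b)) * area_element q a b.

Definition horizontal_line (p : heis R) (A B s : R) : heis R :=
  (p.1.1 + A * s, p.1.2 + B * s, p.2 + (A * p.1.2 - B * p.1.1) * s).

End HeisenbergMetric.

Section C1.
Context {R : realType} {V W : normedModType R}.

(* For an open set D. *)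
Definition C1_on (D : set V) (f : V -> W) : Prop :=
  forall x, D x -> differentiable f x /\
    forall v, {for x, continuous (fun y => 'D_v f y)}.

End C1.

(* An immersed surface is a map F from a topological surface M (possibly with
   boundary) to R^3 that is a C^1 immersion when read in suitable topological
   charts.  Such charts are automatically C^1-compatible with each other, so
   that F determines the C^1 structure of M. *)
Section Surfaces.
Context {R : realType} {M : topologicalType}.
Implicit Types (F : M -> heis R) (D E : set (plane R)) (psi : plane R -> M).

Definition half_plane : set (plane R) := [set x | 0 <= x.2].

Definition chart_domain D : Prop :=
  open D \/ exists2 O : set (plane R), open O & D = O `&` half_plane.

(* A homeomorphism of D onto an open subset of M. *)
Definition chart D psi : Prop :=
  [/\ chart_domain D, set_inj D psi, {within D, continuous psi} &
      forall O : set (plane R), open O -> open (psi @` (D `&` O))].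

(* G is a C^1 extension of F \o psi to a neighbourhood of D (at the boundary of
   the half-plane, "C^1" means having such an extension), and it is an
   immersion along D. *)
Definition C1_immersion_ext F D psi (G : plane R -> heis R) : Prop :=
  [/\ exists O : set (plane R), [/\ open O, D `<=` O & C1_on O G],
      forall x, D x -> G x = F (psi x) &
      forall x, D x -> forall v, 'D_v G x = 0 -> v = 0].

Definition local_param F D psi : Prop :=
  chart D psi /\ exists G, C1_immersion_ext F D psi G.

Definition immersed_surface F : Prop :=
  [/\ hausdorff_space M, @second_countable M &
      forall p : M, exists D psi, local_param F D psi /\ (psi @` D) p].

Definition surface_interior F : set M :=
  [set p | exists D psi, [/\ open D, local_param F D psi & (psi @` D) p]].

Definition surface_boundary F : set M := ~` surface_interior F.

Definition tangent_plane F (p : M) : set (heis R) :=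
  [set w | exists D psi G x v, [/\ chart D psi, C1_immersion_ext F D psi G,
     D x, psi x = p & w = 'D_v G x]].

Definition singular_set F : set M :=
  [set p | tangent_plane F p = horizontal_plane (F p)].

Definition regular_part F : set M := ~` singular_set F.

Definition param_area F psi E : \bar R :=
  (\int[(@lebesgue_measure R \x @lebesgue_measure R)%E]_(x in E)
     (subriem_density (F (psi x)) ('D_((1, 0) : plane R) (F \o psi) x)
                                  ('D_((0, 1) : plane R) (F \o psi) x))%:E)%E.

(* The integral of |N_h| dSigma over a Borel subset P of M: the supremum of the
   areas of the finite disjoint families of Borel pieces of P each lying in one
   local parametrization.  As M is second countable and its boundary has no
   area, it equals the sum over any countable partition of P into such
   pieces. *)
Definition subriem_area F (P : set M) : \bar R :=
  ereal_sup [set a | exists (n : nat) (D E : 'I_n -> set (plane R))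
      (psi : 'I_n -> plane R -> M),
    [/\ forall i, open (D i) /\ local_param F (D i) (psi i),
        forall i, measurable (E i) /\ E i `<=` D i,
        forall i, psi i @` E i `<=` P,
        trivIset setT (fun i => psi i @` E i) &
        a = (\sum_(i < n) param_area F (psi i) (E i))%E]].

Definition vf_support (U : heis R -> heis R) : set (heis R) :=
  closure [set q | U q != 0].

Definition is_flow (U : heis R -> heis R) (phi : R -> heis R -> heis R) : Prop :=
  (forall q, phi 0 q = q) /\
  (forall s q, is_derive s (1 : R) (fun r => phi r q) (U (phi s q))).

(* A compact portion of the surface in the support of U, away from the
   boundary: all of F^-1(supp U) or, when several sheets of the surface meet
   supp U, a union of sheets. *)
Definition portion F (U : heis R -> heis R) (P : set M) : Prop :=
  [/\ compact P,
      exists2 W : set M, open W & P = W `&` F @^-1` vf_support U &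
      P `&` surface_boundary F = set0].

(* The area of a portion is finite by compactness, so that [fine] is harmless.
   For a properly embedded surface it is equivalent, by multiplying U by cut-off
   functions, to consider only the fields U whose support does not meet the
   boundary and P = F^-1(supp U).  For an immersion several sheets, possibly
   infinitely many, can pass near the same point of R^3; a variation is then
   allowed to move some of them only, as for any variation of an immersion. *)
Definition area_stationary F : Prop :=
  forall (U : heis R -> heis R) (phi : R -> heis R -> heis R),
    C1_on setT U -> compact (vf_support U) -> is_flow U phi ->
  forall P : set M, portion F U P ->
    is_derive (0 : R) (1 : R) (fun s => fine (subriem_area (phi s \o F) P)) 0.

(* Regularly parametrized C^1 curves, on the open interval ]a, b[. *)
Definition characteristic_curve F (a b : R) (gamma : R -> M) : Prop :=
  forall s, a < s < b ->
  [/\ surface_interior F (gamma s), regular_part F (gamma s),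
      {for s, continuous gamma}, derivable (F \o gamma) s 1 &
   [/\ {for s, continuous ('D_(1 : R) (F \o gamma))},
      'D_(1 : R) (F \o gamma) s != 0 &
      (tangent_plane F (gamma s) `&` horizontal_plane (F (gamma s)))
        ('D_(1 : R) (F \o gamma) s)]].

(* Through each regular point there passes locally exactly one characteristic
   curve, which is a segment of a horizontal line, and each characteristic curve
   is a piece of such a line.  There need be no leaf through a point of the
   boundary. *)
Definition foliated_by_horizontal_lines F : Prop :=
  (forall p : M, surface_interior F p -> regular_part F p ->
     exists (A B e : R) (gamma : R -> M),
     [/\ 0 < e, gamma 0 = p, characteristic_curve F (- e) e gamma,
         forall s, - e < s < e -> F (gamma s) = horizontal_line (F p) A B s &
         forall (a b s0 : R) (eta : R -> M), a < s0 < b ->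
           characteristic_curve F a b eta -> eta s0 = p ->
           \forall s \near s0, (gamma @` `]- e, e[) (eta s)]) /\
  (forall (a b : R) (gamma : R -> M), characteristic_curve F a b gamma ->
     exists (q : heis R) (A B : R), (A, B) != (0, 0) /\
       forall s, a < s < b -> exists r : R, F (gamma s) = horizontal_line q A B r).

End Surfaces.

(* Main.v *)
(* Away from its singular set the surface is, near each point, an intrinsic graph
   over one of the vertical planes of H^1: writing q = (al xi - be eta, be xi +
   al eta, tau - xi eta) with (al, be) = (1, 0) or (0, 1), it is {eta = u(xi, tau)}
   with u of class C^1, and its area is the integral of sqrt(1 + om^2), where
   om = u_xi + 2 u u_tau.  Moving the graph by the flow eta |-> eta0 +
   atan(tan(eta - eta0) + s v(xi, tau)), the first variation formula reads
     int f (w_xi + 2 (u w)_tau) = 0,   f = om / sqrt(1 + om^2),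
   for every C^1 function w with compact support.  Choosing w concentrated along
   an integral curve tau = t(xi) of dt/dxi = 2 u(xi, t), one finds that f, hence
   om, is constant along this curve; but om is the derivative of u along it, so
   that u is affine and t quadratic in xi, and the curve lifts to a horizontal
   straight line of the surface.  A characteristic curve lifts a solution of the
   same equation, so uniqueness for this equation, which is Lipschitz in t, gives
   the rest. *)

From HB Require Import structures.
From mathcomp Require Import all_boot all_order all_algebra.
From mathcomp Require Import ring lra.
From mathcomp Require Import all_classical all_reals all_analysis.
Require Import Defs.

Set Implicit Arguments.
Unset Strict Implicit.
Unset Printing Implicit Defensive.
Import Order.TTheory GRing.Theory Num.Theory.
Import numFieldNormedType.Exports.
Import measurable_realfun.

Local Open Scope classical_set_scope.
Local Open Scope ring_scope.

Opaque derive diff.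

(** * Calculus of C^1 maps *)

Section DifferentiableEps.
Context {R : realType}.

(** The area is a supremum over families of parametrized pieces, so it becomes an integral only
    through a change of variables formula for C^1 maps of the plane; factoring such a map locally
    into shears and coordinate swaps reduces it to Tonelli and to substitution on an interval. The
    variation must come from a C^1 field on the whole space, of compact support, whose flow can be
    written down: in the coordinate tan(eta - eta0) the flow is a translation at speed v, while in
    eta its speed is v cos^2(eta - eta0), which extends by zero to a C^1 function. The factor 1 +
    tan^2 that appears is absorbed in v, so that every w occurs. Since u is only C^1, f is only
    continuous and the weak equation cannot be integrated by parts; the test functions live in a
    tube of height of order h about the integral curve, where u(xi, tau) - u(xi, t(xi)) is O(h) and
    offsets the larger size of the derivative of the bump. All of this is local; a long
    characteristic curve stays on one line because its position and direction relative to that line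
    cannot start to deviate at any parameter. *)

Lemma differentiable_near_eq {V W : normedModType R} (f g : V -> W) (x : V) :
  (\forall y \near x, f y = g y) -> differentiable f x -> differentiable g x.
Proof.
move=> fg df; have fgx : f x = g x by exact: nbhs_singleton fg.
have H : g \o shift x = cst (g x) + 'd f x +o_ 0 id.
  apply/eqaddoP => e e0.
  have /eqaddoP/(_ _ e0) := diff_locally df.
  apply: filter_app.
  have := fg; rewrite (near_shift 0) subr0 => fg0.
  apply: filter_app fg0; near=> y => /= fgy.
  by rewrite !fctE /= fgx -fgy.
have cdf := diff_continuous df.
by apply/diff_locallyP; rewrite (diff_unique cdf H).
Unshelve. all: by end_near. Qed.

Lemma differentiable_eps {V W : normedModType R} (f : V -> W) (x : V) :
  differentiable f x -> forall e, 0 < e ->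
  \forall y \near x, `|f y - f x - 'd f x (y - x)| <= e * `|y - x|.
Proof.
move=> df e e0; have /eqaddoP/(_ _ e0) := diff_locally df.
rewrite [in X in _ -> X](near_shift 0) subr0.
apply: filter_app; near=> y; by rewrite /= !fctE /= addrK opprD addrA.
Unshelve. all: by end_near. Qed.

(** Uniqueness of the differential lets a guessed linear map be certified by an epsilon estimate.
    Inverse functions are differentiated in this way below. *)
Lemma eps_differentiable {V W : normedModType R} (f : V -> W) (x : V)
    (df : {linear V -> W}) : continuous df ->
  (forall e, 0 < e ->
     \forall y \near x, `|f y - f x - df (y - x)| <= e * `|y - x|) ->
  differentiable f x /\ 'd f x = df :> (V -> W).
Proof.
move=> cdf fdf.
have H : f \o shift x = cst (f x) + df +o_ 0 id.
  apply/eqaddoP => e e0; have := fdf _ e0; rewrite (near_shift 0) subr0.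
  apply: filter_app; near=> y.
  by rewrite /= !fctE /= addrK opprD addrA.
split; last exact: diff_unique.
by apply/diff_locallyP; rewrite (diff_unique cdf H).
Unshelve. all: by end_near. Qed.

End DifferentiableEps.

Section C1Calculus.
Context {R : realType}.
Implicit Types V W : normedModType R.

Lemma derive_comp {V W W' : normedModType R} (f : V -> W) (g : W -> W') p v :
  differentiable f p -> differentiable g (f p) ->
  'D_v (g \o f) p = 'D_('D_v f p) g (f p).
Proof.
move=> df dg; rewrite deriveE; last exact: differentiable_comp.
by rewrite diff_comp//= -deriveE// -deriveE.
Qed.

Lemma derive_linear {V W} (f : V -> W) p (a b : R) v w : differentiable f p ->
  'D_(a *: v + b *: w) f p = a *: 'D_v f p + b *: 'D_w f p.
Proof. by move=> df; rewrite !deriveE// linearD !linearZ. Qed.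

Lemma derive_comp1 {V} (f : V -> R) (g : R -> R) p v :
  differentiable f p -> derivable g (f p) 1 ->
  'D_v (g \o f) p = 'D_1 g (f p) * 'D_v f p.
Proof.
move=> df /derivable1_diffP dg; rewrite derive_comp// !deriveE//.
by rewrite -[X in 'd g _ X]mulr1 linearZ /= mulrC.
Qed.

Lemma derive_pair {V W W'} (f : V -> W) (g : V -> W') p v :
  differentiable f p -> differentiable g p ->
  'D_v (fun x => (f x, g x)) p = ('D_v f p, 'D_v g p).
Proof.
move=> df dg; rewrite !deriveE//; last exact: differentiable_pair.
by rewrite diff_pair.
Qed.

Definition dx {W} (f : plane R -> W) p := 'D_((1, 0) : plane R) f p.
Definition dy {W} (f : plane R -> W) p := 'D_((0, 1) : plane R) f p.

Lemma dxE {W} (f : plane R -> W) p : dx f p = 'D_((1, 0) : plane R) f p.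
Proof. by []. Qed.

Lemma dyE {W} (f : plane R -> W) p : dy f p = 'D_((0, 1) : plane R) f p.
Proof. by []. Qed.

Lemma dx_fun {W} (f : plane R -> W) : dx f = 'D_((1, 0) : plane R) f.
Proof. by []. Qed.

Lemma dy_fun {W} (f : plane R -> W) : dy f = 'D_((0, 1) : plane R) f.
Proof. by []. Qed.

Opaque dx dy.

Lemma derive_plane {W} (f : plane R -> W) p (v : plane R) :
  differentiable f p ->
  'D_v f p = v.1 *: dx f p + v.2 *: dy f p.
Proof.
move=> df; rewrite dxE dyE -derive_linear//; congr ('D_ _ f p).
case: v => a b; apply/pair_equal_spec => /=.
by rewrite /GRing.scale /= !(mulr0, mulr1, addr0, add0r).
Qed.

Lemma derive_comp2 {V} (f : plane R -> R) (g h : V -> R) p v :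
  differentiable g p -> differentiable h p -> differentiable f (g p, h p) ->
  'D_v (fun x => f (g x, h x)) p =
  'D_v g p * dx f (g p, h p) +
  'D_v h p * dy f (g p, h p).
Proof.
move=> dg dh df.
have dgh := differentiable_pair dg dh.
rewrite -[LHS]/('D_v (f \o (fun x => (g x, h x))) p) (derive_comp v dgh df).
by rewrite (derive_pair v dg dh) (derive_plane _ df).
Qed.

Lemma C1_on_sub {V W} (O O' : set V) (f : V -> W) :
  O' `<=` O -> C1_on O f -> C1_on O' f.
Proof. by move=> sO cf x /sO; exact: cf. Qed.

Lemma C1_on_near_eq {V W} (O : set V) (f g : V -> W) :
  (forall x, O x -> \forall y \near x, f y = g y) -> C1_on O f -> C1_on O g.
Proof.
move=> fg cf x Ox; have [df cdf] := cf _ Ox.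
split; first exact: differentiable_near_eq (fg _ Ox) df.
move=> v; have /near_join fg2 := fg _ Ox.
have E : \forall y \near x, 'D_v f y = 'D_v g y.
  by apply: filterS fg2 => y; exact: near_eq_derive.
rewrite /prop_for /continuous_at -(nbhs_singleton E).
exact/(cvg_trans _ (cdf v))/near_eq_cvg.
Qed.

Lemma C1_on_eq {V W} (O : set V) (f g : V -> W) : open O ->
  (forall x, O x -> f x = g x) -> C1_on O f -> C1_on O g.
Proof.
move=> oO fg; apply: C1_on_near_eq => x Ox.
by apply: filterS (open_nbhs_nbhs (conj oO Ox)).
Qed.

(** As [O] is open, the derivative and the formula agree near each point, so continuity passes from
    one to the other. The closure properties of C^1 maps below rest on this. *)
Lemma C1_on_formula {V W} (O : set V) (f : V -> W) (df : V -> V -> W) : open O ->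
  (forall x, O x -> differentiable f x) ->
  (forall x v, O x -> 'D_v f x = df v x) ->
  (forall x v, O x -> {for x, continuous (df v)}) -> C1_on O f.
Proof.
move=> oO Df E cdf x Ox; split; first exact: Df.
move=> v; rewrite /prop_for /continuous_at E//.
apply: cvg_trans (cdf x v Ox); apply: near_eq_cvg.
by apply: filterS (open_nbhs_nbhs (conj oO Ox)) => y /E->.
Qed.

Lemma C1_on_continuous {V W} (O : set V) (f : V -> W) x :
  C1_on O f -> O x -> {for x, continuous f}.
Proof. by move=> cf /cf[/differentiable_continuous]. Qed.

Lemma continuous_pair {T V W : topologicalType} (f : T -> V) (g : T -> W) x :
  {for x, continuous f} -> {for x, continuous g} ->
  {for x, continuous (fun y => (f y, g y))}.
Proof. by move=> cf cg; exact: (cvg_pair cf cg). Qed.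

Lemma C1_on_dx {W} (O : set (plane R)) (f : plane R -> W) p :
  C1_on O f -> O p -> {for p, continuous (dx f)}.
Proof. by move=> cf Op; rewrite dx_fun; have [_] := cf _ Op; apply. Qed.

Lemma C1_on_dy {W} (O : set (plane R)) (f : plane R -> W) p :
  C1_on O f -> O p -> {for p, continuous (dy f)}.
Proof. by move=> cf Op; rewrite dy_fun; have [_] := cf _ Op; apply. Qed.

Lemma C1_on_diff {V W} (O : set V) (f : V -> W) p :
  C1_on O f -> O p -> differentiable f p.
Proof. by move=> cf /cf[]. Qed.

Lemma C1_on_cst {V W} (O : set V) (k : W) : C1_on O (fun=> k).
Proof.
move=> x _; split; first exact: differentiable_cst.
move=> v; rewrite (_ : (fun y => 'D_v (fun=> k) y) = cst 0); first exact: cst_continuous.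
by apply/funext => y; exact: derive_cst.
Qed.

Lemma C1_on_linear {V W} (O : set V) (f : {linear V -> W}) :
  continuous f -> C1_on O f.
Proof.
move=> cf x _; split; first exact: linear_differentiable.
move=> v; rewrite (_ : (fun y => _) = cst (f v)); first exact: cst_continuous.
apply/funext => y; rewrite deriveE; last exact: linear_differentiable.
by rewrite diff_lin.
Qed.

Lemma fst_continuous {V W} : continuous (fst : V * W -> V).
Proof. by move=> x; exact: cvg_fst. Qed.

Lemma snd_continuous {V W} : continuous (snd : V * W -> W).
Proof. by move=> x; exact: cvg_snd. Qed.

Lemma C1_on_fst {V W} (O : set (V * W)) : C1_on O (fst : V * W -> V).
Proof. by apply: C1_on_linear; exact: fst_continuous. Qed.

Lemma C1_on_snd {V W} (O : set (V * W)) : C1_on O (snd : V * W -> W).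
Proof. by apply: C1_on_linear; exact: snd_continuous. Qed.

Lemma derive_fst {V W} (p v : V * W) : 'D_v (fst : V * W -> V) p = v.1.
Proof.
have d : differentiable (fst : V * W -> V) p.
  by apply: linear_differentiable; exact: fst_continuous.
by rewrite deriveE// diff_lin//; exact: fst_continuous.
Qed.

Lemma derive_snd {V W} (p v : V * W) : 'D_v (snd : V * W -> W) p = v.2.
Proof.
have d : differentiable (snd : V * W -> W) p.
  by apply: linear_differentiable; exact: snd_continuous.
by rewrite deriveE// diff_lin//; exact: snd_continuous.
Qed.

Lemma C1_on_fst_comp {V W W'} (O : set V) (f : V -> W * W') :
  open O -> C1_on O f -> C1_on O (fun x => (f x).1).
Proof.
move=> oO cf; have D1 w : differentiable (fst : W * W' -> W) w.
  by have [] := C1_on_fst (W := W') (O := setT) (x := w).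
apply: (C1_on_formula (df := fun v x => ('D_v f x).1)) => //.
- by move=> x /cf[df _]; exact: (differentiable_comp df (D1 _)).
- by move=> x v /cf[df _]; rewrite -[LHS]/('D_v (fst \o f) x) derive_comp// derive_fst.
- move=> x v /cf[_ /(_ v) cdf]; exact: (continuous_comp cdf (@fst_continuous _ _ _)).
Qed.

Lemma C1_on_snd_comp {V W W'} (O : set V) (f : V -> W * W') :
  open O -> C1_on O f -> C1_on O (fun x => (f x).2).
Proof.
move=> oO cf; have D1 w : differentiable (snd : W * W' -> W') w.
  by have [] := C1_on_snd (V := W) (O := setT) (x := w).
apply: (C1_on_formula (df := fun v x => ('D_v f x).2)) => //.
- by move=> x /cf[df _]; exact: (differentiable_comp df (D1 _)).
- by move=> x v /cf[df _]; rewrite -[LHS]/('D_v (snd \o f) x) derive_comp// derive_snd.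
- move=> x v /cf[_ /(_ v) cdf]; exact: (continuous_comp cdf (@snd_continuous _ _ _)).
Qed.

Lemma C1_on_pair {V W W'} (O : set V) (f : V -> W) (g : V -> W') : open O ->
  C1_on O f -> C1_on O g -> C1_on O (fun x => (f x, g x)).
Proof.
move=> oO cf cg; apply: (C1_on_formula (df := fun v x => ('D_v f x, 'D_v g x))) => //.
- by move=> x Ox; apply: differentiable_pair; [have [] := cf x Ox|have [] := cg x Ox].
- by move=> x v Ox; rewrite derive_pair//; [have [] := cf x Ox|have [] := cg x Ox].
- move=> x v Ox; have [_ /(_ v) c1] := cf x Ox; have [_ /(_ v) c2] := cg x Ox.
  exact: cvg_pair.
Qed.

Lemma C1_onD {V W} (O : set V) (f g : V -> W) : open O ->
  C1_on O f -> C1_on O g -> C1_on O (fun x => f x + g x).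
Proof.
move=> oO cf cg; apply: (C1_on_formula (df := fun v x => 'D_v f x + 'D_v g x)) => //.
- by move=> x Ox; apply: differentiableD; [have [] := cf x Ox|have [] := cg x Ox].
- move=> x v Ox; rewrite deriveD//; apply: diff_derivable.
    by have [] := cf x Ox.
  by have [] := cg x Ox.
- move=> x v Ox; have [_ /(_ v) c1] := cf x Ox; have [_ /(_ v) c2] := cg x Ox.
  exact: cvgD.
Qed.

Lemma C1_onN {V W} (O : set V) (f : V -> W) : open O ->
  C1_on O f -> C1_on O (fun x => - f x).
Proof.
move=> oO cf; apply: (C1_on_formula (df := fun v x => - 'D_v f x)) => //.
- by move=> x Ox; apply: differentiableN; have [] := cf x Ox.
- by move=> x v Ox; rewrite deriveN//; apply: diff_derivable; have [] := cf x Ox.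
- by move=> x v Ox; have [_ /(_ v) c1] := cf x Ox; exact: cvgN.
Qed.

Lemma C1_onB {V W} (O : set V) (f g : V -> W) : open O ->
  C1_on O f -> C1_on O g -> C1_on O (fun x => f x - g x).
Proof. by move=> oO cf cg; apply: C1_onD => //; exact: C1_onN. Qed.

Lemma C1_onM {V} (O : set V) (f g : V -> R) : open O ->
  C1_on O f -> C1_on O g -> C1_on O (fun x => f x * g x).
Proof.
move=> oO cf cg.
apply: (C1_on_formula (df := fun v x => f x * 'D_v g x + g x * 'D_v f x)) => //.
- by move=> x Ox; apply: differentiableM; [have [] := cf x Ox|have [] := cg x Ox].
- move=> x v Ox; rewrite deriveM//; apply: diff_derivable.
    by have [] := cf x Ox.
  by have [] := cg x Ox.
- move=> x v Ox; have [/differentiable_continuous k1 /(_ v) c1] := cf x Ox.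
  have [/differentiable_continuous k2 /(_ v) c2] := cg x Ox.
  by apply: cvgD; exact: cvgM.
Qed.

Lemma C1_on_comp1 {V} (O : set V) (D : set R) (f : V -> R) (g : R -> R) : open O ->
  (forall x, O x -> D (f x)) ->
  (forall t, D t -> derivable g t 1 /\ {for t, continuous ('D_1 g)}) ->
  C1_on O f -> C1_on O (g \o f).
Proof.
move=> oO OD Dg cf.
apply: (C1_on_formula (df := fun v x => 'D_1 g (f x) * 'D_v f x)) => //.
- move=> x Ox; apply: differentiable_comp; first by have [] := cf x Ox.
  by apply/derivable1_diffP; have [] := Dg _ (OD _ Ox).
- move=> x v Ox; rewrite derive_comp1//; first by have [] := cf x Ox.
  by have [] := Dg _ (OD _ Ox).
- move=> x v Ox; have [/differentiable_continuous k1 /(_ v) c1] := cf x Ox.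
  have [_ k2] := Dg _ (OD _ Ox).
  by apply: cvgM => //; exact: (continuous_comp k1 k2).
Qed.

Lemma C1_on_comp2 {V} (O : set V) (D : set (plane R)) (f : plane R -> R)
    (g h : V -> R) : open O -> (forall x, O x -> D (g x, h x)) ->
  C1_on D f -> C1_on O g -> C1_on O h -> C1_on O (fun x => f (g x, h x)).
Proof.
move=> oO OD cf cg ch.
pose d v x := 'D_v g x * dx f (g x, h x) +
  'D_v h x * dy f (g x, h x).
apply: (C1_on_formula (df := d)) => //.
- move=> x Ox; rewrite -[fun=> _]/(f \o (fun x => (g x, h x))).
  apply: differentiable_comp; last by have [] := cf _ (OD _ Ox).
  by apply: differentiable_pair; [have [] := cg x Ox|have [] := ch x Ox].
- by move=> x v Ox; apply: derive_comp2; [exact: C1_on_diff cg Ox|exact: C1_on_diff ch Ox|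
    exact: C1_on_diff cf (OD _ Ox)].
- move=> x v Ox; have [/differentiable_continuous k1 /(_ v) c1] := cg x Ox.
  have [/differentiable_continuous k2 /(_ v) c2] := ch x Ox.
  have cdx := C1_on_dx cf (OD _ Ox); have cdy := C1_on_dy cf (OD _ Ox).
  have k : {for x, continuous (fun x => (g x, h x))}.
    exact: continuous_pair.
  apply: cvgD; apply: cvgM.
  - exact: c1.
  - exact: (continuous_comp k cdx).
  - exact: c2.
  - exact: (continuous_comp k cdy).
Qed.

End C1Calculus.

Opaque dx dy.

(** * Implicit and inverse functions *)

Section PlaneTopology.
Context {R : realType}.
Implicit Types (p q : plane R) (A : set (plane R)).

Definition box p (r s : R) : set (plane R) :=
  [set q | `|q.1 - p.1| < r /\ `|q.2 - p.2| < s].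

Lemma nbhs_box p A : nbhs p A <-> exists2 r, 0 < r & box p r r `<=` A.
Proof.
split.
  move=> /nbhs_ballP[r r0 rA]; exists r => // q [h1 h2]; apply: rA.
  by split; rewrite /ball/= distrC.
move=> [r r0 rA]; apply/nbhs_ballP; exists r => // q [h1 h2]; apply: rA.
by split; rewrite distrC; [exact: h1|exact: h2].
Qed.

Lemma open_box p r s : open (box p r s).
Proof.
rewrite openE => q [h1 h2]; apply/nbhs_box.
exists (Num.min (r - `|q.1 - p.1|) (s - `|q.2 - p.2|)).
  by rewrite lt_min !subr_gt0 h1 h2.
move=> x []; rewrite !lt_min => /andP[+ _] /andP[_].
rewrite !ltrBrDr => k1 k2; split.
  by rewrite -(subrK q.1 x.1) -addrA (le_lt_trans _ k1)// ler_normD.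
by rewrite -(subrK q.2 x.2) -addrA (le_lt_trans _ k2)// ler_normD.
Qed.

Lemma open_near A p : open A -> A p -> \forall q \near p, A q.
Proof. by move=> oA Ap; exact: open_nbhs_nbhs. Qed.

Lemma normr_fst p : `|p.1| <= `|p|.
Proof. by rewrite prod_normE/= le_max lexx. Qed.

Lemma normr_snd p : `|p.2| <= `|p|.
Proof. by rewrite prod_normE/= le_max lexx orbT. Qed.

Lemma diff_plane {W : normedModType R} (f : plane R -> W) p v : differentiable f p ->
  'd f p v = v.1 *: dx f p + v.2 *: dy f p.
Proof. by move=> df; rewrite -(derive_plane v df) deriveE. Qed.

Lemma is_derive_sectl (f : plane R -> R) (a b : R) : differentiable f (a, b) ->
  is_derive a 1 (fun x => f (x, b)) (dx f (a, b)).
Proof.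
move=> df; have d1 : differentiable (id : R -> R) a by [].
have d2 : differentiable (fun=> b : R) a by exact: differentiable_cst.
apply: DeriveDef.
  exact/diff_derivable/(differentiable_comp (differentiable_pair d1 d2) df).
rewrite (derive_comp2 (g := id) (h := fun=> b) 1 d1 d2 df).
by rewrite derive_id derive_cst mul1r mul0r addr0.
Qed.

Lemma is_derive_sectr (f : plane R -> R) (a b : R) : differentiable f (a, b) ->
  is_derive b 1 (fun x => f (a, x)) (dy f (a, b)).
Proof.
move=> df; have d1 : differentiable (id : R -> R) b by [].
have d2 : differentiable (fun=> a : R) b by exact: differentiable_cst.
apply: DeriveDef.
  exact/diff_derivable/(differentiable_comp (differentiable_pair d2 d1) df).
rewrite (derive_comp2 (g := fun=> a) (h := id) 1 d2 d1 df).
by rewrite derive_id derive_cst mul1r mul0r add0r.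
Qed.

Lemma itv_dist (a r x y z : R) : `|x - a| <= r -> `|y - a| <= r -> x <= z <= y ->
  `|z - a| <= r.
Proof. by rewrite !ler_norml; lra. Qed.

Lemma mean_value_le (f df : R -> R) (x y c : R) : x <= y ->
  (forall z, x <= z <= y -> is_derive z 1 f (df z)) ->
  (forall z, x <= z <= y -> c <= df z) -> c * (y - x) <= f y - f x.
Proof.
move=> xy fd cd.
have [z zxy ->] : exists2 z, z \in `[x, y]%R & f y - f x = df z * (y - x).
  apply: MVT_segment => //.
    by move=> z; rewrite in_itv/= => /andP[h1 h2]; apply: fd; rewrite !ltW.
  apply: derivable_within_continuous => z; rewrite in_itv/= => h.
  by have [] := fd _ h.
by rewrite ler_wpM2r ?subr_ge0//; apply: cd; rewrite in_itv/= in zxy.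
Qed.

Lemma mean_value_abs (f df : R -> R) (x y c a r : R) :
  (forall z, `|z - a| <= r -> is_derive z 1 f (df z)) ->
  (forall z, `|z - a| <= r -> `|df z| <= c) -> `|x - a| <= r -> `|y - a| <= r ->
  `|f y - f x| <= c * `|y - x|.
Proof.
move=> fd cd; wlog xy : x y / x <= y => [hw xa ya|xa ya].
  case: (leP x y) => [|/ltW] xy; first exact: hw.
  by rewrite distrC (distrC y); exact: hw.
have h z : x <= z <= y -> `|z - a| <= r by exact: itv_dist.
rewrite (ger0_norm (x := y - x)) ?subr_ge0//.
have k1 := @mean_value_le f df x y (- c) xy (fun z hz => fd z (h z hz)).
have k2 := @mean_value_le (fun x => - f x) (fun x => - df x) x y (- c) xy.
rewrite ler_norml; apply/andP; split.
  by rewrite -mulNr; apply: k1 => z /h/cd; rewrite ler_norml => /andP[].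
suff : - c * (y - x) <= - f y - - f x by lra.
apply: k2 => z hz; first by apply: is_deriveN; exact: fd (h _ hz).
by rewrite lerN2; move: (cd _ (h _ hz)); rewrite ler_norml => /andP[].
Qed.

End PlaneTopology.

Section ImplicitFunction.
Context {R : realType}.
Implicit Types (p q : plane R) (O N V : set (plane R)) (h : plane R -> R).

(* [Phi (a, b) = (h (a, b), b)] is a diffeomorphism from N onto V, whose inverse
   is [(xi, b) |-> (al (xi, b), b)]. *)
Definition straightens h N V (al : plane R -> R) : Prop :=
  [/\ open N, open V,
      forall p, N p -> V (h p, p.2) /\ al (h p, p.2) = p.1,
      forall q, V q -> N (al q, q.2) /\ h (al q, q.2) = q.1 &
      C1_on N h /\ C1_on V al].

(** On a small square [h] increases in the first coordinate at rate at least half its slope at [p0].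
    The intermediate value theorem then solves h(a, b) = xi, and the lower bound on the slope makes
    the solution unique, Lipschitz, and finally C^1. *)
Lemma implicit_function_pos O h p0 : open O -> O p0 -> C1_on O h ->
  0 < dx h p0 -> exists N V al, [/\ N p0, N `<=` O & straightens h N V al].
Proof.
move=> oO Op0 ch; set d0 := dx h p0 => d0p; pose m := d0 / 2.
have m0 : 0 < m by rewrite divr_gt0.
pose B := `|dy h p0| + 1.
have B0 : 0 < B by rewrite ltr_wpDl.
have [r r0 hr] : exists2 r, 0 < r & forall p, `|p.1 - p0.1| <= r ->
    `|p.2 - p0.2| <= r -> [/\ O p, m <= dx h p & `|dy h p| <= B].
  have H : \forall p \near p0, [/\ O p, m <= dx h p & `|dy h p| <= B].
    have H1 := open_near oO Op0.
    have H2 : \forall p \near p0, m <= dx h p.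
      have /cvgrPdist_lt/(_ _ m0) := C1_on_dx ch Op0; apply: filterS => p.
      by rewrite -/d0 /m ltr_norml; lra.
    have H3 : \forall p \near p0, `|dy h p| <= B.
      have /cvgrPdist_lt/(_ _ ltr01) := C1_on_dy ch Op0; apply: filterS => p hp.
      rewrite /B -[X in `|X|](subrK (dy h p0)) addrC.
      by rewrite (le_trans (ler_normD _ _))// lerD2l distrC ltW.
    by near=> p; split; near: p.
  have [r r0 hr] := (nbhs_box _ _).1 H; exists (r / 2); first by rewrite divr_gt0.
  by move=> p k1 k2; apply: hr; split; [move: k1|move: k2]; lra.
(* Moving vertically by less than [e] changes [h] by at most [B * e] and the target is off by at
   most [e]; the condition [(B + 1) * e < m * r] lets the horizontal gain [m * r] outweigh both. *)
pose e := Num.min (r / 2) (m * r / (B + 1) / 2).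
have e0 : 0 < e by rewrite lt_min !divr_gt0 ?mulr_gt0// ltr_wpDl// ltW.
have er : e < r by rewrite gt_min; apply/orP; left; lra.
have eB : (B + 1) * e < m * r.
  rewrite mulrC -ltr_pdivlMr ?ltr_wpDl// 1?ltW// gt_min; apply/orP; right.
  have : 0 < m * r / (B + 1) by rewrite !divr_gt0 ?mulr_gt0// ltr_wpDl// ltW.
  lra.
pose V := box (h p0, p0.2) e e.
have inr x : `|x - p0.2| < e -> `|x - p0.2| <= r by move=> k; exact/ltW/(lt_trans k).
have dha a b : `|a - p0.1| <= r -> `|b - p0.2| <= r ->
    is_derive a 1 (fun x => h (x, b)) (dx h (a, b)).
  move=> k1 k2; have [Ok _ _] := hr (a, b) k1 k2.
  by apply: is_derive_sectl; have [] := ch _ Ok.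
have dhb a b : `|a - p0.1| <= r -> `|b - p0.2| <= r ->
    is_derive b 1 (fun x => h (a, x)) (dy h (a, b)).
  move=> k1 k2; have [Ok _ _] := hr (a, b) k1 k2.
  by apply: is_derive_sectr; have [] := ch _ Ok.
have ha a a' b : `|a - p0.1| <= r -> `|a' - p0.1| <= r -> `|b - p0.2| <= r ->
    a <= a' -> m * (a' - a) <= h (a', b) - h (a, b).
  move=> k1 k2 kb aa; apply: (mean_value_le (f := fun x => h (x, b)) aa) => z hz.
    by apply: dha => //; exact: itv_dist hz.
  by have [] := hr (z, b) (itv_dist k1 k2 hz) kb.
have hb a b b' : `|a - p0.1| <= r -> `|b - p0.2| <= r -> `|b' - p0.2| <= r ->
    `|h (a, b') - h (a, b)| <= B * `|b' - b|.
  move=> k1 k2 kb; apply: (@mean_value_abs _ (fun x => h (a, x))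
    (fun x => dy h (a, x)) _ _ _ p0.2 r) => // z hz; first exact: dhb.
  by have [] := hr (a, z) k1 hz.
have r0' : `|p0.1 - p0.1| <= r by rewrite subrr normr0 ltW.
have r0'' : `|p0.2 - p0.2| <= r by rewrite subrr normr0 ltW.
have ex q : V q -> exists a, `|a - p0.1| < r /\ h (a, q.2) = q.1.
  case=> /= k1 k2; have k2' := inr _ k2.
  have Ep : p0.1 + r - p0.1 = r by ring.
  have Em : p0.1 - (p0.1 - r) = r by ring.
  have rp : `|p0.1 + r - p0.1| <= r by rewrite Ep ger0_norm// ltW.
  have rm : `|p0.1 - r - p0.1| <= r by rewrite distrC Em ger0_norm// ltW.
  have h0q := hb p0.1 p0.2 q.2 r0' r0'' k2'.
  rewrite -surjective_pairing in h0q.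
  have h0e : `|h (p0.1, q.2) - h p0| <= B * e.
    by rewrite (le_trans h0q)// ler_pM2l// ltW.
  have hp := ha p0.1 (p0.1 + r) q.2 r0' rp k2' ltac:(lra).
  have hm := ha (p0.1 - r) p0.1 q.2 rm r0' k2' ltac:(lra).
  have hq1 : h (p0.1 - r, q.2) < q.1 < h (p0.1 + r, q.2).
    move: h0e k1 hp hm; rewrite ler_norml ltr_norml Ep Em.
    by move: eB; rewrite mulrDl mul1r; lra.
  have [a] : exists2 a, a \in `[p0.1 - r, p0.1 + r]%R & h (a, q.2) = q.1.
    apply: (IVT (f := fun x => h (x, q.2))); first by lra.
      apply: derivable_within_continuous => z; rewrite in_itv/= => hz.
      by have [] := dha z q.2 (itv_dist rm rp hz) k2'.
    case/andP: hq1 => /ltW l1 /ltW l2.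
    by rewrite ge_min le_max l1 l2 orbT.
  rewrite in_itv/= => /andP[l1 l2] ea; exists a; split => //.
  rewrite ltr_norml; apply/andP; split.
    rewrite ltrBrDr addrC lt_neqAle l1 andbT; apply/eqP => E.
    by move: hq1; rewrite E ea ltxx.
  rewrite ltrBlDr addrC lt_neqAle l2 andbT; apply/eqP => E.
  by move: hq1; rewrite -E ea ltxx andbF.
pose al q := xget 0 [set a | `|a - p0.1| < r /\ h (a, q.2) = q.1].
have alP q : V q -> `|al q - p0.1| < r /\ h (al q, q.2) = q.1.
  by move=> /ex[a ha']; rewrite /al; case: xgetP => [x _//|/(_ a)]; case.
have ml a a' b : `|a - p0.1| <= r -> `|a' - p0.1| <= r -> `|b - p0.2| <= r ->
    m * `|a' - a| <= `|h (a', b) - h (a, b)|.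
  move=> k1 k2 kb; case: (leP a a') => [|/ltW] aa.
    by rewrite [X in _ * X]ger0_norm ?subr_ge0// (le_trans (ha a a' b k1 k2 kb aa))// ler_norm.
  rewrite distrC [leRHS]distrC.
  by rewrite [X in _ * X]ger0_norm ?subr_ge0// (le_trans (ha a' a b k2 k1 kb aa))// ler_norm.
(* Lipschitz constant of [al]: m |al q' - al q| is bounded by the change of [h] between two points
   at height [q'.2], hence by |q'.1 - q.1| + B |q'.2 - q.2|. *)
pose C := (1 + B) / m.
have C0 : 0 < C by rewrite divr_gt0// addr_gt0.
have alC q q' : V q -> V q' -> `|al q' - al q| <= C * `|q' - q|.
  move=> Vq Vq'; have [k1 k2] := alP _ Vq; have [k1' k2'] := alP _ Vq'.
  have b1 := inr _ Vq.2; have b2 := inr _ Vq'.2.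
  have := ml _ _ q'.2 (ltW k1) (ltW k1') b2; rewrite k2'.
  have : `|h (al q, q'.2) - h (al q, q.2)| <= B * `|q'.2 - q.2|.
    exact: (hb _ _ _ (ltW k1)).
  rewrite k2 => l1 l2.
  have l3 := normr_fst (q' - q); have l4 := normr_snd (q' - q); rewrite /= in l3 l4.
  rewrite /C mulrAC ler_pdivlMr// mulrC (le_trans l2)//.
  rewrite -(subrK q.1 q'.1) -addrA (le_trans (ler_normD _ _))// mulrDl mul1r lerD//.
  by rewrite distrC (le_trans l1)// ler_pM2l.
have cal q : V q -> {for q, continuous al}.
  move=> Vq; have Vn := open_near (@open_box _ _ _ _) Vq.
  apply/cvgrPdist_lt => eps eps0; near=> q'.
  rewrite distrC (le_lt_trans (alC _ _ Vq _))//.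
    by near: q'; exact: Vn.
  rewrite -ltr_pdivlMl// mulrC distrC.
  by near: q'; apply: cvgr_dist_lt => //; rewrite divr_gt0.
have oV : open V by exact: open_box.
pose N := [set p | [/\ `|p.1 - p0.1| < r, `|p.2 - p0.2| < r & V (h p, p.2)]].
have NO : N `<=` O by move=> p [k1 k2 _]; have [] := hr p (ltW k1) (ltW k2).
have VN q : V q -> N (al q, q.2).
  move=> Vq; have [k1 k2] := alP _ Vq; split => //=; last first.
    by rewrite k2 -surjective_pairing.
  by apply: le_lt_trans er; exact: ltW Vq.2.
have NV p : N p -> al (h p, p.2) = p.1.
  case=> k1 k2 Vp; have [l1 l2] := alP _ Vp.
  have := ml _ _ p.2 (ltW k1) (ltW l1) (ltW k2).
  rewrite -[(p.1, p.2)]surjective_pairing /= in l2 *.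
  by rewrite l2 subrr normr0 pmulr_rle0// normr_le0 subr_eq0 => /eqP.
have oN : open N.
  rewrite openE => p [k1 k2 Vp].
  have Op : O p by have [] := hr p (ltW k1) (ltW k2).
  have cp : {for p, continuous (fun p => (h p, p.2))}.
    by apply: continuous_pair; [exact: C1_on_continuous ch Op|exact: snd_continuous].
  near=> x; split.
  - by near: x; have := open_near (@open_box _ p0 r r) (conj k1 k2); apply: filterS => ? [].
  - by near: x; have := open_near (@open_box _ p0 r r) (conj k1 k2); apply: filterS => ? [].
  - by near: x; exact: (cp _ (open_nbhs_nbhs (conj oV Vp))).
exists N, V, al; split => //.
  split; rewrite ?subrr ?normr0//; split => /=; by rewrite subrr normr0.
split => //.
- by move=> p Np; split; [case: Np|exact: NV].
- by move=> q Vq; split; [exact: VN|case: (alP _ Vq)].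
split; first exact: C1_on_sub ch.
(* The candidate differential comes from solving the linearized equation D1 da + D2 db = dxi for
   da. *)
have key q : V q -> differentiable al q /\
    'd al q = (fun v => (dx h (al q, q.2))^-1 *
                   (v.1 - dy h (al q, q.2) * v.2)) :> (plane R -> R).
  move=> Vq; set D1 := dx h _; set D2 := dy h _.
  have [Np Eq] := (VN _ Vq, (alP _ Vq).2).
  have D1m : m <= D1 by case: Np => k1 k2 _; have [] := hr _ (ltW k1) (ltW k2).
  have D1p : 0 < D1 by exact: lt_le_trans D1m.
  pose df (v : plane R) := D1^-1 * (v.1 - D2 * v.2).
  have dfl : linear df.
    by move=> k u v; rewrite /df /= /GRing.scale /=; ring.
  pose dfL := GRing.isLinear.Build R (plane R) R _ df dfl.
  pose dfP : {linear plane R -> R} := HB.pack df dfL.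
  apply: (@eps_differentiable _ _ _ al q dfP).
    move=> x; apply: cvgM; first exact: cvg_cst.
    by apply: cvgB; [exact: cvg_fst|apply: cvgM; [exact: cvg_cst|exact: cvg_snd]].
  move=> eps eps0.
  have dh : differentiable h (al q, q.2) by have [] := ch _ (NO _ Np).
  (* [C'] is a Lipschitz constant of q |-> (al q, q.2) in the maximum norm, the 1 being for the
     second coordinate; [eps'] is scaled by it and by the division by [D1]. *)
  pose C' := Num.max C 1.
  have C'0 : 0 < C' by rewrite lt_max C0.
  pose eps' := eps * D1 / C'.
  have eps'0 : 0 < eps' by rewrite divr_gt0// mulr_gt0.
  have := differentiable_eps dh eps'0.
  have cpq : {for q, continuous (fun q => (al q, q.2))}.
    by apply: continuous_pair; [exact: cal|exact: snd_continuous].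
  move=> /cpq H; near=> q'.
  have : (fun y => `|h y - h (al q, q.2) - 'd h (al q, q.2) (y - (al q, q.2))| <=
     eps' * `|y - (al q, q.2)|) (al q', q'.2) by near: q'; exact: H.
  rewrite (diff_plane _ dh) -/D1 -/D2 Eq.
  have Vq' : V q' by near: q'; exact: open_near.
  have [_ ->] := alP _ Vq'; rewrite /= /GRing.scale /= => K.
  have E : al q' - al q - df (q' - q) =
    - (D1^-1 * (q'.1 - q.1 - ((al q' - al q) * D1 + (q'.2 - q.2) * D2))).
    rewrite /df /=; field; exact: lt0r_neq0.
  rewrite E normrN normrM gtr0_norm ?invr_gt0// mulrC ler_pdivrMr//.
  rewrite (le_trans K)//.
  rewrite (_ : eps * _ * D1 = eps' * (C' * `|q' - q|)); last first.
    by rewrite /eps'; field; exact: lt0r_neq0.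
  rewrite ler_pM2l//.
  rewrite prod_normE/= ge_max; apply/andP; split.
    by rewrite (le_trans (alC _ _ Vq Vq'))// ler_wpM2r// le_max lexx.
  rewrite (le_trans (normr_snd (q' - q)))// ler_peMl// le_max lexx orbT//.
pose dal v q := (dx h (al q, q.2))^-1 * (v.1 - dy h (al q, q.2) * v.2).
apply: (C1_on_formula (df := dal)) => //.
- by move=> q /key[].
- by move=> q v /key[k1 k2]; rewrite deriveE// k2.
- move=> q v Vq; have Np := VN _ Vq.
  have cpq : {for q, continuous (fun q => (al q, q.2))}.
    by apply: continuous_pair; [exact: cal|exact: snd_continuous].
  apply: cvgM.
    apply: cvgV; last exact: (continuous_comp cpq (C1_on_dx ch (NO _ Np))).
    case: Np => k1 k2 _; have [_ k3 _] := hr _ (ltW k1) (ltW k2).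
    by rewrite gt_eqF// (lt_le_trans m0).
  apply: cvgB; first exact: cvg_cst.
  apply: cvgM; last exact: cvg_cst.
  exact: (continuous_comp cpq (C1_on_dy ch (NO _ Np))).
Unshelve. all: by end_near. Qed.

End ImplicitFunction.

(** * Diffeomorphisms of the plane and their factorization through shears *)

Section Diffeo.
Context {R : realType}.
Implicit Types (p q : plane R) (O N V : set (plane R)) (h : plane R -> R)
  (k g : plane R -> plane R).

Definition jac k p : R :=
  (dx k p).1 * (dy k p).2 - (dy k p).1 * (dx k p).2.

Definition diffeo k N V g : Prop :=
  [/\ open N, open V, forall p, N p -> V (k p) /\ g (k p) = p,
      forall q, V q -> N (g q) /\ k (g q) = q & C1_on N k /\ C1_on V g].

Lemma continuous_open_preimage {T T' : topologicalType} (f : T -> T') (A : set T)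
    (B : set T') : open A -> open B -> (forall x, A x -> {for x, continuous f}) ->
  open (A `&` f @^-1` B).
Proof.
move=> oA oB cf; rewrite openE => x [Ax Bfx]; apply: filterI.
  exact: open_nbhs_nbhs.
by apply: (cf _ Ax); exact: open_nbhs_nbhs.
Qed.

Lemma diffeo_shrinkr k N V g V' : diffeo k N V g -> open V' -> V' `<=` V ->
  diffeo k (N `&` k @^-1` V') V' g.
Proof.
move=> [oN oV NV VN [ck cg]] oV' sV; split; [|by []| | |].
- apply: continuous_open_preimage => // x; exact: C1_on_continuous ck.
- by move=> p [/NV[]].
- by move=> q Vq; have [] := VN _ (sV _ Vq); split; [split|]; rewrite ?/preimage /= ?b.
- by split; [apply: C1_on_sub ck => ? []|exact: C1_on_sub cg].
Qed.

Lemma diffeo_shrinkl k N V g N' : diffeo k N V g -> open N' -> N' `<=` N ->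
  diffeo k N' (V `&` g @^-1` N') g.
Proof.
move=> [oN oV NV VN [ck cg]] oN' sN; split; [by []| | | |].
- apply: continuous_open_preimage => // x; exact: C1_on_continuous cg.
- by move=> p Np; have [] := NV _ (sN _ Np); split; [split|]; rewrite ?/preimage /= ?b.
- by move=> q [/VN[]].
- by split; [exact: C1_on_sub ck|apply: C1_on_sub cg => ? []].
Qed.

Lemma C1_on_comp_plane {W : normedModType R} O D (f : plane R -> W) k :
  open O -> (forall p, O p -> D (k p)) -> C1_on D f -> C1_on O k -> C1_on O (f \o k).
Proof.
move=> oO OD cf ck.
pose df v p := ('D_v k p).1 *: dx f (k p) + ('D_v k p).2 *: dy f (k p).
apply: (C1_on_formula (df := df)) => //.
- by move=> p Op; apply: differentiable_comp; [exact: C1_on_diff ck Op|exact: C1_on_diff cf (OD _ Op)].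
- move=> p v Op; have [dk _] := ck _ Op; have [dfp _] := cf _ (OD _ Op).
  by rewrite (derive_comp _ dk dfp) (derive_plane _ dfp).
- move=> p v Op; have [/differentiable_continuous k1 /(_ v) c1] := ck _ Op.
  apply: cvgD; apply: cvgZ.
  + exact: (continuous_comp c1 (@fst_continuous _ _ _ _)).
  + exact: (continuous_comp k1 (C1_on_dx cf (OD _ Op))).
  + exact: (continuous_comp c1 (@snd_continuous _ _ _ _)).
  + exact: (continuous_comp k1 (C1_on_dy cf (OD _ Op))).
Qed.

Lemma diffeo_comp k k' N V V' g g' : diffeo k N V g -> diffeo k' V V' g' ->
  diffeo (k' \o k) N V' (g \o g').
Proof.
move=> [oN oV NV VN [ck cg]] [_ oV' VV' V'V [ck' cg']]; split; [by []|by []| | |].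
- by move=> p /NV[/VV'[V'k E'] E]; split => //=; rewrite E' E.
- by move=> q /V'V[/VN[Ng E] E']; split => //=; rewrite E E'.
- split.
    by apply: C1_on_comp_plane ck' ck => // p /NV[].
  by apply: C1_on_comp_plane cg cg' => // p /V'V[].
Qed.

Lemma diffeo_eq k k' N V g : (forall p, N p -> k p = k' p) ->
  diffeo k N V g -> diffeo k' N V g.
Proof.
move=> kk' [oN oV NV VN [ck cg]]; split; [by []|by []| | |].
- by move=> p Np; rewrite -kk'//; exact: NV.
- by move=> q Vq; have [Ng E] := VN _ Vq; rewrite -kk'.
- by split; [exact: C1_on_eq ck|].
Qed.

Lemma dx_comp {W : normedModType R} (f : plane R -> W) k p :
  differentiable k p -> differentiable f (k p) ->
  dx (f \o k) p = (dx k p).1 *: dx f (k p) + (dx k p).2 *: dy f (k p).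
Proof.
move=> dk df; have -> : dx (f \o k) p = 'D_((1, 0) : plane R) (f \o k) p by rewrite dxE.
by rewrite (derive_comp _ dk df) (derive_plane _ df) -dxE.
Qed.

Lemma dy_comp {W : normedModType R} (f : plane R -> W) k p :
  differentiable k p -> differentiable f (k p) ->
  dy (f \o k) p = (dy k p).1 *: dx f (k p) + (dy k p).2 *: dy f (k p).
Proof.
move=> dk df; have -> : dy (f \o k) p = 'D_((0, 1) : plane R) (f \o k) p by rewrite dyE.
by rewrite (derive_comp _ dk df) (derive_plane _ df) -dyE.
Qed.

Lemma derive_fst_comp {V W W' : normedModType R} (f : V -> W * W') (p v : V) :
  differentiable f p -> 'D_v (fun x => (f x).1) p = ('D_v f p).1.
Proof.
move=> df; have d : differentiable (fst : W * W' -> W) (f p) by case: (@C1_on_fst _ _ _ setT (f p)).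
by rewrite -[LHS]/('D_v (fst \o f) p) (derive_comp _ df d) derive_fst.
Qed.

Lemma derive_snd_comp {V W W' : normedModType R} (f : V -> W * W') (p v : V) :
  differentiable f p -> 'D_v (fun x => (f x).2) p = ('D_v f p).2.
Proof.
move=> df; have d : differentiable (snd : W * W' -> W') (f p) by case: (@C1_on_snd _ _ _ setT (f p)).
by rewrite -[LHS]/('D_v (snd \o f) p) (derive_comp _ df d) derive_snd.
Qed.

(** The relation A u + v = 0 makes the rows u and v proportional, so their determinant vanishes. *)
Lemma det_elim (A u1 u2 v1 v2 : R) : 0 = A * u1 + v1 -> A * u2 + v2 = 0 ->
  u1 * v2 - v1 * u2 = 0.
Proof.
move=> h1 h2; have -> : v1 = - (A * u1) by lra.
have -> : v2 = - (A * u2) by lra.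
by ring.
Qed.

Lemma jac_comp k k' p : differentiable k p -> differentiable k' (k p) ->
  jac (k' \o k) p = jac k' (k p) * jac k p.
Proof.
move=> dk dk'; rewrite /jac (dx_comp dk dk') (dy_comp dk dk').
move: (dx k p) (dy k p) (dx k' _) (dy k' _) => u v a b.
by rewrite /= /GRing.scale /=; ring.
Qed.

Lemma jac_pair (k1 k2 : plane R -> R) p : differentiable k1 p -> differentiable k2 p ->
  jac (fun x => (k1 x, k2 x)) p = dx k1 p * dy k2 p - dy k1 p * dx k2 p.
Proof.
by move=> d1 d2; rewrite /jac !dxE !dyE (derive_pair _ d1 d2) (derive_pair _ d1 d2).
Qed.

Lemma jac_near_eq k k' p : (\forall x \near p, k x = k' x) -> jac k p = jac k' p.
Proof. by move=> kk'; rewrite /jac !dxE !dyE !(near_eq_derive _ kk'). Qed.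

Definition swap p : plane R := (p.2, p.1).

Lemma C1_on_swap O : open O -> C1_on O swap.
Proof. by move=> oO; apply: C1_on_pair; [exact: oO|exact: C1_on_snd|exact: C1_on_fst]. Qed.

Lemma jac_swap p : jac swap p = -1.
Proof.
have d1 : differentiable (fst : plane R -> R) p by case: (@C1_on_fst _ _ _ setT p).
have d2 : differentiable (snd : plane R -> R) p by case: (@C1_on_snd _ _ _ setT p).
rewrite /swap (jac_pair d2 d1) !dxE !dyE !derive_fst !derive_snd /=; ring.
Qed.

Lemma swapK : involutive swap.
Proof. by case. Qed.

Lemma diffeo_swap N V : open N -> open V -> (forall p, N p <-> V (swap p)) ->
  diffeo swap N V swap.
Proof.
move=> oN oV NV; split; [by []|by []| | |].
- by move=> p /NV ?; rewrite swapK.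
- by move=> q Vq; rewrite swapK; split => //; apply/NV; rewrite swapK.
- by split; exact: C1_on_swap.
Qed.

Lemma diffeo_straightens h N V al : straightens h N V al ->
  diffeo (fun p => (h p, p.2)) N V (fun q => (al q, q.2)).
Proof.
move=> [oN oV NV VN [ch cal]]; split; [by []|by []| | |].
- by move=> p /NV[Vp ->]; rewrite -surjective_pairing.
- by move=> q /VN[Nq /= ->]; rewrite -surjective_pairing.
- split.
    by apply: C1_on_pair; [exact: oN|exact: ch|exact: C1_on_snd].
  by apply: C1_on_pair; [exact: oV|exact: cal|exact: C1_on_snd].
Qed.

(** A negative slope is turned into a positive one by passing to [- h], which reflects the first
    coordinate on the image side. *)
Lemma implicit_function O h p0 : open O -> O p0 -> C1_on O h ->
  dx h p0 != 0 -> exists N V al, [/\ N p0, N `<=` O & straightens h N V al].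
Proof.
move=> oO Op0 ch; case: (ltgtP 0 (dx h p0)) => // h0 _.
  exact: implicit_function_pos h0.
have [dh _] := ch _ Op0.
have h0' : 0 < dx (fun x => - h x) p0.
  by rewrite dxE deriveN ?oppr_gt0 -?dxE//; exact: diff_derivable.
have [N [V [al [Np0 NO [oN oV NV VN [cmh cal]]]]]] :=
  implicit_function_pos oO Op0 (C1_onN oO ch) h0'.
pose neg q : plane R := (- q.1, q.2).
have cneg O' : open O' -> C1_on O' neg.
  by move=> oO'; apply: C1_on_pair; [|apply: C1_onN => //; exact: C1_on_fst|exact: C1_on_snd].
have oV' : open (neg @^-1` V).
  rewrite -[_ @^-1` _]setTI; apply: continuous_open_preimage => //; first exact: openT.
  by move=> x _; apply: C1_on_continuous (cneg _ openT) _.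
exists N, (neg @^-1` V), (al \o neg); split; [by []|by []|split; [by []|by []|by []| |]].
- by move=> q /VN[Nq E]; split => //; apply: oppr_inj; rewrite E.
- split; first exact: C1_on_sub ch.
  exact: C1_on_comp_plane cal (cneg _ oV').
Qed.

(* With [Phi (a, b) = (k1 (a, b), b)] straightened first, the map [k \o Phi^-1]
   keeps the first coordinate, so that the two-dimensional inverse function
   theorem reduces to the implicit function theorem applied twice. *)
Lemma factor_through_shear O k p0 : open O -> O p0 -> C1_on O k ->
  jac k p0 != 0 -> (dx k p0).1 != 0 ->
  exists N V al N' V' be, [/\ N p0 /\ N `<=` O,
    straightens (fun p => (k p).1) N V al,
    straightens (fun q => (k (al (swap q), q.1)).2) N' V' be,
    (forall q, N' q -> V (swap q)) & N' (swap ((k p0).1, p0.2))].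
Proof.
move=> oO Op0 ck jk k1; have [dk _] := ck _ Op0.
have ck1 : C1_on O (fun p => (k p).1) by exact: C1_on_fst_comp.
have ck2 : C1_on O (fun p => (k p).2) by exact: C1_on_snd_comp.
have k1' : dx (fun p => (k p).1) p0 != 0 by rewrite dxE (derive_fst_comp _ dk) -dxE.
have Dk1 : dx (fun p => (k p).1) p0 = (dx k p0).1 /\ dy (fun p => (k p).1) p0 = (dy k p0).1.
  by rewrite dxE dyE !(derive_fst_comp _ dk) -dxE -dyE.
have Dk2 : dx (fun p => (k p).2) p0 = (dx k p0).2 /\ dy (fun p => (k p).2) p0 = (dy k p0).2.
  by rewrite dxE dyE !(derive_snd_comp _ dk) -dxE -dyE.
have [N [V [al [Np0 NO S]]]] := implicit_function oO Op0 ck1 k1'.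
have [oN oV NV VN [_ cal]] := S.
have [Vq0 alq0] := NV _ Np0; set q0 := ((k p0).1, p0.2) in Vq0 alq0.
pose T q := (k (al (swap q), q.1)).2.
have Tnear : \forall q \near swap q0, V (swap q).
  have : {for swap q0, continuous swap} by exact: C1_on_continuous (C1_on_swap openT) _.
  by apply; rewrite swapK; exact: open_near.
pose VS := swap @^-1` V.
have oVS : open VS.
  rewrite /VS -[_ @^-1` _]setTI; apply: continuous_open_preimage => //; first exact: openT.
  by move=> x _; exact: C1_on_continuous (C1_on_swap openT) _.
have VSq0 : VS (swap q0) by rewrite /VS/preimage/= swapK.
have cA : C1_on VS (fun q => (al (swap q), q.1) : plane R).
  apply: C1_on_pair => //; last exact: C1_on_fst.
  by apply: (C1_on_comp_plane (D := V)) => //; exact: C1_on_swap.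
have cT : C1_on VS T.
  apply: (C1_on_comp_plane (f := fun p => (k p).2)) (C1_on_sub NO ck2) cA => //.
  by move=> q /VN[].
have [dal _] := cal _ Vq0.
have Eal : (k (al (swap (swap q0)), (swap q0).1)).1 = q0.1.
  by rewrite swapK; case: (VN _ Vq0).
have dT : dx T (swap q0) != 0.
  have Ak : (al (swap (swap q0)), (swap q0).1) = p0.
    by rewrite swapK alq0 /= -surjective_pairing.
  have [dA _] := cA _ VSq0.
  pose DA : plane R := dx (fun q => (al (swap q), q.1) : plane R) (swap q0).
  have DA2 : DA.2 = 1.
    rewrite /DA dxE -(derive_snd_comp _ dA) (_ : (fun x => _) = fst)//.
    by rewrite derive_fst.
  have K (f : plane R -> R) : differentiable f p0 ->
      dx (fun q => f (al (swap q), q.1)) (swap q0) = DA.1 * dx f p0 + dy f p0.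
    rewrite -Ak => df; rewrite -[LHS]/(dx (f \o (fun q => (al (swap q), q.1) : plane R)) (swap q0)).
    by rewrite (dx_comp dA df) -/DA DA2 scale1r.
  have K1 := K _ (C1_on_diff ck1 Op0); rewrite Dk1.1 Dk1.2 in K1.
  have K2 := K _ (C1_on_diff ck2 Op0); rewrite -/T Dk2.1 Dk2.2 in K2.
  (* By the choice of [al], the first component of [k] along this path is the second coordinate of
     [q], so it does not vary with the first one. Were the derivative of [T] also zero, the same
     combination of partial derivatives would kill both components of [k]. *)
  have E0 : dx (fun q => (k (al (swap q), q.1)).1) (swap q0) = 0.
    rewrite dxE (@near_eq_derive _ _ _ _ (snd : plane R -> R)); first by rewrite derive_snd.
    by apply: filterS Tnear => q /VN[_ ->].
  rewrite E0 in K1; rewrite K2; move: K1 jk; rewrite /jac; clearbody DA.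
  move: (dx k p0) (dy k p0) DA.1 => u v A K1 jk; apply: contra_neq jk => K2'.
  exact: det_elim K1 K2'.
have [N' [V' [be [N'q0 sN' S']]]] := implicit_function oVS VSq0 cT dT.
by exists N, V, al, N', V', be; split.
Qed.

End Diffeo.

(** * Change of variables in the plane *)

Section PlaneMeasurability.
Context {R : realType}.
Implicit Types (p q : plane R) (A B O : set (plane R)).

Definition rbox (a b r : rat) : set (plane R) :=
  box (ratr a, ratr b) (ratr r) (ratr r).

Lemma rational_box p A : nbhs p A ->
  exists a b r : rat, rbox a b r p /\ rbox a b r `<=` A.
Proof.
move=> /nbhs_box[s s0 sA].
have [r] : exists r : rat, ratr r \in `]0, (s / 2)[%R.
  by apply: rat_in_itvoo; rewrite divr_gt0.
rewrite in_itv/= => /andP[r0 rs].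
have [a] : exists a : rat, ratr a \in `](p.1 - ratr r), (p.1 + ratr r)[%R.
  by apply: rat_in_itvoo; move: r0; lra.
rewrite in_itv/= => ha.
have [b] : exists b : rat, ratr b \in `](p.2 - ratr r), (p.2 + ratr r)[%R.
  by apply: rat_in_itvoo; move: r0; lra.
rewrite in_itv/= => hb.
exists a, b, r; split; first by split => /=; rewrite ltr_norml; move: ha hb; lra.
move=> q [/= h1 h2]; apply: sA; split; move: h1 h2 ha hb rs;
  by rewrite !ltr_norml; lra.
Qed.

Lemma measurable_box p r s : measurable (box p r s).
Proof.
rewrite (_ : box p r s = [set x | `|x - p.1| < r] `*` [set x | `|x - p.2| < s])//.
have m (c t : R) : measurable [set x : R | `|x - c| < t].
  rewrite (_ : [set x | _] = `]c - t, c + t[%classic); first exact: measurable_itv.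
  apply/seteqP; split=> x /=; rewrite in_itv/= ltr_norml; lra.
by apply: measurableX; exact: m.
Qed.

(** Measurability in the plane refers to the product sigma-algebra; an open set belongs to it as a
    countable union of boxes with rational data. *)
Lemma open_plane_measurable O : open O -> measurable O.
Proof.
move=> oO; pose F a b r := if asbool (rbox a b r `<=` O) then rbox a b r else set0.
rewrite (_ : O = \bigcup_a \bigcup_b \bigcup_r F a b r).
  apply: bigcupT_measurable_rat => a; apply: bigcupT_measurable_rat => b.
  apply: bigcupT_measurable_rat => r; rewrite /F; case: ifPn => // _.
  exact: measurable_box.
apply/seteqP; split => [p Op|p [a _ [b _ [r _]]]].
  have [a [b [r [h1 h2]]]] := rational_box (open_near oO Op).
  by exists a => //; exists b => //; exists r => //; rewrite /F asboolT.
by rewrite /F; case: ifPn => // /asboolP; apply.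
Qed.

Lemma continuous_plane_measurable O (f : plane R -> R) : open O ->
  (forall p, O p -> {for p, continuous f}) -> measurable_fun O f.
Proof.
move=> oO cf; apply: (measurability _ (RGenOpens.measurableE R)).
move=> _ [_ [a [b ->] <-]]; apply: open_plane_measurable.
by apply: continuous_open_preimage => //; exact: interval_open.
Qed.

Lemma measurable_fun_planeP O (k : plane R -> plane R) : measurable O ->
  measurable_fun O (fun p => (k p).1) -> measurable_fun O (fun p => (k p).2) ->
  measurable_fun O k.
Proof.
move=> mO m1 m2.
apply: (measurability _ (@measurable_prod_measurableType _ _ R R)).
move=> _ [_ [A mA [B mB <-]] <-].
rewrite (_ : _ `&` _ = (O `&` (fun p => (k p).1) @^-1` A) `&`
                       (O `&` (fun p => (k p).2) @^-1` B)).
  by apply: measurableI; [exact: m1|exact: m2].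
by apply/seteqP; split => p /=; [move=> [? []]|move=> [[? ?] []]].
Qed.

Lemma continuous_plane_measurable2 O (k : plane R -> plane R) : open O ->
  (forall p, O p -> {for p, continuous k}) -> measurable_fun O k.
Proof.
move=> oO ck; apply: measurable_fun_planeP; first exact: open_plane_measurable.
  apply: (continuous_plane_measurable oO) => p Op.
  exact: (continuous_comp (ck _ Op) (@fst_continuous _ _ _ _)).
apply: (continuous_plane_measurable oO) => p Op.
exact: (continuous_comp (ck _ Op) (@snd_continuous _ _ _ _)).
Qed.

End PlaneMeasurability.

Section PushDensity.
Local Open Scope ereal_scope.
Context d d' (T : measurableType d) (T' : measurableType d') (R : realType)
  (mu : {measure set T -> \bar R}).
Variables (D : set T) (g : T -> T') (phi : T -> \bar R).
Hypotheses (mD : measurable D) (mg : measurable_fun D g)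
  (mphi : measurable_fun D phi) (phi0 : forall x, D x -> 0 <= phi x).

(** The image under [g] of the measure on [D] with density [phi]. The hypotheses are arguments so
    that the measure structure declared below can be attached to the term. *)
Definition push_density (mD : measurable D) (mg : measurable_fun D g)
    (mphi : measurable_fun D phi) (phi0 : forall x, D x -> 0 <= phi x)
    (B : set T') : \bar R :=
  \int[mu]_(x in D `&` g @^-1` B) phi x.

Local Notation nu := (push_density mD mg mphi phi0).

Let nu0 : nu set0 = 0.
Proof. by rewrite /push_density preimage_set0 setI0 integral_set0. Qed.

Let nu_ge0 B : 0 <= nu B.
Proof. by apply: integral_ge0 => x [Dx _]; exact: phi0. Qed.

Let nu_sigma : semi_sigma_additive nu.
Proof.
move=> F mF tF mUF; rewrite /push_density preimage_bigcup setI_bigcupr.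
have h1 k : measurable (D `&` g @^-1` F k) by exact: mg.
have h2 : measurable_fun (\bigcup_k (D `&` g @^-1` F k)) phi.
  by apply: (measurable_funS mD _ mphi) => x [i _ []].
have h3 x : (\bigcup_k (D `&` g @^-1` F k)) x -> 0 <= phi x.
  by move=> [i _ [Dx _]]; exact: phi0.
have h4 : trivIset setT (fun k => D `&` g @^-1` F k).
  move=> i j _ _ [x [[_ k1] [_ k2]]]; apply: (tF i j) => //.
  by exists (g x).
rewrite (ge0_integral_bigcup mu h1 h2 h3 h4).
apply: is_cvg_ereal_nneg_natsum_cond => n _ _.
by apply: integral_ge0 => x [Dx _]; exact: phi0.
Qed.

HB.instance Definition _ := isMeasure.Build _ _ _ nu nu0 nu_ge0 nu_sigma.

End PushDensity.

(** * Substitution on an interval, over arbitrary Borel sets *)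

Section ChangeOfVariables1.
Context {R : realType}.
Notation mu := (@lebesgue_measure R).
Implicit Types (a b c d : R) (g F phi : R -> R) (B : set R).

(* Both sides are finite measures of B, so half-lines suffice. *)
Lemma change_of_variables1_gen a b c d g F phi : c <= d ->
  measurable_fun `[a, b] g -> (forall x, x \in `[a, b] -> g x \in `[c, d]) ->
  measurable_fun `[c, d] F -> (forall x, x \in `[c, d] -> 0 <= F x) ->
  measurable_fun `[a, b] (fun x => F (g x) * phi x) ->
  (forall x, x \in `[a, b] -> 0 <= phi x) ->
  (\int[mu]_(x in `[c, d]) (F x)%:E < +oo)%E ->
  (forall y, c <= y <= d -> (\int[mu]_(x in `[y, d]) (F x)%:E =
     \int[mu]_(x in `[a, b] `&` g @^-1` `[y, +oo[) (F (g x) * phi x)%:E)%E) ->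
  forall B, measurable B -> (\int[mu]_(x in `[c, d] `&` B) (F x)%:E =
     \int[mu]_(x in `[a, b] `&` g @^-1` B) (F (g x) * phi x)%:E)%E.
Proof.
move=> cd mg gcd mF F0 mFg phi0 Foo H B mB.
have mab : measurable `[a, b]%classic by exact: measurable_itv.
have mcd : measurable `[c, d]%classic by exact: measurable_itv.
have mid : measurable_fun `[c, d]%classic (@id R) by exact: measurable_id.
have mF' : measurable_fun `[c, d]%classic (EFin \o F) by exact/measurable_EFinP.
have F0' x : `[c, d]%classic x -> (0 <= (EFin \o F) x)%E.
  by move=> xcd; rewrite lee_fin F0.
have mFg' : measurable_fun `[a, b]%classic (EFin \o (fun x => F (g x) * phi x)).
  exact/measurable_EFinP.
have Fg0' x : `[a, b]%classic x -> (0 <= (F (g x) * phi x)%:E)%E.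
  by move=> xab; rewrite lee_fin mulr_ge0 ?phi0// F0// gcd.
pose m1 := @push_density _ _ _ _ _ mu _ _ _ mcd mid mF' F0'.
pose m2 := @push_density _ _ _ _ _ mu _ _ _ mab mg mFg' Fg0'.
suff : m1 B = m2 B by [].
pose G := @RGenCInfty.G R.
apply: (measure_unique G (fun n => `[(- n%:R), +oo[%classic)) => //.
- exact: RGenCInfty.measurableE.
- move=> _ _ [x ->] [y ->]; exists (Num.max x y).
  apply/seteqP; split => z /=; rewrite !in_itv/= !andbT ge_max; first by case=> -> ->.
  by move=> /andP[].
- by move=> n; exists (- n%:R).
- apply/seteqP; split => // x _; exists (Num.bound `|x|) => //=.
  rewrite in_itv/= andbT lerNl (le_trans (ler_norm _))// normrN ltW//.
  exact: archi_boundP.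
- move=> _ [y ->]; rewrite /m1 /m2 /= /push_density.
  have [yc|cy] := leP y c.
    rewrite (_ : _ `&` _ = `[c, d]%classic); last first.
      apply/seteqP; split => x /=; rewrite !in_itv/= ?andbT; first by case.
      by move=> /andP[h1 h2]; rewrite h1 h2; split => //; exact: le_trans h1.
    rewrite (_ : _ `&` _ = `[a, b]%classic `&` g @^-1` `[c, +oo[%classic).
      by rewrite -H// lexx.
    apply/seteqP; split => x /= [xab]; have := gcd x xab; rewrite !in_itv/= !andbT.
      by move=> /andP[h1 h2] _.
    by move=> /andP[h1 h2] _; split => //; exact: le_trans h1.
  have [yd|dy] := leP y d.
    rewrite (_ : _ `&` _ = `[y, d]%classic); first by rewrite -H// (ltW cy).
    apply/seteqP; split => x /=; rewrite !in_itv/= ?andbT.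
      by move=> [/andP[_ ->] ->].
    by move=> /andP[h1 ->]; rewrite h1 (ltW (lt_le_trans cy h1)).
  rewrite (_ : _ `&` _ = set0); last first.
    apply/seteqP; split => x //=; rewrite !in_itv/= andbT => -[/andP[_ h1] h2].
    by have := lt_le_trans dy h2; rewrite ltNge h1.
  rewrite (_ : _ `&` _ = set0); first by rewrite !integral_set0.
  apply/seteqP; split => x //= [xab]; have := gcd x xab.
  rewrite !in_itv/= andbT => /andP[_ h1] h2.
  by have := lt_le_trans dy h2; rewrite ltNge h1.
- move=> n; apply: le_lt_trans Foo; rewrite /m1 /= /push_density.
  apply: ge0_subset_integral => //.
  by apply: measurableI => //; rewrite preimage_id; exact: measurable_itv.
Qed.

Lemma continuous_within_set (A : set R) F : (forall x, A x -> {for x, continuous F}) ->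
  {within A, continuous F}.
Proof. by move=> cF; apply: continuous_in_subspaceT => x /set_mem; exact: cF. Qed.

Lemma continuous_itv_measurable a b F : (forall x, x \in `[a, b] -> {for x, continuous F}) ->
  measurable_fun `[a, b] F.
Proof.
move=> cF; apply: subspace_continuous_measurable_fun; first exact: measurable_itv.
by apply: continuous_within_set => x xab; exact: cF.
Qed.

Lemma continuous_itv_integral_lty a b F : (forall x, x \in `[a, b] -> {for x, continuous F}) ->
  (\int[mu]_(x in `[a, b]) (F x)%:E < +oo)%E.
Proof.
move=> cF; have : mu.-integrable `[a, b] (EFin \o F).
  apply: continuous_compact_integrable; first exact: segment_compact.
  by apply: continuous_within_set => x xab; exact: cF.
move=> /integrable_fin_num H; rewrite ltey_eq; apply/orP; left; apply: H.
exact: measurable_itv.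
Qed.

Section Monotone.
Variables (O : set R) (a b : R) (g dg F : R -> R).
Hypotheses (oO : open O) (abO : forall x, a <= x <= b -> O x) (ab : a <= b)
  (g_dg : forall x, O x -> is_derive x 1 g (dg x) /\ {for x, continuous dg})
  (F_cont : forall x, a <= x <= b -> 0 <= F (g x) /\ {for g x, continuous F}).

Let g_cont x : O x -> {for x, continuous g}.
Proof. by move=> /g_dg[[dgx _] _]; exact/differentiable_continuous/derivable1_diffP. Qed.

Let dg_near x : O x -> \forall y \near x, dg y = derive1 g y.
Proof.
move=> Ox; apply: filterS (open_nbhs_nbhs (conj oO Ox)) => y /g_dg[[_ +] _].
by rewrite derive1E => ->.
Qed.

Let g'_cont x : O x -> {for x, continuous (derive1 g)}.
Proof.
move=> Ox; rewrite /prop_for /continuous_at -(nbhs_singleton (dg_near Ox)).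
exact/(cvg_trans _ (g_dg Ox).2)/near_eq_cvg/dg_near.
Qed.

Let g_surj c d y : a <= c -> d <= b -> c <= d ->
  Num.min (g c) (g d) <= y <= Num.max (g c) (g d) -> exists2 x, c <= x <= d & g x = y.
Proof.
move=> ac db cd hy; have [x] : exists2 x, x \in `[c, d]%R & g x = y.
  apply: IVT => //; apply: continuous_within_set => x /=; rewrite in_itv/= => /andP[h1 h2].
  by apply/g_cont/abO; rewrite (le_trans ac h1) (le_trans h2 db).
by rewrite in_itv/= => h1 h2; exists x.
Qed.

Let LR x y : a <= x -> y <= b -> x <= y -> derivable_oo_LRcontinuous g x y.
Proof.
move=> ax yb xy; have h z : x <= z <= y -> O z.
  by move=> /andP[h1 h2]; apply: abO; rewrite (le_trans ax h1) (le_trans h2 yb).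
split.
- move=> z; rewrite in_itv/= => /andP[h1 h2].
  by have /g_dg[[]] : O z by apply: h; rewrite !ltW.
- by apply: cvg_at_right_filter; apply: g_cont; apply: h; rewrite lexx xy.
- by apply: cvg_at_left_filter; apply: g_cont; apply: h; rewrite lexx xy.
Qed.

Let phi_meas phi : (forall x, O x -> {for x, continuous phi}) ->
  measurable_fun `[a, b] (fun x => F (g x) * phi x).
Proof.
move=> cphi; apply: continuous_itv_measurable => x; rewrite in_itv/= => hx.
apply: cvgM; last exact: cphi (abO hx).
exact: (continuous_comp (g_cont (abO hx)) (F_cont hx).2).
Qed.

(** For a half-line starting at y = g(x0), with x0 given by the intermediate value theorem,
    monotonicity makes the preimage exactly [x0, b], and there the formula is ordinary
    substitution. *)
Lemma change_of_variables1_incr : (forall x, a <= x <= b -> 0 < dg x) ->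
  forall B, measurable B -> (\int[mu]_(x in `[g a, g b] `&` B) (F x)%:E =
     \int[mu]_(x in `[a, b] `&` g @^-1` B) (F (g x) * dg x)%:E)%E.
Proof.
move=> dg0.
have gi : {in `[a, b] &, {homo g : x y / x < y}}.
  move=> x y; rewrite !in_itv/= => /andP[ax xb] /andP[ay yb] xy.
  have h z : x <= z <= y -> a <= z <= b.
    by move=> /andP[h1 h2]; rewrite (le_trans ax h1) (le_trans h2 yb).
  apply: (@gtr0_derive1_lt_cc _ g x y); rewrite ?in_itv/= ?lexx ?(ltW xy)//.
  - by move=> z; rewrite in_itv/= => /andP[h1 h2]; have /g_dg[[]] : O z by apply/abO/h; rewrite !ltW.
  - move=> z; rewrite in_itv/= => /andP[h1 h2].
    have hz : a <= z <= b by apply: h; rewrite !ltW.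
    by rewrite -(nbhs_singleton (dg_near (abO hz))) dg0.
  - by apply: continuous_within_set => z /=; rewrite in_itv/= => /h/abO/g_cont.
have gle x y : a <= x -> y <= b -> x <= y -> g x <= g y.
  move=> ax yb; rewrite le_eqVlt => /predU1P[->//|xy]; apply/ltW/gi => //; rewrite in_itv/=.
    by rewrite ax (le_trans (ltW xy)).
  by rewrite yb (le_trans ax (ltW xy)).
have Fc y : y \in `[g a, g b] -> 0 <= F y /\ {for y, continuous F}.
  rewrite in_itv/= => hy; have [|x hx <-] := g_surj (lexx a) (lexx b) ab (y := y); last exact: F_cont.
  by rewrite min_l ?max_r// gle.
apply: change_of_variables1_gen.
- exact: gle.
- by apply: continuous_itv_measurable => x; rewrite in_itv/= => /abO/g_cont.
- by move=> x; rewrite !in_itv/= => /andP[ax xb]; rewrite !gle.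
- by apply: continuous_itv_measurable => x /Fc[].
- by move=> x /Fc[].
- by apply: phi_meas => x /g_dg[].
- by move=> x; rewrite in_itv/= => /dg0/ltW.
- by apply: continuous_itv_integral_lty => x /Fc[].
- move=> y hy; have [|x0 hx0 Ex0] := g_surj (lexx a) (lexx b) ab (y := y).
    by rewrite min_l ?max_r// gle.
  case/andP: (hx0) => ax0 x0b.
  rewrite -Ex0 (@integration_by_substitution_increasing _ g F x0 b x0b).
  + rewrite (_ : _ `&` _ = `[x0, b]%classic).
      apply: eq_integral => x; rewrite inE/= in_itv/= => /andP[h1 h2].
      rewrite /= !fctE /= (nbhs_singleton (dg_near (x := x) _))//.
      by apply: abO; rewrite (le_trans ax0 h1).
    apply/seteqP; split => x /=; rewrite !in_itv/= andbT.
      move=> [/andP[ax xb] h]; rewrite xb andbT leNgt; apply/negP => xx0.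
      have : g x < g x0 by apply: gi; rewrite ?in_itv/= ?ax ?xb ?ax0 ?x0b.
      by rewrite ltNge h.
    by move=> /andP[h1 h2]; rewrite (le_trans ax0 h1) h2 gle.
  + move=> x z; rewrite !in_itv/= => /andP[h1 h2] /andP[h3 h4]; apply: gi.
      by rewrite in_itv/= h2 (le_trans ax0 h1).
    by rewrite in_itv/= h4 (le_trans ax0 h3).
  + move=> x; rewrite in_itv/= => /andP[h1 h2]; apply/g'_cont/abO.
    by rewrite (ltW h2) (le_trans ax0 (ltW h1)).
  + by apply/cvg_ex; exists (derive1 g x0); apply: cvg_at_right_filter; apply/g'_cont/abO.
  + by apply/cvg_ex; exists (derive1 g b); apply: cvg_at_left_filter; apply/g'_cont/abO; rewrite ab lexx.
  + exact: LR.
  + apply: continuous_within_set => z /=; rewrite in_itv/= => /andP[h1 h2].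
    by have [] := Fc z; rewrite // in_itv/= h2 andbT (le_trans _ h1)// gle.
Qed.

(** Mirror image of the increasing case: the preimage of the half-line from g(x0) is now [a, x0],
    and [- dg] is the positive density. *)
Lemma change_of_variables1_decr : (forall x, a <= x <= b -> dg x < 0) ->
  forall B, measurable B -> (\int[mu]_(x in `[g b, g a] `&` B) (F x)%:E =
     \int[mu]_(x in `[a, b] `&` g @^-1` B) (F (g x) * - dg x)%:E)%E.
Proof.
move=> dg0.
have gi : {in `[a, b] &, {homo g : x y /~ x < y}}.
  move=> y x; rewrite !in_itv/= => /andP[ay yb] /andP[ax xb] xy.
  have h z : x <= z <= y -> a <= z <= b.
    by move=> /andP[h1 h2]; rewrite (le_trans ax h1) (le_trans h2 yb).
  apply: (@ltr0_derive1_lt_cc _ g x y); rewrite ?in_itv/= ?lexx ?(ltW xy)//.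
  - by move=> z; rewrite in_itv/= => /andP[h1 h2]; have /g_dg[[]] : O z by apply/abO/h; rewrite !ltW.
  - move=> z; rewrite in_itv/= => /andP[h1 h2].
    have hz : a <= z <= b by apply: h; rewrite !ltW.
    by rewrite -(nbhs_singleton (dg_near (abO hz))) dg0.
  - by apply: continuous_within_set => z /=; rewrite in_itv/= => /h/abO/g_cont.
have gle x y : a <= x -> y <= b -> x <= y -> g y <= g x.
  move=> ax yb; rewrite le_eqVlt => /predU1P[->//|xy]; apply/ltW/gi => //; rewrite in_itv/=.
    by rewrite yb (le_trans ax (ltW xy)).
  by rewrite ax (le_trans (ltW xy)).
have Fc y : y \in `[g b, g a] -> 0 <= F y /\ {for y, continuous F}.
  rewrite in_itv/= => hy; have [|x hx <-] := g_surj (lexx a) (lexx b) ab (y := y); last exact: F_cont.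
  by rewrite min_r ?max_l// gle.
apply: change_of_variables1_gen.
- exact: gle.
- by apply: continuous_itv_measurable => x; rewrite in_itv/= => /abO/g_cont.
- by move=> x; rewrite !in_itv/= => /andP[ax xb]; rewrite !gle.
- by apply: continuous_itv_measurable => x /Fc[].
- by move=> x /Fc[].
- by apply: phi_meas => x /g_dg[_ cdg]; exact: cvgN.
- by move=> x; rewrite in_itv/= oppr_ge0 => /dg0/ltW.
- by apply: continuous_itv_integral_lty => x /Fc[].
- move=> y hy; have [|x0 hx0 Ex0] := g_surj (lexx a) (lexx b) ab (y := y).
    by rewrite min_r ?max_l// gle.
  case/andP: (hx0) => ax0 x0b.
  rewrite -Ex0 (@integration_by_substitution_decreasing _ g F a x0 ax0).
  + rewrite (_ : _ `&` _ = `[a, x0]%classic).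
      apply: eq_integral => x; rewrite inE/= in_itv/= => /andP[h1 h2].
      rewrite /= !fctE /= (nbhs_singleton (dg_near (x := x) _))//.
      by apply: abO; rewrite h1 (le_trans h2).
    apply/seteqP; split => x /=; rewrite !in_itv/= andbT.
      move=> [/andP[ax xb] h]; rewrite ax leNgt; apply/negP => xx0.
      have : g x < g x0 by apply: gi; rewrite ?in_itv/= ?ax ?xb ?ax0 ?x0b.
      by rewrite ltNge h.
    by move=> /andP[h1 h2]; rewrite (le_trans h2 x0b) h1 gle.
  + move=> x z; rewrite !in_itv/= => /andP[h1 h2] /andP[h3 h4]; apply: gi.
      by rewrite in_itv/= h1 (le_trans h2 x0b).
    by rewrite in_itv/= h3 (le_trans h4 x0b).
  + move=> x; rewrite in_itv/= => /andP[h1 h2]; apply/g'_cont/abO.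
    by rewrite (ltW h1) (le_trans (ltW h2) x0b).
  + by apply/cvg_ex; exists (derive1 g a); apply: cvg_at_right_filter; apply/g'_cont/abO; rewrite ab lexx.
  + by apply/cvg_ex; exists (derive1 g x0); apply: cvg_at_left_filter; apply/g'_cont/abO.
  + exact: LR.
  + apply: continuous_within_set => z /=; rewrite in_itv/= => /andP[h1 h2].
    by have [] := Fc z; rewrite // in_itv/= h2 andbT (le_trans _ h1)// gle.
Qed.

End Monotone.

End ChangeOfVariables1.

(** * The change of variables formula for diffeomorphisms of the plane *)

Section ChangeOfVariables2.
Context {R : realType}.
Notation mu := (@lebesgue_measure R).
Notation mu2 := (mu \x mu)%E.
Implicit Types (p q : plane R) (O N V B : set (plane R)) (h : plane R -> R)
  (k g : plane R -> plane R) (f : plane R -> R).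

Definition nonneg_cont f V := forall q, V q -> 0 <= f q /\ {for q, continuous f}.

(* The continuity of f is asked on a set V that is larger than the image of N. *)
Definition cov k V N := forall f, nonneg_cont f V ->
  forall B, measurable B -> B `<=` k @` N ->
  (\int[mu2]_(q in B) (f q)%:E =
   \int[mu2]_(p in N `&` k @^-1` B) (f (k p) * `|jac k p|)%:E)%E.

Lemma measurable_EFin_plane f B V : open V -> nonneg_cont f V -> measurable B ->
  B `<=` V -> measurable_fun setT ((fun q => (f q)%:E) \_ B).
Proof.
move=> oV cf mB BV.
suff m : measurable_fun B (EFin \o f) by exact: ((measurable_restrictT _ mB).1 m).
apply/measurable_EFinP; apply: (measurable_funS (open_plane_measurable oV) BV).
by apply: (continuous_plane_measurable oV) => q /cf[].
Qed.

Lemma measurable_preimage_plane k N V g B : diffeo k N V g -> measurable B ->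
  measurable (N `&` k @^-1` B).
Proof.
move=> [oN _ _ _ [ck _]] mB.
have mk : measurable_fun N k.
  by apply: (continuous_plane_measurable2 oN) => p; exact: C1_on_continuous ck.
by apply: mk => //; exact: open_plane_measurable.
Qed.

Lemma continuous_jac O k p : C1_on O k -> O p -> {for p, continuous (jac k)}.
Proof.
move=> ck Op.
have c1 := C1_on_dx ck Op; have c2 := C1_on_dy ck Op.
have c11 := continuous_comp c1 (@fst_continuous _ _ _ _).
have c12 := continuous_comp c1 (@snd_continuous _ _ _ _).
have c21 := continuous_comp c2 (@fst_continuous _ _ _ _).
have c22 := continuous_comp c2 (@snd_continuous _ _ _ _).
by apply: cvgB; [exact: (cvgM c11 c22)|exact: (cvgM c21 c12)].
Qed.

Lemma nonneg_cont_pull k N V g f : diffeo k N V g -> nonneg_cont f V ->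
  nonneg_cont (fun p => f (k p) * `|jac k p|) N.
Proof.
move=> [oN _ NV _ [ck _]] cf p Np; have [Vk _] := NV _ Np; have [f0 cfk] := cf _ Vk.
split; first by rewrite mulr_ge0.
apply: cvgM; first exact: (continuous_comp (C1_on_continuous ck Np) cfk).
exact: (continuous_comp (continuous_jac ck Np) (@norm_continuous _ _ _)).
Qed.

(** The formula for [k'] produces the integrand f(k') |jac k'|, which is again nonnegative and
    continuous, so that the formula for [k] applies to it. This is why [cov] quantifies over all
    such functions and not over indicators only. *)
Lemma cov_comp k k' N0 V0 V0' g g' N N' : diffeo k N0 V0 g -> diffeo k' V0 V0' g' ->
  N `<=` N0 -> N' `<=` V0 -> open N' -> cov k V0 N -> cov k' V0' N' ->
  cov (k' \o k) V0' (N `&` k @^-1` N').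
Proof.
move=> dk dk' sN sN' oN' ck ck' f cf B mB BkN.
have dk's := diffeo_shrinkl dk' oN' sN'.
have [_ _ NV VN [C1k C1g]] := dk; have [_ _ V'V VV' [C1k' _]] := dk'.
have BN' : B `<=` k' @` N' by move=> q /BkN[p [Np N'kp] <-]; exists (k p).
have mB' : measurable (N' `&` k' @^-1` B) by exact: measurable_preimage_plane dk's mB.
have B'N : N' `&` k' @^-1` B `<=` k @` N.
  move=> q [N'q] /BkN[p [Np N'kp] /= E]; exists p => //.
  have [_ <-] := V'V _ (sN' _ N'q); have [_ <-] := V'V _ (sN' _ N'kp).
  by rewrite /= E.
have -> := ck' _ cf _ mB BN'.
have -> := ck _ (nonneg_cont_pull dk' cf) _ mB' B'N.
rewrite (_ : (_ `&` _) = (N `&` k @^-1` N') `&` (k' \o k) @^-1` B).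
  apply: eq_integral => p /set_mem [[Np N'p] _].
  have dkp := C1_on_diff C1k (sN _ Np).
  have dk'p : differentiable k' (k p) by apply: C1_on_diff C1k' (sN' _ N'p).
  by rewrite (jac_comp dkp dk'p) normrM mulrA.
by apply/seteqP; split => p /=; [move=> [? []]|move=> [[]]].
Qed.

Lemma cov_eq k k' V N : open N -> (forall p, N p -> k p = k' p) ->
  cov k V N -> cov k' V N.
Proof.
move=> oN kk' ck f cf B mB BN; have BN' : B `<=` k @` N by move=> q /BN[p Np <-]; exists p => //; rewrite (kk' _ Np).
have -> := ck _ cf _ mB BN'; rewrite (_ : N `&` k @^-1` B = N `&` k' @^-1` B).
  apply: eq_integral => p /set_mem [Np _]; rewrite (kk' _ Np).
  rewrite (@jac_near_eq _ k k'); first by [].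
  apply: filterS (open_near oN Np) => x; exact: kk'.
by apply/seteqP; split => p [Np]; rewrite /preimage/= (kk' _ Np).
Qed.

Lemma cov_sub k N0 V0 g N N' : diffeo k N0 V0 g -> N' `<=` N -> N `<=` N0 ->
  cov k V0 N -> cov k V0 N'.
Proof.
move=> [_ _ NV _ _] s1 s2 ck f cf B mB BN'.
have BN : B `<=` k @` N by move=> q /BN'[p N'p <-]; exists p => //; exact: s1.
have -> := ck _ cf _ mB BN.
rewrite (_ : N `&` k @^-1` B = N' `&` k @^-1` B)//.
apply/seteqP; split => p [Np Bp]; split => //; last exact: s1.
have [p' N'p' E] := BN' _ Bp; suff -> : p = p' by [].
by have [_ <-] := NV _ (s2 _ Np); have [_ <-] := NV _ (s2 _ (s1 _ N'p')); rewrite E.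
Qed.

(** The two iterated integrals of Tonelli's theorem are exchanged by [swap], whose Jacobian is
    -1. *)
Lemma cov_swap N V : diffeo swap N V swap -> cov swap V N.
Proof.
move=> ds f cf B mB BN; have [oN oV NV VN _] := ds.
have BV : B `<=` V by move=> q /BN[p /NV[+ _] <-].
rewrite (_ : N `&` _ = swap @^-1` B); last first.
  apply/seteqP; split => p; first by case.
  move=> Bp; split => //; have [p' N'p' E] := BN _ Bp.
  by rewrite -(swapK p) -E swapK.
rewrite integral_mkcond [RHS]integral_mkcond.
have mf := measurable_EFin_plane oV cf mB BV.
have f0 q : (0 <= ((fun q => (f q)%:E) \_ B) q)%E.
  by apply: erestrict_ge0 => {}q /BV/cf[]; rewrite lee_fin.
have Es : (fun p => (f (swap p) * `|jac swap p|)%:E) \_ (swap @^-1` B) =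
    ((fun q => (f q)%:E) \_ B) \o swap.
  apply/funext => p; rewrite /= !patchE /= jac_swap normrN normr1 mulr1.
  by rewrite /preimage /mem /= /in_mem.
rewrite Es fubini_tonelli1//.
have ms : measurable_fun setT (swap : plane R -> plane R).
  by apply: measurable_fun_pair.
by rewrite fubini_tonelli2; [|exact: measurableT_comp|move=> x; exact: f0].
Qed.

Lemma straightens_dx h N V al p : straightens h N V al -> N p -> dx h p != 0.
Proof.
move=> [oN oV NV VN [ch cal]] Np; have [Vp _] := NV _ Np.
have dal := C1_on_diff cal Vp; have dh := C1_on_diff ch Np.
have d2 : differentiable (snd : plane R -> R) p by case: (@C1_on_snd _ _ _ setT p).
have : 'D_((1, 0) : plane R) (fun x => al (h x, x.2)) p = 1.
  rewrite (@near_eq_derive _ _ _ _ (fst : plane R -> R)) ?derive_fst//.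
  by apply: filterS (open_near oN Np) => x /NV[].
rewrite (derive_comp2 _ dh d2 dal) derive_snd /= mul0r addr0 -dxE => E.
by apply/eqP => h0; move: E; rewrite h0 mul0r => /eqP; rewrite eq_sym oner_eq0.
Qed.

(** The map fixes the second coordinate, so by Tonelli it suffices to substitute x |-> h(x, y) on
    each horizontal slice. The set [N1] is a box on which [dx h] has one sign, the slices being then
    strictly monotone. *)
Lemma cov_straightens h N V al p0 : straightens h N V al -> N p0 ->
  exists N1, [/\ open N1, N1 p0, N1 `<=` N & cov (fun p => (h p, p.2)) V N1].
Proof.
move=> S Np0; have dS := diffeo_straightens S.
have [oN oV NV VN [ch cal]] := S.
have h0 := straightens_dx S Np0.
have [r r0 [rN sgn]] : exists2 r, 0 < r & (forall p, `|p.1 - p0.1| <= r ->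
    `|p.2 - p0.2| <= r -> N p) /\ ((forall p, `|p.1 - p0.1| <= r ->
    `|p.2 - p0.2| <= r -> 0 < dx h p) \/ (forall p, `|p.1 - p0.1| <= r ->
    `|p.2 - p0.2| <= r -> dx h p < 0)).
  have cdx := C1_on_dx ch Np0.
  have [s0|s0] : dx h p0 < 0 \/ 0 < dx h p0.
    by case: (ltgtP (dx h p0) 0) h0 => //; [left|right].
  (* Halving the radius leaves a closed box inside the region, as substitution is used on closed
     intervals. *)
  - have H : \forall p \near p0, N p /\ dx h p < 0.
      apply: filterI; first exact: open_near.
      exact: (cvgr_lt _ cdx).
    have [r r0 rH] := (nbhs_box _ _).1 H; exists (r / 2); first by rewrite divr_gt0.
    have rb p : `|p.1 - p0.1| <= r / 2 -> `|p.2 - p0.2| <= r / 2 -> box p0 r r p.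
      by move=> k1 k2; split; [apply: le_lt_trans k1 _|apply: le_lt_trans k2 _]; lra.
    split; first by move=> p k1 k2; case: (rH _ (rb _ k1 k2)).
    by right => p k1 k2; case: (rH _ (rb _ k1 k2)).
  - have H : \forall p \near p0, N p /\ 0 < dx h p.
      apply: filterI; first exact: open_near.
      exact: (cvgr_gt _ cdx).
    have [r r0 rH] := (nbhs_box _ _).1 H; exists (r / 2); first by rewrite divr_gt0.
    have rb p : `|p.1 - p0.1| <= r / 2 -> `|p.2 - p0.2| <= r / 2 -> box p0 r r p.
      by move=> k1 k2; split; [apply: le_lt_trans k1 _|apply: le_lt_trans k2 _]; lra.
    split; first by move=> p k1 k2; case: (rH _ (rb _ k1 k2)).
    by left => p k1 k2; case: (rH _ (rb _ k1 k2)).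
pose N1 := box p0 r r.
have N1N : N1 `<=` N by move=> p [k1 k2]; apply: rN; exact: ltW.
exists N1; split => //; first exact: open_box.
  by split; rewrite subrr normr0.
set Phi := fun p => (h p, p.2); move=> f cf B mB BN1.
have BV : B `<=` V by move=> q /BN1[p /N1N/NV[+ _] <-].
have mN1B : measurable (N1 `&` Phi @^-1` B).
  by apply: (measurable_preimage_plane (diffeo_shrinkl dS _ N1N)) => //; exact: open_box.
have jacE p : N p -> jac Phi p = dx h p.
  move=> Np; have d2 : differentiable (snd : plane R -> R) p by case: (@C1_on_snd _ _ _ setT p).
  by rewrite (jac_pair (C1_on_diff ch Np) d2) (dxE snd) (dyE snd) !derive_snd /= mulr1 mulr0 subr0.
have cfp := nonneg_cont_pull dS cf.
rewrite integral_mkcond [RHS]integral_mkcond.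
have m1 := measurable_EFin_plane oV cf mB BV.
have m2 := measurable_EFin_plane oN cfp mN1B (fun x hx => N1N x hx.1).
rewrite fubini_tonelli2; [|exact: m1|]; last first.
  by move=> q; apply: erestrict_ge0 => {}q /BV/cf[]; rewrite lee_fin.
rewrite fubini_tonelli2; [|exact: m2|]; last first.
  by move=> p; apply: erestrict_ge0 => {}p [/N1N/cfp[] + _ _]; rewrite lee_fin.
apply: eq_integral => y _; rewrite /fubini_G.
pose By := [set x | B (x, y)].
have mBy : measurable By by have := measurable_ysection y mB; rewrite /ysection/= => /= m; rewrite (_ : By = [set x | (x, y) \in B])//; apply/seteqP; split => x /=; rewrite inE.
rewrite (_ : (fun x => ((fun q => (f q)%:E) \_ B) (x, y)) = (fun x => (f (x, y))%:E) \_ By); last first.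
  by apply/funext => x; rewrite !patchE.
pose Ay := [set x | N1 (x, y) /\ B (h (x, y), y)].
rewrite (_ : (fun x => ((fun p => (f (Phi p) * `|jac Phi p|)%:E) \_ (N1 `&` Phi @^-1` B)) (x, y)) =
    (fun x => (f (h (x, y), y) * `|jac Phi (x, y)|)%:E) \_ Ay); last first.
  by apply/funext => x; rewrite !patchE.
rewrite -!integral_mkcond.
have [yr|yr] := ltP `|y - p0.2| r; last first.
  rewrite (_ : By = set0); last first.
    apply/seteqP; split => x // /BN1[p [_ k2] [_ E]].
    by move: k2; rewrite E => /lt_le_trans/(_ yr); rewrite ltxx.
  rewrite (_ : Ay = set0) ?integral_set0//.
  apply/seteqP; split => x // [[_ /= k2] _].
  by have := lt_le_trans k2 yr; rewrite ltxx.
pose a := p0.1 - r; pose b := p0.1 + r.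
have abP x : a <= x <= b -> `|x - p0.1| <= r.
  by rewrite /a /b ler_norml; lra.
pose O := [set x | N (x, y)].
have cy (x : R) : {for x, continuous (fun x : R => (x, y))}.
  by apply: continuous_pair => //; exact: cst_continuous.
have oO : open O.
  rewrite (_ : O = setT `&` (fun x => (x, y)) @^-1` N); last by rewrite setTI.
  by apply: continuous_open_preimage => //; exact: openT.
have abO x : a <= x <= b -> O x by move=> /abP k1; apply: rN => //; exact: ltW.
have ab : a <= b by rewrite /a /b; move: r0; lra.
have g_dg x : O x -> is_derive x 1 (fun x => h (x, y)) (dx h (x, y)) /\
    {for x, continuous (fun x => dx h (x, y))}.
  move=> Ox; split; first by apply: is_derive_sectl; exact: C1_on_diff ch Ox.
  exact: (continuous_comp (cy x) (C1_on_dx ch Ox)).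
have F_cont x : a <= x <= b -> 0 <= f (h (x, y), y) /\
    {for h (x, y), continuous (fun z => f (z, y))}.
  move=> /abO Ox; have [Vq _] := NV _ Ox; have [f0 cfq] := cf _ Vq; split => //.
  exact: (continuous_comp (cy (h (x, y))) cfq).
(* The open slice may be replaced by the closed segment: a point of the segment sent into [B] has
   the same image as a point of [N1], and the map is injective on [N]. *)
have AyE : Ay = `[a, b]%classic `&` (fun x => h (x, y)) @^-1` By.
  apply/seteqP; split => x.
    move=> [[/= k1 _] k2]; split => //; rewrite /= in_itv/= /a /b.
    by move: k1; rewrite ltr_norml; lra.
  rewrite /= in_itv/= => -[k1 k2]; split => //.
  have [p N1p E] := BN1 _ k2; suff <- : p = (x, y) by [].
  have Nx : N (x, y) by exact: abO.
  have [_ E1] := NV _ (N1N _ N1p); have [_ E2] := NV _ Nx.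
  move: E; rewrite [p]surjective_pairing /Phi /= -surjective_pairing => -[E3 E4].
  by rewrite [p]surjective_pairing -E1 E4 E3 E2.
have Byi c d : (forall x, a <= x <= b -> c <= h (x, y) <= d) -> `[c, d]%classic `&` By = By.
  move=> H; apply/seteqP; split => x; first by case.
  move=> Bx; split => //; have [p [k1 k2] [E1 E2]] := BN1 _ Bx.
  rewrite /= in_itv/= -E1 [p]surjective_pairing E2; apply: H.
  by move: k1; rewrite ltr_norml /a /b; lra.
have mono (s : R) : (forall x, a <= x <= b -> 0 <= s * dx h (x, y)) ->
    forall x x', a <= x -> x' <= b -> x <= x' -> s * h (x, y) <= s * h (x', y).
  move=> hs x x' ax x'b xx'; rewrite -subr_ge0 -mulrBr.
  have hz z : x <= z <= x' -> a <= z <= b.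
    by move=> /andP[k1 k2]; rewrite (le_trans ax k1) (le_trans k2 x'b).
  have := @mean_value_le _ (fun x => s * h (x, y)) (fun x => s * dx h (x, y)) x x' 0 xx'.
  rewrite mul0r mulrBr; apply => z /hz hzz; last exact: hs.
  by apply: is_deriveZ; exact: (g_dg z (abO _ hzz)).1.
rewrite AyE; case: sgn => sgn.
- have sgn' x : a <= x <= b -> 0 < dx h (x, y) by move=> /abP k1; apply: sgn => //; exact: ltW.
  have mn := mono 1 (fun x hx => ltac:(rewrite mul1r; exact: ltW (sgn' x hx))).
  have := change_of_variables1_incr oO abO ab g_dg F_cont sgn' mBy.
  rewrite Byi; last first.
    move=> x /andP[k1 k2]; have := mn a x (lexx _) k2 k1; have := mn x b k1 (lexx _) k2.
    by rewrite !mul1r => -> ->.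
  move=> ->; apply: eq_integral => x /set_mem [/= + _]; rewrite in_itv/= => hx.
  by rewrite (jacE _ (abO _ hx)) ger0_norm// ltW// sgn'.
- have sgn' x : a <= x <= b -> dx h (x, y) < 0 by move=> /abP k1; apply: sgn => //; exact: ltW.
  have mn := mono (-1) (fun x hx => ltac:(rewrite mulN1r oppr_ge0; exact: ltW (sgn' x hx))).
  have := change_of_variables1_decr oO abO ab g_dg F_cont sgn' mBy.
  rewrite Byi; last first.
    move=> x /andP[k1 k2]; have := mn a x (lexx _) k2 k1; have := mn x b k1 (lexx _) k2.
    by rewrite !mulN1r !lerN2 => -> ->.
  move=> ->; apply: eq_integral => x /set_mem [/= + _]; rewrite in_itv/= => hx.
  by rewrite (jacE _ (abO _ hx)) ler0_norm// ltW// sgn'.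
Qed.

Lemma straightens_shrink h N V al V' : straightens h N V al -> open V' -> V' `<=` V ->
  straightens h (N `&` (fun p => (h p, p.2)) @^-1` V') V' al.
Proof.
move=> S oV' sV; have [oN oV NV VN [ch cal]] := S.
have [oN' _ _ _ _] := diffeo_shrinkr (diffeo_straightens S) oV' sV.
split; [by []|by []| | |].
- by move=> p [Np V'p]; split => //; exact: (NV _ Np).2.
- move=> q V'q; have [Nq E] := VN _ (sV _ V'q); split => //; split => //.
  by rewrite /preimage/= E -surjective_pairing.
- by split; [apply: C1_on_sub ch => p []|exact: C1_on_sub cal].
Qed.

(** The diffeomorphism keeps a fixed domain [N] while the integral formula is asserted only near
    [p0], so that compositions do not have to shrink domains twice. *)
Definition local_cov k N V g p0 := diffeo k N V g /\
  exists N', [/\ open N', N' p0, N' `<=` N & cov k V N'].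

Lemma local_cov_comp k k' N0 V0 V0' g g' p0 : N0 p0 ->
  local_cov k N0 V0 g p0 -> local_cov k' V0 V0' g' (k p0) ->
  local_cov (k' \o k) N0 V0' (g \o g') p0.
Proof.
move=> Np0 [dk [N [oN Np sN ck]]] [dk' [N' [oN' N'kp sN' ck']]].
split; first exact: diffeo_comp dk dk'.
exists (N `&` k @^-1` N'); split => //.
- apply: continuous_open_preimage => // p Np'; have [_ _ _ _ [C1k _]] := dk.
  exact: C1_on_continuous C1k (sN _ Np').
- by move=> p [/sN].
- exact: (cov_comp dk dk' sN sN' oN' ck ck').
Qed.

Lemma local_cov_eq k k' N V g p0 : (forall p, N p -> k p = k' p) ->
  local_cov k N V g p0 -> local_cov k' N V g p0.
Proof.
move=> kk' [dk [N' [oN' N'p sN' ck]]]; split; first exact: diffeo_eq dk.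
by exists N'; split => //; apply: cov_eq ck => // p /sN'; exact: kk'.
Qed.

Lemma local_cov_swap N V p0 : open N -> open V -> (forall p, N p <-> V (swap p)) ->
  N p0 -> local_cov swap N V swap p0.
Proof.
move=> oN oV NV Np0; have ds := diffeo_swap oN oV NV.
by split; [|exists N; split => //; exact: cov_swap].
Qed.

Lemma local_cov_straightens h N V al p0 : straightens h N V al -> N p0 ->
  local_cov (fun p => (h p, p.2)) N V (fun q => (al q, q.2)) p0.
Proof.
by move=> S Np0; split; [exact: diffeo_straightens|exact: cov_straightens S Np0].
Qed.

Lemma open_swap V : open V -> open (swap @^-1` V).
Proof.
move=> oV; rewrite -[_ @^-1` _]setTI; apply: continuous_open_preimage => //; first exact: openT.
by move=> x _; exact: C1_on_continuous (C1_on_swap openT) _.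
Qed.

(** Near [p0] the map is shear, swap, shear, swap: (p1, p2) goes to (k1, p2), to (p2, k1), to (k2,
    k1), and to (k1, k2). Each factor satisfies the formula. *)
Lemma local_change_of_variables1 O k p0 : open O -> O p0 -> C1_on O k ->
  jac k p0 != 0 -> (dx k p0).1 != 0 ->
  exists N V g, [/\ N p0, N `<=` O & local_cov k N V g p0].
Proof.
move=> oO Op0 ck jk k1.
have [N [V [al [N' [V' [be [[Np0 NO] S S' N'V N'q]]]]]]] :=
  factor_through_shear oO Op0 ck jk k1.
have [oN' oV' N'V' _ _] := S'; pose W := swap @^-1` N'.
have oW : open W by exact: open_swap.
have WV : W `<=` V by move=> q /N'V; rewrite swapK.
have S2 := straightens_shrink S oW WV; set N2 := _ `&` _ in S2.
have N2p0 : N2 p0 by split.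
have L1 := local_cov_straightens S2 N2p0.
have Wq : W ((k p0).1, p0.2) by [].
have L2 : local_cov swap W N' swap ((k p0).1, p0.2) by apply: local_cov_swap.
have L3 := local_cov_straightens S' N'q.
have V'q := (N'V' _ N'q).1.
have H p : V' p <-> (swap @^-1` V') (swap p) by rewrite /preimage/= swapK.
have L4 := local_cov_swap oV' (open_swap oV') H V'q.
have L12 := local_cov_comp N2p0 L1 L2.
have L123 := local_cov_comp N2p0 L12 L3.
have L := local_cov_comp N2p0 L123 L4.
exists N2, (swap @^-1` V'); eexists; split; first exact: N2p0.
  by move=> p [/NO].
apply: local_cov_eq L => p [Np _] /=.
have [_ _ NV _ _] := S; have [_ E] := NV _ Np.
by rewrite /swap /= E -!surjective_pairing.
Qed.

(** If the first component has zero slope in the first direction, the nonzero Jacobian forces a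
    nonzero slope in the second one; precomposing with [swap] gives back the previous case. *)
Lemma local_change_of_variables O k p0 : open O -> O p0 -> C1_on O k ->
  jac k p0 != 0 -> exists N V g, [/\ N p0, N `<=` O & local_cov k N V g p0].
Proof.
move=> oO Op0 ck jk; have [k1|k1] := eqVneq (dx k p0).1 0; last first.
  exact: local_change_of_variables1 ck jk k1.
pose O' := swap @^-1` O; have oO' : open O' by exact: open_swap.
have O'p : O' (swap p0) by rewrite /O'/preimage/= swapK.
have ck' : C1_on O' (k \o swap).
  by apply: (C1_on_comp_plane oO' _ ck (C1_on_swap oO')).
have dk : differentiable k (swap (swap p0)) by rewrite swapK; exact: C1_on_diff ck Op0.
have ds : differentiable swap (swap p0) by apply: C1_on_diff (C1_on_swap oO') O'p.
have jk' : jac (k \o swap) (swap p0) != 0.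
  by rewrite (jac_comp ds dk) jac_swap swapK mulrN1 oppr_eq0.
have k1' : (dx (k \o swap) (swap p0)).1 != 0.
  have d1 : differentiable (fst : plane R -> R) (swap p0) by case: (@C1_on_fst _ _ _ setT (swap p0)).
  have d2 : differentiable (snd : plane R -> R) (swap p0) by case: (@C1_on_snd _ _ _ setT (swap p0)).
  have E : dx swap (swap p0) = (0, 1) by rewrite dxE (derive_pair _ d2 d1) derive_fst derive_snd.
  rewrite (dx_comp ds dk) E swapK /= scale0r scale1r add0r.
  move: jk; rewrite /jac; move: (dx k p0) (dy k p0) k1 => u v k1; apply: contra_neq => k2.
  by rewrite k1 k2 !mul0r subrr.
have [N [V [g [Np NO L]]]] := local_change_of_variables1 oO' O'p ck' jk' k1'.
have oN : open N by have [[]] := L.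
have oN' := open_swap oN.
have Ls : local_cov swap (swap @^-1` N) N swap p0 by apply: local_cov_swap.
have L' := local_cov_comp (N0 := swap @^-1` N) Np Ls L.
exists (swap @^-1` N), V; eexists; split; first exact: Np.
  by move=> p /NO; rewrite /O' /preimage/= swapK.
by apply: local_cov_eq L' => p _ /=; rewrite swapK.
Qed.

(* Countably many rational boxes carry the local formula. *)
Lemma change_of_variables k N V g : diffeo k N V g ->
  (forall p, N p -> jac k p != 0) ->
  forall f, nonneg_cont f V -> forall E, measurable E -> E `<=` N ->
  measurable (k @` E) /\ (\int[mu2]_(q in k @` E) (f q)%:E =
     \int[mu2]_(p in E) (f (k p) * `|jac k p|)%:E)%E.
Proof.
move=> dk jk f cf; have [oN oV NV VN [ck cg]] := dk.
have imE A : A `<=` N -> k @` A = V `&` g @^-1` A.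
  move=> AN; apply/seteqP; split => [q [p Ap <-]|q [Vq Agq]].
    by have [Vk E] := NV _ (AN _ Ap); split => //; rewrite /preimage/= E.
  by exists (g q) => //; have [] := VN _ Vq.
have mim A : measurable A -> A `<=` N -> measurable (k @` A).
  move=> mA AN; rewrite imE//.
  have mg : measurable_fun V g.
    by apply: (continuous_plane_measurable2 oV) => q; exact: C1_on_continuous cg.
  by apply: mg => //; exact: open_plane_measurable.
have loc p : N p -> exists2 N', [/\ open N', N' p & N' `<=` N] & cov k V N'.
  move=> Np; have [N0 [V0 [g0 [N0p sN0 [d0 [N' [oN' N'p sN' cN']]]]]]] :=
    local_change_of_variables oN Np ck (jk _ Np).
  have sN'N : N' `<=` N by move=> x /sN'/sN0.
  exists N' => // f' cf' B mB BN'; apply: cN' => // q V0q; apply: cf'.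
  by have [_ _ _ V0N0 _] := d0; have [/sN0 Ng <-] := V0N0 _ V0q; case: (NV _ Ng).
pose good (i : rat * rat * rat) :=
  rbox i.1.1 i.1.2 i.2 `<=` N /\ cov k V (rbox i.1.1 i.1.2 i.2).
(* The boxes that lie in [N] and carry the formula are enumerated through their rational data; every
   other index gives the empty set, for which the formula is trivial. *)
pose Bx n : set (plane R) := if unpickle n is Some i then
  if asbool (good i) then rbox i.1.1 i.1.2 i.2 else set0 else set0.
have mBx n : measurable (Bx n).
  rewrite /Bx; case: unpickle => [i|//]; case: ifPn => // _; exact: measurable_box.
have BxN n : Bx n `<=` N /\ cov k V (Bx n).
  rewrite /Bx; case: unpickle => [i|].
    case: ifPn => [/asboolP[]//|_]; split => // f' cf' B mB.
    rewrite image_set0 subset0 => ->.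
    by rewrite preimage_set0 setI0 !integral_set0.
  split => // f' cf' B mB; rewrite image_set0 subset0 => ->.
  by rewrite preimage_set0 setI0 !integral_set0.
have Bxcov p : N p -> exists n, Bx n p.
  move=> Np; have [N' [oN' N'p sN'] cN'] := loc _ Np.
  have [a [b [r [h1 h2]]]] := rational_box (open_near oN' N'p).
  exists (pickle (a, b, r)); rewrite /Bx pickleK asboolT//; split.
    exact: subset_trans h2 sN'.
  exact: (cov_sub dk h2 sN' cN').
move=> E mE EN; split; first exact: mim.
(* The boxes are made disjoint so that both sides of the formula become countable sums; injectivity
   of [k] keeps the images of the pieces disjoint. *)
pose D := seqDU Bx; pose En n := E `&` D n.
have mD n : measurable (D n) by apply: measurableD => //; exact: bigsetU_measurable.
have mEn n : measurable (En n) by exact: measurableI.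
have tD : trivIset setT D by exact: trivIset_seqDU.
have tEn : trivIset setT En by apply: trivIset_setIl.
have EE : E = \bigcup_n En n.
  rewrite -setI_bigcupr -seqDU_bigcup_eq; apply/seteqP; split => [p Ep|p []//].
  by split => //; have [n Bn] := Bxcov _ (EN _ Ep); exists n.
have EnN n : En n `<=` N by move=> p [/EN].
have cfp := nonneg_cont_pull dk cf.
have mfp A : measurable A -> A `<=` N ->
    measurable_fun A (fun p => (f (k p) * `|jac k p|)%:E).
  move=> mA AN; apply/measurable_EFinP.
  apply: (measurable_funS (open_plane_measurable oN) AN).
  by apply: (continuous_plane_measurable oN) => q /cfp[].
have mf A : measurable A -> A `<=` V -> measurable_fun A (fun p => (f p)%:E).
  move=> mA AV; apply/measurable_EFinP.
  apply: (measurable_funS (open_plane_measurable oV) AV).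
  by apply: (continuous_plane_measurable oV) => q /cf[].
have kV A : A `<=` N -> k @` A `<=` V by move=> AN q [p /AN/NV[Vk _] <-].
have inj p p' : N p -> N p' -> k p = k p' -> p = p'.
  by move=> Np Np' E'; have [_ <-] := NV _ Np; have [_ <-] := NV _ Np'; rewrite E'.
have -> : (\int[mu2]_(q in k @` E) (f q)%:E =
    \sum_(0 <= n <oo) \int[mu2]_(q in k @` En n) (f q)%:E)%E.
  have kE : k @` E = \bigcup_n (k @` En n) by rewrite EE image_bigcup.
  rewrite kE; apply: ge0_integral_bigcup.
  - by move=> n; exact: mim.
  - apply: mf; last by move=> q [n _]; exact: kV.
    by apply: bigcup_measurable => n _; exact: mim.
  - by move=> q [n _ /(kV _ (EnN n))/cf[]]; rewrite lee_fin.
  - move=> i j _ _ [q [[p1 Ei <-] [p2 Ej E12]]]; apply: tEn => //; exists p1; split => //.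
    by rewrite -(inj _ _ (EnN _ _ Ej) (EnN _ _ Ei) E12).
have -> : (\int[mu2]_(p in E) (f (k p) * `|jac k p|)%:E =
    \sum_(0 <= n <oo) \int[mu2]_(p in En n) (f (k p) * `|jac k p|)%:E)%E.
  rewrite [in LHS]EE; apply: ge0_integral_bigcup => //.
  - by rewrite -EE; exact: mfp.
  - by move=> p [n _ /EnN/cfp[]]; rewrite lee_fin.
apply: eq_eseriesr => n _; have [BN cB] := BxN n.
have EnB : En n `<=` Bx n by move=> p [_ []].
have kEnB : k @` En n `<=` k @` Bx n.
  by move=> q [p Ep <-]; exists p => //; exact: EnB.
have -> := cB f cf (k @` En n) (mim _ (mEn n) (EnN n)) kEnB.
rewrite (_ : Bx n `&` _ = En n)//; apply/seteqP; split => [p [Bp [p' Ep' E']]|p Ep].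
  by rewrite -(inj _ _ (EnN _ _ Ep') (BN _ Bp) E').
by split; [exact: EnB|exists p].
Qed.

End ChangeOfVariables2.

(** * Intrinsic graphs and their area *)

Section Density.
Context {R : realType}.
Implicit Types (q a b v : heis R).

Lemma gnorm_of_frame q (c : heis R) :
  gnorm q (of_frame q c) = Num.sqrt (c.1.1 ^+ 2 + c.1.2 ^+ 2 + c.2 ^+ 2).
Proof. by rewrite /gnorm /metric of_frameK !expr2. Qed.

(** The X and Y components of the cross product [gcross], that is, its horizontal part. *)
Definition cross_h q a b : R * R :=
  let c := frame_coord q a in let d := frame_coord q b in
  (c.1.2 * d.2 - c.2 * d.1.2, c.2 * d.1.1 - c.1.1 * d.2).

(** By Lagrange's identity the area element is the norm of the cross product, which cancels the
    normalization of the normal. What remains is the norm of the horizontal part of the cross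
    product. *)
Lemma subriem_densityE q a b : subriem_density q a b =
  Num.sqrt ((cross_h q a b).1 ^+ 2 + (cross_h q a b).2 ^+ 2).
Proof.
rewrite /subriem_density /unit_normal /area_element /gcross /cross_h.
set c := frame_coord q a; set d := frame_coord q b => /=.
set c1 := _ - _; set c2 := _ - _; set c3 := _ - _.
rewrite gnorm_of_frame /=.
set S := c1 ^+ 2 + c2 ^+ 2 + c3 ^+ 2.
have -> : metric q a a * metric q b b - metric q a b ^+ 2 = S.
  by rewrite /S /c1 /c2 /c3 /metric /frame_coord /=; ring.
have -> : horizontal_part q ((Num.sqrt S)^-1 *: of_frame q (c1, c2, c3)) =
    of_frame q ((Num.sqrt S)^-1 * c1, (Num.sqrt S)^-1 * c2, 0).
  clearbody c1 c2 c3; move: (Num.sqrt S)^-1 => k.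
  case: q {c d S} => [[x y] t]; rewrite /horizontal_part /metric /frame_coord /of_frame.
  rewrite /fieldX /fieldY /fieldT /=.
  by congr (_, _, _); rewrite /= /GRing.scale /=; ring.
rewrite gnorm_of_frame /= expr0n addr0 !exprMn -mulrDr sqrtrM ?sqr_ge0//.
rewrite sqrtr_sqr ger0_norm ?invr_ge0 ?sqrtr_ge0//.
(* For dependent vectors the inverse in the unit normal is meaningless, but the area element
   vanishes and so do both components on the right. *)
have [S0|S0] := eqVneq S 0; last first.
  rewrite mulrAC mulVf ?mul1r// gt_eqF// sqrtr_gt0 lt0r S0/=.
  by rewrite !addr_ge0 ?sqr_ge0.
rewrite S0 sqrtr0 mulr0 (_ : _ + _ = 0) ?sqrtr0//.
apply/eqP; rewrite eq_le addr_ge0 ?sqr_ge0// andbT.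
by rewrite -S0 /S lerDl sqr_ge0.
Qed.

End Density.

Section IntrinsicGraphs.
Context {R : realType} (al be : R).
Hypothesis albe : al ^+ 2 + be ^+ 2 = 1.

(* The point reached from [(xi, 0, tau)] by following the flow of Y for time eta,
   all this being rotated by the angle of [al + i be] about the t-axis. *)
Definition gpt (xi eta tau : R) : heis R :=
  (al * xi - be * eta, be * xi + al * eta, tau - xi * eta).

Definition gxi (q : heis R) : R := al * q.1.1 + be * q.1.2.
Definition geta (q : heis R) : R := - be * q.1.1 + al * q.1.2.
Definition gtau (q : heis R) : R := q.2 + gxi q * geta q.
(** The projection along the orbits of the rotated Y, which change [eta] only. *)
Definition gproj (q : heis R) : plane R := (gxi q, gtau q).

Lemma gxiK xi eta tau : gxi (gpt xi eta tau) = xi.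
Proof. by rewrite -[RHS]mul1r -albe /gxi /gpt /=; ring. Qed.

Lemma getaK xi eta tau : geta (gpt xi eta tau) = eta.
Proof. by rewrite -[RHS]mul1r -albe /geta /gpt /=; ring. Qed.

Lemma gtauK xi eta tau : gtau (gpt xi eta tau) = tau.
Proof. by rewrite /gtau gxiK getaK /gpt /=; ring. Qed.

Lemma gptK q : gpt (gxi q) (geta q) (gtau q) = q.
Proof.
case: q => [[x y] t]; rewrite /gpt /gtau addrK /gxi /geta /=.
congr (_, _, _).
  by rewrite -[RHS]mul1r -albe; ring.
by rewrite -[RHS]mul1r -albe; ring.
Qed.

(** The differential of [gpt], applied to the increments of the three coordinates; [gpt] is affine
    in tau, so the value of tau does not enter. *)
Definition dgpt (xi eta : R) (dxi deta dtau : R) : heis R :=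
  (al * dxi - be * deta, be * dxi + al * deta, dtau - (xi * deta + eta * dxi)).

Lemma differentiable_gpt {V : normedModType R} (a b c : V -> R) p :
  differentiable a p -> differentiable b p -> differentiable c p ->
  differentiable (fun x => gpt (a x) (b x) (c x)) p.
Proof.
move=> da db dc; have cst k : differentiable (fun=> k : R) p by exact: differentiable_cst.
apply: differentiable_pair.
  apply: differentiable_pair.
    by apply: differentiableB; [exact: (differentiableM (cst al) da)|exact: (differentiableM (cst be) db)].
  by apply: differentiableD; [exact: (differentiableM (cst be) da)|exact: (differentiableM (cst al) db)].
by apply: differentiableB; [exact: dc|exact: (differentiableM da db)].
Qed.

Lemma derive_gpt {V : normedModType R} (a b c : V -> R) p v :
  differentiable a p -> differentiable b p -> differentiable c p ->
  'D_v (fun x => gpt (a x) (b x) (c x)) p =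
  dgpt (a p) (b p) ('D_v a p) ('D_v b p) ('D_v c p).
Proof.
move=> da db dc; have cst k : differentiable (fun=> k : R) p by exact: differentiable_cst.
have m1 k (f : V -> R) : differentiable f p -> 'D_v (fun x => k * f x) p = k * 'D_v f p.
  by move=> df; apply: (deriveZ k); exact: diff_derivable.
have h1 : differentiable (fun x => al * a x - be * b x) p.
  by apply: differentiableB; [exact: (differentiableM (cst al) da)|exact: (differentiableM (cst be) db)].
have h2 : differentiable (fun x => be * a x + al * b x) p.
  by apply: differentiableD; [exact: (differentiableM (cst be) da)|exact: (differentiableM (cst al) db)].
have h3 : differentiable (fun x => c x - a x * b x) p.
  by apply: differentiableB; [exact: dc|exact: (differentiableM da db)].
rewrite /gpt (derive_pair v (differentiable_pair h1 h2) h3) (derive_pair v h1 h2).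
rewrite /dgpt; congr (_, _, _).
- rewrite deriveB ?m1//; apply: diff_derivable.
    exact: (differentiableM (cst al) da).
  exact: (differentiableM (cst be) db).
- rewrite deriveD ?m1//; apply: diff_derivable.
    exact: (differentiableM (cst be) da).
  exact: (differentiableM (cst al) db).
- rewrite deriveB; last 2 first.
  + exact: diff_derivable.
  + by apply: diff_derivable; exact: (differentiableM da db).
  by rewrite deriveM; [|exact: diff_derivable|exact: diff_derivable].
Qed.

Lemma C1_on_gpt {V : normedModType R} (O : set V) (a b c : V -> R) : open O ->
  C1_on O a -> C1_on O b -> C1_on O c -> C1_on O (fun x => gpt (a x) (b x) (c x)).
Proof.
move=> oO ca cb cc; have k r := @C1_on_cst _ V R O r.
apply: C1_on_pair; [exact: oO| |].
  apply: C1_on_pair; [exact: oO| |].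
    by apply: C1_onB; [exact: oO|exact: (C1_onM oO (k al) ca)|exact: (C1_onM oO (k be) cb)].
  by apply: C1_onD; [exact: oO|exact: (C1_onM oO (k be) ca)|exact: (C1_onM oO (k al) cb)].
by apply: C1_onB; [exact: oO|exact: cc|exact: (C1_onM oO ca cb)].
Qed.

Lemma C1_on_gxi {V : normedModType R} (O : set V) (f : V -> heis R) : open O ->
  C1_on O f -> C1_on O (fun x => gxi (f x)).
Proof.
move=> oO cf; have k r := @C1_on_cst _ V R O r.
have c1 := C1_on_fst_comp oO cf.
apply: C1_onD; [exact: oO|exact: (C1_onM oO (k al) (C1_on_fst_comp oO c1))|].
exact: (C1_onM oO (k be) (C1_on_snd_comp oO c1)).
Qed.

Lemma C1_on_geta {V : normedModType R} (O : set V) (f : V -> heis R) : open O ->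
  C1_on O f -> C1_on O (fun x => geta (f x)).
Proof.
move=> oO cf; have k r := @C1_on_cst _ V R O r.
have c1 := C1_on_fst_comp oO cf.
apply: C1_onD; [exact: oO|exact: (C1_onM oO (k (- be)) (C1_on_fst_comp oO c1))|].
exact: (C1_onM oO (k al) (C1_on_snd_comp oO c1)).
Qed.

Lemma C1_on_gtau {V : normedModType R} (O : set V) (f : V -> heis R) : open O ->
  C1_on O f -> C1_on O (fun x => gtau (f x)).
Proof.
move=> oO cf; apply: C1_onD; [exact: oO|exact: C1_on_snd_comp|].
exact: (C1_onM oO (C1_on_gxi oO cf) (C1_on_geta oO cf)).
Qed.

Lemma C1_on_gproj {V : normedModType R} (O : set V) (f : V -> heis R) : open O ->
  C1_on O f -> C1_on O (fun x => gproj (f x)).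
Proof.
by move=> oO cf; apply: C1_on_pair; [exact: oO|exact: C1_on_gxi|exact: C1_on_gtau].
Qed.

(* [cross_h] has the norm of [(deta /\ theta, theta /\ dxi)], where the contact
   form is [theta = dtau - 2 eta dxi]. *)
Lemma cross_h_gpt xi eta tau x1 y1 t1 x2 y2 t2 :
  let c := cross_h (gpt xi eta tau) (dgpt xi eta x1 y1 t1) (dgpt xi eta x2 y2 t2) in
  c.1 ^+ 2 + c.2 ^+ 2 =
  (y1 * (t2 - 2 * eta * x2) - y2 * (t1 - 2 * eta * x1)) ^+ 2 + (t1 * x2 - t2 * x1) ^+ 2.
Proof.
have th x y t : (frame_coord (gpt xi eta tau) (dgpt xi eta x y t)).2 = t - 2 * eta * x.
  rewrite /frame_coord /gpt /dgpt /=.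
  transitivity (t - xi * y - eta * x + (al ^+ 2 + be ^+ 2) * (xi * y - eta * x)); first by ring.
  by rewrite albe; ring.
have := th x1 y1 t1; have := th x2 y2 t2.
rewrite /cross_h /frame_coord /gpt /dgpt /= => -> ->.
rewrite -[RHS]mul1r -albe; ring.
Qed.

Definition om (u : plane R -> R) (x : plane R) : R := dx u x + 2 * u x * dy u x.

Definition gdens u x : R := Num.sqrt (1 + om u x ^+ 2).

(** Any parametrization of the graph is the graph map composed with some [k], and the two 2-forms in
    [cross_h_gpt] pull back to the Jacobian of [k] times [om] and times 1, up to sign. The Jacobian
    is the factor that the change of variables formula expects. *)
Lemma density_graph (G : plane R -> heis R) (k : plane R -> plane R) u p :
  differentiable k p -> differentiable u (k p) ->
  (\forall x \near p, G x = gpt (k x).1 (u (k x)) (k x).2) ->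
  subriem_density (G p) ('D_((1, 0) : plane R) G p) ('D_((0, 1) : plane R) G p) =
  gdens u (k p) * `|jac k p|.
Proof.
move=> dk du E.
have duk : differentiable (u \o k) p by exact: differentiable_comp.
have d1 : differentiable (fun x => (k x).1) p.
  have d : differentiable (fst : plane R -> R) (k p) by case: (@C1_on_fst _ _ _ setT (k p)).
  exact: (differentiable_comp dk d).
have d2 : differentiable (fun x => (k x).2) p.
  have d : differentiable (snd : plane R -> R) (k p) by case: (@C1_on_snd _ _ _ setT (k p)).
  exact: (differentiable_comp dk d).
rewrite !(near_eq_derive _ E) (nbhs_singleton E).
rewrite !(derive_gpt _ d1 duk d2) subriem_densityE cross_h_gpt.
rewrite !(derive_fst_comp _ dk) !(derive_snd_comp _ dk) -!dxE -!dyE (dx_comp dk du) (dy_comp dk du).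
rewrite /gdens /om /jac -sqrtr_sqr -sqrtrM ?addr_ge0 ?sqr_ge0//.
rewrite /= /GRing.scale /=.
move: (dx k p) (dy k p) (dx u (k p)) (dy u (k p)) (u (k p)) => v w a b c.
by congr (Num.sqrt _); ring.
Qed.

(** * Charts of intrinsic graphs and the area formula *)

Section Charts.
Context {M : topologicalType}.
Implicit Types (F : M -> heis R) (D E : set (plane R)) (psi : plane R -> M)
  (u : plane R -> R).
Notation mu := (@lebesgue_measure R).
Notation mu2 := (mu \x mu)%E.

(** The chart parameters are the coordinates (xi, tau) of the surface point, so the transition from
    any other chart to this one is simply [gproj] of the immersion. *)
Definition graph_chart F D psi u : Prop :=
  [/\ open D, chart D psi, C1_on D u &
      forall x, D x -> F (psi x) = gpt x.1 (u x) x.2].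

Lemma chart_continuous D psi : open D -> chart D psi ->
  forall x, D x -> {for x, continuous psi}.
Proof.
move=> oD [_ _ + _] x Dx; rewrite continuous_open_subspace//.
by move=> /(_ x (mem_set Dx)).
Qed.

Lemma chart_image_open D psi : chart D psi -> open (psi @` D).
Proof. by move=> [_ _ _ /(_ setT openT)]; rewrite setIT. Qed.

Lemma C1_on_graph D u : open D -> C1_on D u ->
  C1_on D (fun x => gpt x.1 (u x) x.2).
Proof. by move=> oD cu; apply: C1_on_gpt; [exact: oD|exact: C1_on_fst|exact: cu|exact: C1_on_snd]. Qed.

Lemma derive_graph D u x v : C1_on D u -> D x ->
  'D_v (fun x => gpt x.1 (u x) x.2) x = dgpt x.1 (u x) v.1 ('D_v u x) v.2.
Proof.
move=> cu Dx; have d1 : differentiable (fst : plane R -> R) x by case: (@C1_on_fst _ _ _ setT x).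
have d2 : differentiable (snd : plane R -> R) x by case: (@C1_on_snd _ _ _ setT x).
by rewrite (derive_gpt v d1 (C1_on_diff cu Dx) d2) derive_fst derive_snd.
Qed.

Lemma dgpt_eq0 xi eta x y t : dgpt xi eta x y t = 0 -> [/\ x = 0, y = 0 & t = 0].
Proof.
move=> [h1 h2 h3].
have x0 : x = 0.
  rewrite -[x]mul1r -albe.
  transitivity (al * (al * x - be * y) + be * (be * x + al * y)); first by ring.
  by rewrite h1 h2; ring.
have y0 : y = 0.
  rewrite -[y]mul1r -albe.
  transitivity (al * (be * x + al * y) - be * (al * x - be * y)); first by ring.
  by rewrite h1 h2; ring.
by split => //; move: h3; rewrite x0 y0; lra.
Qed.

Lemma graph_immersion_ext F D psi u : graph_chart F D psi u ->
  C1_immersion_ext F D psi (fun x => gpt x.1 (u x) x.2).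
Proof.
move=> [oD cpsi cu Fpsi]; split.
- by exists D; split => //; exact: C1_on_graph.
- by move=> x Dx; rewrite Fpsi.
- move=> x Dx v; rewrite (derive_graph v cu Dx) => /dgpt_eq0[v1 _ v2].
  by case: v v1 v2 => a b /= -> ->.
Qed.

Lemma graph_local_param F D psi u : graph_chart F D psi u -> local_param F D psi.
Proof.
by move=> gc; split; [case: gc|eexists; exact: graph_immersion_ext gc].
Qed.

Lemma gdens_nonneg_cont D u : open D -> C1_on D u -> nonneg_cont (gdens u) D.
Proof.
move=> oD cu x Dx; split; first exact: sqrtr_ge0.
have c0 := C1_on_continuous cu Dx; have c1 := C1_on_dx cu Dx; have c2 := C1_on_dy cu Dx.
have cst (r : R) : {for x, continuous (fun=> r : R)} by exact: cst_continuous.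
have c3 : {for x, continuous (fun x => 1 + om u x ^+ 2)}.
  apply: cvgD; first exact: cst.
  by apply: cvgM; (apply: cvgD; [exact: c1|apply: cvgM; [exact: (cvgM (cst 2) c0)|exact: c2]]).
exact: (continuous_comp c3 (@sqrt_continuous _ _)).
Qed.

(** An inverse chosen pointwise exists by injectivity; near each image point it must coincide with
    the C^1 inverse given locally, so it is C^1. *)
Lemma diffeo_of_injective (N : set (plane R)) (k : plane R -> plane R) : open N -> C1_on N k -> set_inj N k ->
  (forall p, N p -> jac k p != 0) -> exists g, diffeo k N (k @` N) g.
Proof.
move=> oN ck ik jk.
pose g q := xget 0 [set p | N p /\ k p = q].
have gk p : N p -> g (k p) = p.
  move=> Np; rewrite /g; case: xgetP => [p' -> [Np' E]|/(_ p)]; last by case.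
  by apply: ik; rewrite ?inE.
have loc p : N p -> exists2 V', open V' /\ V' (k p) & V' `<=` k @` N /\ C1_on V' g.
  move=> Np; have [N0 [V0 [g0 [N0p sN [[oN0 oV0 NV VN [_ cg0]] _]]]]] :=
    local_change_of_variables oN Np ck (jk _ Np).
  exists V0; first by split; [exact: oV0|exact: (NV _ N0p).1].
  split; first by move=> q /VN[/sN Ng E]; exists (g0 q).
  apply: (C1_on_eq oV0 _ cg0) => q /VN[/sN Ng E].
  by rewrite -[in RHS]E gk.
exists g; split; [exact: oN| | | |split; [exact: ck|]].
- rewrite openE => _ [p Np <-]; have [V' [oV' V'k] [sV' _]] := loc _ Np.
  by apply: filterS sV' _; exact: open_nbhs_nbhs.
- by move=> p Np; split; [exists p|exact: gk].
- by move=> _ [p Np <-]; rewrite gk.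
- by move=> _ [p Np <-]; have [V' [oV' V'k] [_ cg]] := loc _ Np; exact: cg.
Qed.

(** The immersion factors as the graph map after [k]. A vector killed by the differential of [k] is
    therefore killed by that of the immersion, hence is zero, and the Jacobian of [k] cannot
    vanish. *)
Lemma chart_transition F D psi u D1 psi1 : graph_chart F D psi u ->
  open D1 -> local_param F D1 psi1 ->
  let k := fun y => gproj (F (psi1 y)) in
  let O1 := D1 `&` psi1 @^-1` (psi @` D) in
  [/\ open O1, C1_on O1 k, set_inj O1 k, forall p, O1 p -> jac k p != 0 &
      forall p, O1 p -> [/\ D (k p), psi (k p) = psi1 p &
        F (psi1 p) = gpt (k p).1 (u (k p)) (k p).2]].
Proof.
move=> gc oD1 [ch1 [G [[W [oO DO cG]] GF immG]]] k O1.
have [oD cpsi cu Fpsi] := gc.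
have cpsi1 := chart_continuous oD1 ch1.
have oO1 : open O1 by apply: continuous_open_preimage => //; exact: chart_image_open.
have kP p : O1 p -> [/\ D (k p), psi (k p) = psi1 p &
    F (psi1 p) = gpt (k p).1 (u (k p)) (k p).2].
  move=> [_ [x Dx E]]; have Ek : k p = x.
    by rewrite /k -E Fpsi// /gproj gxiK gtauK -surjective_pairing.
  by rewrite Ek; split => //; rewrite -E Fpsi.
have ck : C1_on O1 k.
  have cG1 : C1_on O1 G by apply: C1_on_sub cG => p [/DO].
  apply: (C1_on_eq oO1 _ (C1_on_gproj oO1 cG1)) => p [D1p _].
  by rewrite /k -GF.
split => //.
- move=> p p' /set_mem Op /set_mem Op' E.
  have [_ E1 _] := kP _ Op; have [_ E2 _] := kP _ Op'.
  have [_ inj1 _ _] := ch1; apply: inj1; rewrite ?inE; [exact: Op.1|exact: Op'.1|].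
  by rewrite -E1 -E2 E.
- move=> p Op; have [Dk _ _] := kP _ Op.
  have dk := C1_on_diff ck Op; have du := C1_on_diff cu Dk.
  have duk : differentiable (u \o k) p by exact: differentiable_comp.
  have E : \forall x \near p, G x = gpt (k x).1 ((u \o k) x) (k x).2.
    apply: filterS (open_near oO1 Op) => x Ox; have [_ _ <-] := kP _ Ox.
    by rewrite GF//; case: Ox.
  have d1 : differentiable (fun x => (k x).1) p.
    have d : differentiable (fst : plane R -> R) (k p) by case: (@C1_on_fst _ _ _ setT (k p)).
    exact: (differentiable_comp dk d).
  have d2 : differentiable (fun x => (k x).2) p.
    have d : differentiable (snd : plane R -> R) (k p) by case: (@C1_on_snd _ _ _ setT (k p)).
    exact: (differentiable_comp dk d).
  have H v : 'D_v k p = 0 -> v = 0.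
    move=> Dv0; apply: (immG p (Op.1)).
    rewrite (near_eq_derive _ E) (derive_gpt v d1 duk d2).
    rewrite (derive_fst_comp v dk) (derive_snd_comp v dk) Dv0.
    rewrite (derive_comp v dk du) Dv0 derive0 /dgpt /=.
    by rewrite !(mulr0, addr0, subr0).
  apply/eqP; rewrite /jac => J.
  have K (a b : R) : 'D_((a, b) : plane R) k p = (a * (dx k p).1 + b * (dy k p).1, a * (dx k p).2 + b * (dy k p).2).
    by rewrite (derive_plane _ dk).
  have {K} : forall a b : R, a * (dx k p).1 + b * (dy k p).1 = 0 ->
      a * (dx k p).2 + b * (dy k p).2 = 0 -> a = 0 /\ b = 0.
    by move=> a b h1 h2; have := H (a, b); rewrite K h1 h2 => /(_ erefl)[-> ->].
  move: (dx k p) (dy k p) J => v w J K.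
  (* If the determinant vanishes, both cofactor vectors lie in the kernel, which is trivial; all
     entries are then zero, and the kernel would contain (1, 0). *)
  have [a1 b1] := K (w.2) (- v.2) ltac:(lra) ltac:(ring).
  have [a2 b2] := K (w.1) (- v.1) ltac:(ring) ltac:(lra).
  have [] := K 1 0; last by move=> /eqP; rewrite oner_eq0.
    by rewrite mul1r mul0r addr0; apply: oppr_inj; rewrite oppr0.
  by rewrite mul1r mul0r addr0; apply: oppr_inj; rewrite oppr0.
Qed.

(** A competing family is carried by the transition maps to disjoint measurable pieces of [K], with
    the same areas by change of variables, so its total is at most the integral over [K]. The bound
    is attained by the family with the single piece [K]. *)
Theorem area_graph F D psi u K : graph_chart F D psi u -> measurable K -> K `<=` D ->
  subriem_area F (psi @` K) = (\int[mu2]_(x in K) (gdens u x)%:E)%E.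
Proof.
move=> gc mK KD; have [oD cpsi cu Fpsi] := gc.
have cd := gdens_nonneg_cont oD cu.
have mg A : measurable A -> A `<=` D -> measurable_fun A (fun x => (gdens u x)%:E).
  move=> mA AD; apply/measurable_EFinP.
  apply: (measurable_funS (open_plane_measurable oD) AD).
  by apply: (continuous_plane_measurable oD) => x /cd[].
apply/eqP; rewrite eq_le; apply/andP; split.
  apply: ge_ereal_sup => _ [n [D1 [E1 [psi1 [H1 H2 H3 H4 ->]]]]].
  pose k i y := gproj (F (psi1 i y)).
  have T i := chart_transition gc (H1 i).1 (H1 i).2.
  have EO i : E1 i `<=` D1 i `&` psi1 i @^-1` (psi @` D).
    move=> y Ey; split; first exact: (H2 i).2.
    have [x Kx Ex] : (psi @` K) (psi1 i y) by apply: (H3 i); exists y.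
    by exists x => //; exact: KD.
  have kK i : k i @` E1 i `<=` K.
    move=> _ [y Ey <-]; have [_ _ _ _ kP] := T i.
    have [Dk Ek _] := kP _ (EO i _ Ey).
    have [x Kx Ex] : (psi @` K) (psi1 i y) by apply: (H3 i); exists y.
    suff <- : x = k i y by [].
    have [_ inj _ _] := cpsi; apply: inj; rewrite ?inE//; first exact: KD.
    by rewrite Ek.
  have CV i : measurable (k i @` E1 i) /\
      param_area F (psi1 i) (E1 i) = (\int[mu2]_(x in k i @` E1 i) (gdens u x)%:E)%E.
    have [oO1 ck ik jk kP] := T i.
    have [g dg] := diffeo_of_injective oO1 ck ik jk.
    have cd1 : nonneg_cont (gdens u) (k i @` (D1 i `&` psi1 i @^-1` (psi @` D))).
      by move=> _ [y /kP[Dk _ _] <-]; exact: cd.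
    have [m ->] := change_of_variables dg jk cd1 (H2 i).1 (EO i).
    split => //; apply: eq_integral => y /set_mem /(EO i) Oy.
    have [Dk _ _] := kP _ Oy; congr (_%:E).
    apply: (@density_graph _ (k i)); [exact: C1_on_diff ck Oy|exact: C1_on_diff cu Dk|].
    by apply: filterS (open_near oO1 Oy) => x /kP[].
  under eq_bigr do rewrite (CV _).2.
  have tk : trivIset setT (fun i => k i @` E1 i).
    move=> i j _ _ [x [[y Ey Ex] [y' Ey' Ex']]]; apply: H4 => //.
    exists (psi1 i y); split; first by exists y.
    have [_ _ _ _ kPi] := T i; have [_ E2 _] := kPi _ (EO i _ Ey).
    have [_ _ _ _ kPj] := T j; have [_ E3 _] := kPj _ (EO j _ Ey').
    by exists y' => //; rewrite -E2 -E3 -/(k i y) -/(k j y') Ex Ex'.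
  have mU : measurable (\big[setU/set0]_(i < n) k i @` E1 i).
    by apply: bigsetU_measurable => i _; exact: (CV i).1.
  have UK : \big[setU/set0]_(i < n) k i @` E1 i `<=` K.
    apply: (big_ind (fun A => A `<=` K)) => [x //|A B AK BK x [/AK|/BK]//|i _].
    exact: kK.
  rewrite -ge0_integral_bigsetU//.
  - apply: ge0_subset_integral => //; first exact: mg.
    by move=> x /KD/cd[]; rewrite lee_fin.
  - by move=> i; exact: (CV i).1.
  - by rewrite /index_enum -enumT enum_uniq.
  - by apply: sub_trivIset tk.
  - by apply: mg => // x /UK/KD.
  - by move=> x /UK/KD/cd[]; rewrite lee_fin.
apply: ereal_sup_ubound.
exists 1%N, (fun=> D), (fun=> K), (fun=> psi); split => //.
- by move=> i; split => //; exact: graph_local_param gc.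
- by move=> _.
- by move=> i j _ _ _; rewrite (ord1 i) (ord1 j).
- rewrite big_ord1; apply: eq_integral => x /set_mem /KD Dx; congr (_%:E).
  have did : differentiable (id : plane R -> plane R) x by [].
  have jid : jac (id : plane R -> plane R) x = 1.
    by rewrite /jac !dxE !dyE !derive_id /=; ring.
  have := @density_graph (F \o psi) id u x did (C1_on_diff cu Dx).
  rewrite jid normr1 mulr1 => -> //.
  by apply: filterS (open_near oD Dx) => y /Fpsi.
Qed.

End Charts.

End IntrinsicGraphs.

(** * First variation of the area *)

Section OpenIntervals.
Context {R : realType}.

Lemma open_oo (a b : R) : open [set z : R | a < z < b].
Proof.
rewrite (_ : [set z | _] = `]a, b[%classic); first exact: interval_open.
by apply/seteqP; split => z /=; rewrite in_itv.
Qed.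

Lemma open_norm_lt (r : R) : open [set z : R | `|z| < r].
Proof.
rewrite (_ : [set z | _] = [set z | - r < z < r]); first exact: open_oo.
by apply/seteqP; split => z /=; rewrite ltr_norml.
Qed.

Lemma open_dist_lt (a r : R) : open [set z : R | `|z - a| < r].
Proof.
rewrite (_ : [set z | _] = [set z | a - r < z < a + r]); first exact: open_oo.
by apply/seteqP; split => z /=; rewrite ltr_distl.
Qed.

End OpenIntervals.

Section Rectangles.
Context {R : realType}.
Notation mu := (@lebesgue_measure R).
Notation mu2 := (mu \x mu)%E.
Implicit Types (f : plane R -> R) (a b c d : R).

Definition rect a b c d : set (plane R) := `[a, b]%classic `*` `[c, d]%classic.

Lemma rectP a b c d x :
  rect a b c d x <-> a <= x.1 <= b /\ c <= x.2 <= d.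
Proof. by rewrite /rect /setX /= !in_itv. Qed.

Lemma compact_rect a b c d : compact (rect a b c d).
Proof. by apply: compact_setX; exact: segment_compact. Qed.

Lemma closed_rect a b c d : closed (rect a b c d).
Proof.
by apply: compact_closed; [exact: norm_hausdorff|exact: compact_rect].
Qed.

Lemma measurable_rect a b c d : measurable (rect a b c d).
Proof. by apply: measurableX; exact: measurable_itv. Qed.

Lemma mu2_rect_lty a b c d : (mu2 (rect a b c d) < +oo)%E.
Proof.
have m (x y : R) : mu `[x, y]%classic \is a fin_num.
  by rewrite lebesgue_measure_itv/=; case: ifP.
by rewrite product_measure1E//= ltey_eq fin_numM.
Qed.

Lemma bounded_rect_integrable a b c d f C :
  measurable_fun (rect a b c d) f ->
  (forall x, rect a b c d x -> `|f x| <= C) ->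
  mu2.-integrable (rect a b c d) (EFin \o f).
Proof.
move=> mf fC; apply: measurable_bounded_integrable => //.
- exact: measurable_rect.
- exact: mu2_rect_lty.
- exists C; split; first by rewrite num_real.
  by move=> M CM x /fC; move=> /le_trans; apply; exact: ltW.
Qed.

Lemma rect_bounded a b c d f :
  (forall x, rect a b c d x -> {for x, continuous f}) ->
  exists C, forall x, rect a b c d x -> `|f x| <= C.
Proof.
move=> cf; have cA : compact (f @` rect a b c d).
  apply: continuous_compact; last exact: compact_rect.
  by apply: continuous_in_subspaceT => x /set_mem; exact: cf.
have [M [_ hM]] := compact_bounded cA; exists (M + 1) => x Ax.
by apply: hM; [rewrite ltrDl|exists x].
Qed.

Lemma continuous_rect_measurable a b c d f (D : set (plane R)) : open D ->
  rect a b c d `<=` D -> (forall x, D x -> {for x, continuous f}) ->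
  measurable_fun (rect a b c d) f.
Proof.
move=> oD rD cf; apply: (measurable_funS (open_plane_measurable oD) rD).
exact: continuous_plane_measurable.
Qed.

Lemma continuous_rect_integrable a b c d f (D : set (plane R)) : open D ->
  rect a b c d `<=` D -> (forall x, D x -> {for x, continuous f}) ->
  mu2.-integrable (rect a b c d) (EFin \o f).
Proof.
move=> oD rD cf; have [C hC] := rect_bounded (fun x hx => cf x (rD x hx)).
exact: bounded_rect_integrable (continuous_rect_measurable oD rD cf) hC.
Qed.

End Rectangles.

(** * Cut-off functions of one variable *)

Section Bumps.
Context {R : realType}.
Implicit Types (x y t : R) (g : R -> R).

Definition sqp x : R := Num.max 0 x ^+ 2.

Lemma is_derive_eps g x (d : R) :
  (forall e, 0 < e -> \forall y \near x, `|g y - g x - d * (y - x)| <= e * `|y - x|) ->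
  is_derive x 1 g d.
Proof.
move=> H; pose df (h : R) := d * h.
have dfl : linear df by move=> k u v; rewrite /df /= /GRing.scale /=; ring.
pose dfL := GRing.isLinear.Build R R R _ df dfl.
pose dfP : {linear R -> R} := HB.pack df dfL.
have [|dg E] := @eps_differentiable _ _ _ g x dfP _ H.
  by move=> h; apply: cvgM; [exact: cvg_cst|exact: cvg_id].
by apply: DeriveDef; [exact: diff_derivable|rewrite deriveE// E /= /df mulr1].
Qed.

Lemma is_derive_sqp x : is_derive x 1 sqp (2 * Num.max 0 x).
Proof.
apply: is_derive_eps => e e0.
have Hn : \forall y \near x, `|y - x| <= e.
  by have := @cvgr_distC_le _ _ _ _ _ (@id R) x (@cvg_id _ (nbhs x)); apply.
(* The first-order remainder of the squared positive part is at most (y - x)^2, also across the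
   corner at 0; a neighbourhood of radius [e] then suffices. *)
apply: filterS Hn => y hy; have H : `|sqp y - sqp x - 2 * Num.max 0 x * (y - x)| <= (y - x) ^+ 2.
  have sq := sqr_ge0 (y - x).
  rewrite /sqp ler_norml; have [x0|x0] := leP 0 x; have [y0|y0] := leP 0 y.
  - rewrite (_ : y ^+ 2 - x ^+ 2 - 2 * x * (y - x) = (y - x) ^+ 2); last by ring.
    by rewrite lexx andbT; lra.
  - by apply/andP; split; rewrite !expr2; nra.
  - by apply/andP; split; rewrite !expr2; nra.
  - rewrite (_ : 0 ^+ 2 - 0 ^+ 2 - 2 * 0 * (y - x) = 0); last by ring.
    by rewrite oppr_le0 sq.
apply: le_trans H _; rewrite -real_normK ?num_real// expr2 ler_wpM2r//.
Qed.

Lemma continuous_maxr0 : continuous (fun x : R => Num.max 0 x).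
Proof.
by move=> x; apply: (@continuous_max _ _ (fun=> 0) id); [exact: cst_continuous|].
Qed.

Lemma C1_on_is_derive (A : set R) g dg : open A ->
  (forall t, A t -> is_derive t 1 g (dg t) /\ {for t, continuous dg}) -> C1_on A g.
Proof.
move=> oA H; apply: (C1_on_formula (df := fun v t => v * dg t)) => //.
- by move=> t /H[[dgt _] _]; apply/derivable1_diffP.
- move=> t v /H[[dgt <-] _]; have dt : differentiable g t by apply/derivable1_diffP.
  by rewrite !deriveE// -[X in 'd g t X]mulr1 linearZ.
- by move=> t v /H[_ cdg]; apply: cvgM => //; exact: cvg_cst.
Qed.

Lemma C1_on_comp_real {V : normedModType R} (O : set V) (A : set R) (f : V -> R) g :
  open O -> (forall p, O p -> A (f p)) -> C1_on A g -> C1_on O f -> C1_on O (g \o f).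
Proof.
move=> oO OA cg; apply: (C1_on_comp1 (D := A)) => // t /cg[dg cdg]; split => //.
by apply/derivable1_diffP.
Qed.

Lemma C1_onU {V W : normedModType R} (A B : set V) (f : V -> W) :
  C1_on A f -> C1_on B f -> C1_on (A `|` B) f.
Proof. by move=> cA cB x [/cA|/cB]. Qed.

Lemma C1_on_sqp : C1_on setT sqp.
Proof.
apply: (@C1_on_is_derive _ _ (fun x => 2 * Num.max 0 x)); first exact: openT.
move=> t _; split; first exact: is_derive_sqp.
by apply: cvgM; [exact: cvg_cst|exact: continuous_maxr0].
Qed.

Lemma C1_on_cos : C1_on setT (@cos R).
Proof.
apply: (@C1_on_is_derive _ _ (fun x => - sin x)); first exact: openT.
move=> t _; split; first exact: is_derive_cos.
by apply: cvgN; exact: continuous_sin.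
Qed.

(* The speed of the flow [atan (tan y + s)]. *)
Definition cosbump y : R := if `|y| < pi / 2 then cos y ^+ 2 else 0.

(** Between pi/2 and pi the cosine is nonpositive, so taking its positive part performs the cut-off.
    This exhibits the function as C^1 across pi/2 and -pi/2. *)
Lemma cosbump_sqp y : `|y| < pi -> cosbump y = sqp (cos y).
Proof.
rewrite /cosbump /sqp => ypi; case: ifPn => [y2|].
  by rewrite max_r// cos_ge0_pihalf//; move: y2; rewrite ltr_norml => /andP[/ltW -> /ltW ->].
rewrite -leNgt => y2; rewrite max_l ?expr0n//.
rewrite -cos_norm -[`|y|](subrK (pi / 2)) cosDpihalf oppr_le0 sin_ge0_pi//.
have := pi_gt0 R; lra.
Qed.

Lemma C1_on_cosbump : C1_on setT cosbump.
Proof.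
have o1 := @open_norm_lt R pi.
have o2 : open [set y : R | pi / 2 < `|y|].
  rewrite -[X in open X]setTI.
  apply: (continuous_open_preimage (B := [set z : R | pi / 2 < z])); [exact: openT|exact: open_gt|].
  by move=> x _; exact: (@norm_continuous _ _ x).
rewrite (_ : setT = [set y : R | `|y| < pi] `|` [set y : R | pi / 2 < `|y|]).
  apply: C1_onU.
    apply: (C1_on_eq o1 (f := sqp \o @cos R)); first by move=> y /cosbump_sqp ->.
    apply: (C1_on_comp_real o1 (A := setT)) => //; first exact: C1_on_sqp.
    by apply: C1_on_sub C1_on_cos.
  apply: (C1_on_eq o2 (f := fun=> 0)); last exact: C1_on_cst.
  by move=> y /= hy; rewrite /cosbump ltNge (ltW hy).
apply/seteqP; split => // y _ /=; have := pi_gt0 R.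
by case: (ltP `|y| pi) => [|h] p0; [left|right; lra].
Qed.

(** The right-hand side is the derivative of atan at [y]; hence s |-> atan(tan y + s r) moves at r
    times the bump evaluated at its own position. *)
Lemma cosbump_atan y : cosbump (atan y) = (1 + y ^+ 2)^-1.
Proof.
have h : 0 <= 1 + y ^+ 2 by rewrite addr_ge0// sqr_ge0.
rewrite /cosbump ltr_norml atan_gtNpi2 atan_ltpi2/= cos_atan exprVn sqr_sqrtr//.
Qed.

End Bumps.

(** * The explicit flow along the orbits of a horizontal field *)

Section Flow.
Context {R : realType} (al be : R).
Hypothesis albe : al ^+ 2 + be ^+ 2 = 1.
Variables (eta0 : R) (v : plane R -> R).

Local Notation gpt := (gpt al be).
Local Notation gxi := (gxi al be).
Local Notation geta := (geta al be).
Local Notation gtau := (gtau al be).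
Local Notation gproj := (gproj al be).

(** Only [eta] moves, so the field is tangent to the fibres of [gproj] and [v (gproj q)] is constant
    along its orbits. The bump confines the motion to |eta - eta0| < pi/2. *)
Definition vfield (q : heis R) : heis R :=
  dgpt al be (gxi q) (geta q) 0 (v (gproj q) * cosbump (geta q - eta0)) 0.

Definition shift_eta (s r y : R) : R := eta0 + atan (tan (y - eta0) + s * r).

Definition vflow (s : R) (q : heis R) : heis R :=
  if `|geta q - eta0| < pi / 2
  then gpt (gxi q) (shift_eta s (v (gproj q)) (geta q)) (gtau q) else q.

Lemma vflowE s q : `|geta q - eta0| < pi / 2 ->
  vflow s q = gpt (gxi q) (shift_eta s (v (gproj q)) (geta q)) (gtau q).
Proof. by rewrite /vflow => ->. Qed.

Lemma is_derive_shift_eta (s r y : R) :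
  is_derive s 1 (fun s : R => shift_eta s r y) (r * (1 + (tan (y - eta0) + s * r) ^+ 2)^-1).
Proof.
pose A s := tan (y - eta0) + s * r.
have dA : is_derive s 1 A r.
  apply: is_derive_eps => e e0; apply: (@filterE _ (nbhs s)) => z.
  rewrite (_ : A z - A s - r * (z - s) = 0); last by rewrite /A; ring.
  by rewrite normr0 mulr_ge0// ltW.
have d1 : differentiable A s by apply/derivable1_diffP; case: dA.
have d2 : derivable (@atan R) (A s) 1 by exact: derivable_atan.
have d3 : is_derive s 1 (@atan R \o A) (r * (1 + A s ^+ 2)^-1).
  apply: DeriveDef.
    by apply: diff_derivable; apply: differentiable_comp => //; apply/derivable1_diffP.
  rewrite (derive_comp1 _ d1 d2); have [_ ->] := is_derive1_atan (A s).
  by have [_ ->] := dA; rewrite mulrC.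
rewrite -[fun s => _]/(cst eta0 + (@atan R \o A)).
by apply: is_derive_eq; rewrite add0r.
Qed.

Lemma shift_eta0 (r y : R) : `|y - eta0| < pi / 2 -> shift_eta 0 r y = y.
Proof.
move=> h; rewrite /shift_eta mul0r addr0 tanK; first by rewrite addrC subrK.
by rewrite in_itv/= -ltr_norml.
Qed.

(** Outside the moving strip the field vanishes and points stay fixed. Inside it [gproj] is
    preserved, and the identity cos^2(atan y) = 1 / (1 + y^2) turns the speed of [shift_eta] into
    the field. *)
Lemma vflow_is_flow : is_flow vfield vflow.
Proof.
split=> [q|s q].
  by rewrite /vflow; case: ifP => // h; rewrite shift_eta0// gptK.
have [h|h] := ltP `|geta q - eta0| (pi / 2); last first.
  have Ev r : vflow r q = q by rewrite /vflow ltNge h.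
  rewrite (_ : (fun r => vflow r q) = cst q); last by apply/funext.
  rewrite Ev /vfield /cosbump ltNge h mulr0 /dgpt !mulr0 !(addr0, subr0).
  exact: is_derive_cst.
have E r : vflow r q = gpt (gxi q) (shift_eta r (v (gproj q)) (geta q)) (gtau q).
  exact: vflowE.
rewrite (_ : (fun r => vflow r q) = (fun r => gpt (gxi q) (shift_eta r (v (gproj q)) (geta q)) (gtau q))); last exact/funext.
have [d1 d2] := is_derive_shift_eta s (v (gproj q)) (geta q).
have c1 : differentiable (fun=> gxi q : R) s by exact: differentiable_cst.
have c2 : differentiable (fun=> gtau q : R) s by exact: differentiable_cst.
have c3 : differentiable (fun r => shift_eta r (v (gproj q)) (geta q)) s by apply/derivable1_diffP.
apply: DeriveDef.
  by apply: diff_derivable; exact: differentiable_gpt.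
rewrite (derive_gpt al be _ c1 c3 c2) d2 !derive_cst E /vfield.
rewrite (gxiK albe) (getaK albe).
have -> : gproj (gpt (gxi q) (shift_eta s (v (gproj q)) (geta q)) (gtau q)) = gproj q.
  by rewrite /gproj gxiK// gtauK.
congr (dgpt _ _ _ _ _ (_ * _) _).
by rewrite [in RHS]/shift_eta [eta0 + _]addrC addrK cosbump_atan.
Qed.

Lemma C1_on_vfield : C1_on setT v -> C1_on setT vfield.
Proof.
move=> cv; have oT := @openT (heis R).
have ci := @C1_on_linear _ (heis R) (heis R) setT idfun (fun x => cvg_id).
have cx := C1_on_gxi al be oT ci; have ce := C1_on_geta al be oT ci.
have cp := C1_on_gproj al be oT ci.
have k r := @C1_on_cst _ (heis R) R setT r.
pose m q := v (gproj q) * cosbump (geta q - eta0).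
have cm : C1_on setT m.
  apply: (C1_onM oT).
    exact: (C1_on_comp2 oT (fun _ _ => I) cv (C1_on_gxi al be oT ci) (C1_on_gtau al be oT ci)).
  exact: (C1_on_comp_real oT (fun _ _ => I) C1_on_cosbump (C1_onB oT ce (k eta0))).
apply: C1_on_pair; [exact: oT| |].
  apply: C1_on_pair; [exact: oT| |].
    by apply: (C1_onB oT); [exact: k|exact: (C1_onM oT (k be) cm)].
  by apply: (C1_onD oT); [exact: k|exact: (C1_onM oT (k al) cm)].
apply: (C1_onB oT); first exact: k.
apply: (C1_onD oT); first exact: (C1_onM oT cx cm).
exact: (C1_onM oT ce (k 0)).
Qed.

Variables (a b c d : R).
Hypothesis v_supp : forall x, ~ rect a b c d x -> v x = 0.

Definition vsupp : set (heis R) :=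
  [set q | rect a b c d (gproj q) /\ `|geta q - eta0| <= pi / 2].

Lemma compact_vsupp : compact vsupp.
Proof.
pose B : set (R * R * R) := rect a b c d `*` `[eta0 - pi / 2, eta0 + pi / 2]%classic.
have -> : vsupp = (fun z : R * R * R => gpt z.1.1 z.2 z.1.2) @` B.
  apply/seteqP; split => [q [h1 h2]|_ [[z e] [h1 h2] <-]].
    exists (gproj q, geta q); last by rewrite /= gptK.
    by split => //=; rewrite in_itv/=; move: h2; rewrite ler_norml; lra.
  rewrite /= in_itv/= in h1 h2; split; rewrite ?getaK//.
    by rewrite /gproj gxiK// gtauK// -surjective_pairing.
  by rewrite /= ler_norml; lra.
apply: continuous_compact; last first.
  by apply: compact_setX; [exact: compact_rect|exact: segment_compact].
apply: continuous_in_subspaceT => z _.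
have oT := @openT (R * R * R)%type.
have cz : C1_on setT (fun z : R * R * R => gpt z.1.1 z.2 z.1.2).
  have c1 := @C1_on_fst _ (R * R)%type R setT.
  apply: (C1_on_gpt al be oT); last exact: (C1_on_snd_comp oT c1).
    exact: (C1_on_fst_comp oT c1).
  exact: C1_on_snd.
exact: C1_on_continuous cz I.
Qed.

Lemma vf_support_sub : vf_support vfield `<=` vsupp.
Proof.
have cV : closed vsupp.
  by apply: compact_closed; [exact: norm_hausdorff|exact: compact_vsupp].
have Ecl := (closure_id vsupp).1 cV; rewrite /vf_support [X in _ `<=` X]Ecl.
apply: closure_subset => q /= Uq; split.
  apply: contrapT => /v_supp v0; move: Uq; rewrite /vfield v0 mul0r.
  by rewrite /dgpt !mulr0 !(addr0, subr0) eqxx.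
rewrite leNgt; apply/negP => h; move: Uq.
rewrite /vfield /cosbump ltNge (ltW h) mulr0 /dgpt !mulr0 !(addr0, subr0).
by rewrite eqxx.
Qed.

Lemma compact_vf_support : compact (vf_support vfield).
Proof.
apply: subclosed_compact vf_support_sub; last exact: compact_vsupp.
exact: closed_closure.
Qed.

End Flow.

Section RealDerivativeRules.
Context {R : realType}.
Implicit Types (f g : R -> R) (s a b : R).

Lemma isD_affine a b s : is_derive s 1 (fun x => a + x * b) b.
Proof.
apply: is_derive_eps => e e0; apply: (@filterE _ (nbhs s)) => z.
rewrite (_ : a + z * b - (a + s * b) - b * (z - s) = 0); last by ring.
by rewrite normr0 mulr_ge0// ltW.
Qed.

Lemma isD_add f g s a b : is_derive s 1 f a -> is_derive s 1 g b ->
  is_derive s 1 (fun x => f x + g x) (a + b).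
Proof. by move=> df dg; exact: (is_deriveD (f := f) (g := g)). Qed.

Lemma isD_mul f g s a b : is_derive s 1 f a -> is_derive s 1 g b ->
  is_derive s 1 (fun x => f x * g x) (f s * b + g s * a).
Proof. by move=> df dg; exact: (is_deriveM (f := f) (g := g)). Qed.

Lemma isD_comp f g s a b : is_derive s 1 f a -> is_derive (f s) 1 g b ->
  is_derive s 1 (fun x => g (f x)) (b * a).
Proof.
move=> [df Ea] [dg Eb]; have df' : differentiable f s by apply/derivable1_diffP.
apply: DeriveDef.
  by apply: diff_derivable; apply: differentiable_comp => //; apply/derivable1_diffP.
by rewrite -[LHS]/('D_1 (g \o f) s) (derive_comp1 _ df' dg) Ea Eb.
Qed.

Lemma isD_inv s : s != 0 -> is_derive s 1 (fun x => x^-1) (- s ^- 2).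
Proof.
move=> s0; have := is_deriveV s0 (is_derive_id s 1).
by rewrite /GRing.scale /= mulr1; apply.
Qed.

End RealDerivativeRules.

(** * Dependence of the area density on the variation parameter *)

Section AreaIntegrand.
Context {R : realType}.
Variables (e0 z v zx vx zy vy : R).

(** At a fixed point, [z] stands for tan(u - e0), and the other letters for [v] and the partial
    derivatives of both. Then [vA] is the tangent coordinate after time s, [vT] the varied height,
    [vI] the derivative of atan there, and [vW] the value of [om] for the varied graph. *)
Definition vA (s : R) : R := z + s * v.
Definition vT (s : R) : R := e0 + atan (vA s).
Definition vN (s : R) : R := zx + s * vx + 2 * vT s * (zy + s * vy).
Definition vI (s : R) : R := (1 + vA s ^+ 2)^-1.
Definition vW (s : R) : R := vN s * vI s.
Definition vW' (s : R) : R :=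
  vN s * (- vI s ^+ 2 * (2 * vA s * v)) +
  vI s * (vx + (2 * vT s * vy + (zy + s * vy) * (2 * (vI s * v)))).

Lemma one_sqr_gt0 (x : R) : 0 < 1 + x ^+ 2.
Proof. by rewrite ltr_pwDl// sqr_ge0. Qed.

Lemma is_derive_vW (s : R) : is_derive s 1 vW (vW' s).
Proof.
have dA : is_derive s 1 vA v by exact: isD_affine.
have dA2 : is_derive s 1 (fun s => 1 + vA s ^+ 2) (0 + (vA s * v + vA s * v)).
  exact: (isD_add (is_derive_cst _ _ _) (isD_mul dA dA)).
have dI : is_derive s 1 vI (- vI s ^+ 2 * (2 * vA s * v)).
  have n0 : 1 + vA s ^+ 2 != 0 by rewrite gt_eqF// one_sqr_gt0.
  apply: (is_derive_eq (isD_comp dA2 (isD_inv n0))).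
  by rewrite /vI exprVn add0r; ring.
have dT : is_derive s 1 vT (0 + (vI s * v)).
  exact: (isD_add (is_derive_cst _ _ _) (isD_comp dA (is_derive1_atan _))).
have dT2 : is_derive s 1 (fun s => 2 * vT s) (2 * (0 + vI s * v) + vT s * 0).
  by apply: (isD_mul (f := fun=> 2)) => //; exact: is_derive_cst.
have dN : is_derive s 1 vN (vx + (2 * vT s * vy + (zy + s * vy) * (2 * (0 + vI s * v) + vT s * 0))).
  by apply: isD_add; [exact: isD_affine|apply: isD_mul => //; exact: isD_affine].
apply: (is_derive_eq (isD_mul dN dI)).
by rewrite /vW'; congr (_ + _); congr (_ * _); ring.
Qed.

Lemma is_derive_sqrt_vW (s : R) :
  is_derive s 1 (fun s => Num.sqrt (1 + vW s ^+ 2)) (vW s * vW' s / Num.sqrt (1 + vW s ^+ 2)).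
Proof.
have p := one_sqr_gt0 (vW s); have dW := is_derive_vW s.
have d1 : is_derive s 1 (fun s => 1 + vW s ^+ 2) (0 + (vW s * vW' s + vW s * vW' s)).
  exact: (isD_add (is_derive_cst _ _ _) (isD_mul dW dW)).
apply: (is_derive_eq (isD_comp d1 (is_derive1_sqrt p))).
move: (Num.sqrt _) (sqrtr_gt0 (1 + vW s ^+ 2)); rewrite p => r r0.
by field; rewrite gt_eqF.
Qed.

Definition vbound : R :=
  (`|zx| + `|vx| + 2 * (`|e0| + pi / 2) * (`|zy| + `|vy|)) * `|v| +
  (`|vx| + 2 * (`|e0| + pi / 2) * `|vy| + (`|zy| + `|vy|) * (2 * `|v|)).

(** The tangent coordinate enters the derivative only through [vI] and [2 * vA * vI], both bounded
    by 1, and through the bounded [vT]. Moreover W / sqrt(1 + W^2) is at most 1 in absolute value,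
    so a bound on [vW'] suffices. It does not depend on s, as dominated differentiation requires. *)
Lemma sqrt_vW_bound (s : R) : `|s| <= 1 ->
  `|vW s * vW' s / Num.sqrt (1 + vW s ^+ 2)| <= vbound.
Proof.
move=> s1; have I0 : 0 < vI s by rewrite invr_gt0 one_sqr_gt0.
have I1 : vI s <= 1 by rewrite invf_le1 ?one_sqr_gt0// lerDl sqr_ge0.
have IA : `|2 * vA s| * vI s <= 1.
  rewrite /vI ler_pdivrMr ?one_sqr_gt0// mul1r ler_norml.
  by have := sqr_ge0 (vA s - 1); have := sqr_ge0 (vA s + 1); rewrite !expr2; lra.
have T1 : `|vT s| <= `|e0| + pi / 2.
  rewrite (le_trans (ler_normD _ _))// lerD2l ler_norml.
  by rewrite (ltW (atan_gtNpi2 _)) (ltW (atan_ltpi2 _)).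
have sm (x y : R) : `|x + s * y| <= `|x| + `|y|.
  by rewrite (le_trans (ler_normD _ _))// lerD2l normrM ler_piMl.
have p2 : 0 <= `|e0| + pi / 2 :> R by rewrite (le_trans _ T1).
have TT (x y : R) : `|x| <= y -> `|2 * vT s * x| <= 2 * (`|e0| + pi / 2) * y.
  by move=> xy; rewrite !normrM ger0_norm// ler_pM// ?mulr_ge0// ler_pM2l.
have N1 : `|vN s| <= `|zx| + `|vx| + 2 * (`|e0| + pi / 2) * (`|zy| + `|vy|).
  by rewrite (le_trans (ler_normD _ _))// lerD// TT.
have W'1 : `|vW' s| <= vbound.
  rewrite (le_trans (ler_normD _ _))//; apply: lerD.
    rewrite normrM ler_pM// normrM normrN normrM normrM.
    rewrite !(ger0_norm (ltW I0)) mulrA ler_piMl// -mulrA [vI s * `|_|]mulrC.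
    by apply: mulr_ile1; rewrite ?mulr_ge0// ltW.
  rewrite normrM (ger0_norm (ltW I0)) (le_trans (ler_piMl _ I1))//.
  rewrite (le_trans (ler_normD _ _))// -addrA lerD2l (le_trans (ler_normD _ _))//.
  rewrite lerD ?TT// normrM ler_pM// normrM ger0_norm// ler_pM2l// normrM.
  by rewrite (ger0_norm (ltW I0)) ler_piMl.
have S : `|vW s| <= Num.sqrt (1 + vW s ^+ 2).
  by rewrite -sqrtr_sqr ler_wsqrtr// ler_wpDl.
have S0 : 0 < Num.sqrt (1 + vW s ^+ 2) by rewrite sqrtr_gt0 one_sqr_gt0.
rewrite normrM normfV (gtr0_norm S0) ler_pdivrMr// normrM mulrC.
by rewrite ler_pM.
Qed.

Lemma vbound_ge0 : 0 <= vbound.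
Proof.
have p : 0 <= `|e0| + pi / 2 :> R by rewrite addr_ge0// ltW// divr_gt0// pi_gt0.
by rewrite /vbound; repeat (exact: p || exact: normr_ge0 || exact: (ler0n _ 2) || apply: addr_ge0 || apply: mulr_ge0).
Qed.

(* The derivative at 0 when [z = tan (u - e0)] and the variation of u is w. *)
Lemma vW'0 (w ux uy wx wy u0 : R) : u0 = e0 + atan z -> v = w * (1 + z ^+ 2) ->
  zx = ux * (1 + z ^+ 2) -> zy = uy * (1 + z ^+ 2) ->
  vx = wx * (1 + z ^+ 2) + w * (2 * z * zx) -> vy = wy * (1 + z ^+ 2) + w * (2 * z * zy) ->
  vW 0 = ux + 2 * u0 * uy /\ vW' 0 = wx + 2 * u0 * wy + 2 * w * uy.
Proof.
rewrite /vW' /vW /vN /vI /vT /vA !mul0r !addr0 => -> -> -> -> -> ->.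
have n0 : 1 + z ^+ 2 != 0 by rewrite gt_eqF// one_sqr_gt0.
by move: (atan z) => T; split; field.
Qed.

End AreaIntegrand.

Section FirstVariation.
Context {R : realType} (al be : R) {M : topologicalType}.
Hypothesis albe : al ^+ 2 + be ^+ 2 = 1.
Notation mu := (@lebesgue_measure R).
Notation mu2 := (mu \x mu)%E.
Variables (F : M -> heis R) (D : set (plane R)) (psi : plane R -> M) (u : plane R -> R).
Hypotheses (stat : area_stationary F) (gc : graph_chart al be F D psi u).
Variable (eta0 : R).
Hypothesis u_eta0 : forall x, D x -> `|u x - eta0| < pi / 2.
Variables (a b c d : R).
Hypothesis rectD : rect a b c d `<=` D.

Let oD : open D. Proof. by case: gc. Qed.
Let cu : C1_on D u. Proof. by case: gc. Qed.
Let Fpsi x : D x -> F (psi x) = gpt al be x.1 (u x) x.2. Proof. by case: gc => _ _ _; apply. Qed.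

Let cos_u x : D x -> 0 < cos (u x - eta0).
Proof. by move=> /u_eta0 h; apply: cos_gt0_pihalf; rewrite -ltr_norml. Qed.

(** In this coordinate the flow is the translation by s v; it is defined because u stays within pi/2
    of [eta0]. *)
Let zf x : R := tan (u x - eta0).

Let dtan t : cos t != 0 -> is_derive t 1 (@tan R) (1 + tan t ^+ 2).
Proof. by move=> ct; rewrite -cos2_tan2//; exact: is_derive_tan. Qed.

Let cz : C1_on D zf.
Proof.
pose A := [set t : R | `|t| < pi / 2].
have oA : open A by exact: open_norm_lt.
have cA t : A t -> cos t != 0.
  by move=> At; rewrite gt_eqF// cos_gt0_pihalf// -ltr_norml.
have ctan : C1_on A (@tan R).
  apply: (C1_on_is_derive (dg := fun t => 1 + tan t ^+ 2) oA) => t /cA ct.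
  split; first exact: dtan.
  apply: cvgD; first exact: cvg_cst.
  by apply: cvgM; exact: continuous_tan.
have ce : C1_on D (fun x => u x - eta0) by exact: (C1_onB oD cu (@C1_on_cst _ _ _ D eta0)).
exact: (C1_on_comp_real oD u_eta0 ctan ce).
Qed.

Let dz x v : D x -> 'D_v zf x = 'D_v u x * (1 + zf x ^+ 2).
Proof.
move=> Dx; have du := C1_on_diff cu Dx.
have ct : cos (u x - eta0) != 0 by rewrite gt_eqF// cos_u.
have [d1 d2] := dtan ct.
have de : differentiable (fun x => u x - eta0) x by apply: differentiableB; [exact: du|exact: differentiable_cst].
rewrite -[LHS]/('D_v (@tan R \o (fun x => u x - eta0)) x) (derive_comp1 v de d1) d2 mulrC; congr (_ * _).
rewrite deriveB; [|exact: diff_derivable|exact: derivable_cst].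
by rewrite derive_cst subr0.
Qed.

Section Vary.
Variable v : plane R -> R.
Hypotheses (cv : C1_on setT v) (v0 : forall x, ~ rect a b c d x -> v x = 0).

Let us s x := shift_eta eta0 s (v x) (u x).
Let cvD : C1_on D v. Proof. exact: C1_on_sub cv. Qed.

Lemma C1_on_varied s : C1_on D (us s).
Proof.
have k r := @C1_on_cst _ (plane R) R D r.
have ca : C1_on setT (@atan R).
  apply: (C1_on_is_derive (dg := fun t => (1 + t ^+ 2)^-1)); first exact: openT.
  move=> t _; split; first exact: is_derive1_atan.
  apply: cvgV; first by rewrite gt_eqF// one_sqr_gt0.
  by apply: cvgD; [exact: cvg_cst|apply: cvgM; exact: cvg_id].
have ci := C1_onD oD cz (C1_onM oD (k s) cvD).
exact: (C1_onD oD (k eta0) (C1_on_comp_real oD (fun _ _ => I) ca ci)).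
Qed.

Lemma derive_varied s x w : D x ->
  'D_w (us s) x = ('D_w zf x + s * 'D_w v x) * (1 + (zf x + s * v x) ^+ 2)^-1.
Proof.
move=> Dx; have d1 := C1_on_diff cz Dx; have d2 := C1_on_diff cvD Dx.
have d3 : differentiable (fun x => s * v x) x.
  by apply: (differentiableM (f := fun=> s)); [exact: differentiable_cst|exact: d2].
have d4 : differentiable (fun x => zf x + s * v x) x by exact: differentiableD.
have [d5 E5] := is_derive1_atan (zf x + s * v x).
have d6 : differentiable (@atan R \o (fun x => zf x + s * v x)) x.
  by apply: differentiable_comp; [exact: d4|apply/derivable1_diffP].
rewrite -[LHS]/('D_w (cst eta0 + (@atan R \o (fun x => zf x + s * v x))) x).
rewrite deriveD; [|exact: derivable_cst|exact: diff_derivable].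
rewrite derive_cst add0r (derive_comp1 w d4 d5) E5 mulrC; congr (_ * _).
rewrite deriveD; [|exact: diff_derivable|exact: diff_derivable].
congr (_ + _); apply: (deriveZ s); exact: diff_derivable.
Qed.

Lemma om_varied s x : D x ->
  om (us s) x = vW eta0 (zf x) (v x) (dx zf x) (dx v x) (dy zf x) (dy v x) s.
Proof.
move=> Dx; rewrite /om dxE dyE !derive_varied// -!dxE -!dyE /vW /vN /vI /vT /vA.
rewrite /us /shift_eta -/(zf x).
by move: (dx zf x) (dx v x) (dy zf x) (dy v x) (_^-1) (atan _) => e f g h k l; ring.
Qed.

Lemma varied_chart s : graph_chart al be (vflow al be eta0 v s \o F) D psi (us s).
Proof.
split; [exact: oD|by case: gc|exact: C1_on_varied|].
move=> x Dx; rewrite /= Fpsi// vflowE ?getaK ?u_eta0// gxiK// gtauK//.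
by rewrite /gproj gxiK// gtauK// -surjective_pairing.
Qed.

Let G x := gpt al be x.1 (u x) x.2.
Let O := D `&` G @^-1` ~` vf_support (vfield al be eta0 v).
(** The parameters whose surface point meets the support of the field. Removing the open set [O]
    from the rectangle makes closedness and measurability immediate. *)
Let K := rect a b c d `&` ~` O.

Let oO : open O.
Proof.
apply: continuous_open_preimage; [exact: oD| |].
  exact/closed_openC/closed_closure.
by move=> x Dx; exact: (C1_on_continuous (C1_on_graph al be oD cu) Dx).
Qed.

Let KE x : K x <-> D x /\ vf_support (vfield al be eta0 v) (F (psi x)).
Proof.
split=> [[rx nO]|[Dx sx]].
  have Dx := rectD rx; split => //; apply: contrapT => ns; apply: nO; split => //.
  by rewrite /preimage /= /G -Fpsi.
split; last by move=> [_]; apply; rewrite /G -Fpsi.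
have [] := vf_support_sub albe v0 sx.
by rewrite Fpsi// /gproj gxiK// gtauK// -surjective_pairing.
Qed.

Let KD : K `<=` D. Proof. by move=> x /KE[]. Qed.

Let closedK : closed K.
Proof. exact: (closedI (@closed_rect _ a b c d) (open_closedC oO)). Qed.

Let compactK : compact K.
Proof. by apply: subclosed_compact closedK (@compact_rect _ a b c d) _ => x []. Qed.

Let mK : measurable K.
Proof.
exact: (measurableI _ _ (measurable_rect a b c d) (measurableC (open_plane_measurable oO))).
Qed.

(** The open set psi(D) isolates this sheet from any other one that crosses the support, and all its
    points are interior points of the surface. *)
Lemma varied_portion : portion F (vfield al be eta0 v) (psi @` K).
Proof.
have [_ ch _ _] := gc; split.
- apply: continuous_compact => //.
  by apply: continuous_in_subspaceT => x /set_mem /KD; exact: chart_continuous.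
- exists (psi @` D); first exact: chart_image_open.
  apply/seteqP; split => [_ [x /KE[Dx sx] <-]|_ [[x Dx <-] sx]].
    by split => //; exists x.
  by exists x => //; apply/KE.
- apply/seteqP; split => // _ [[x Kx <-] nb]; apply: nb.
  exists D, psi; split; [exact: oD|exact: graph_local_param gc|].
  by exists x => //; exact: KD.
Qed.

(** Off [K] the field vanishes near the surface point, or [v] vanishes near x. As the bump is
    positive on the graph, [v] vanishes near x in both cases, so the graph is unchanged on a whole
    neighbourhood, as needed for the derivatives in the density. *)
Let unmoved s x : D x -> ~ K x -> gdens (us s) x = gdens u x.
Proof.
move=> Dx nK.
have vn : \forall y \near x, v y = 0.
  have [rx|nr] := pselect (rect a b c d x); last first.
    have oC : open (~` rect a b c d) by exact/closed_openC/closed_rect.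
    by apply: filterS (open_near oC nr) => y; exact: v0.
  have Ox : O x by apply: contrapT => nO; apply: nK.
  apply: filterS (open_near oO Ox) => y [Dy ns]; apply: contrapT => vy0.
  apply: ns; apply: subset_closure => /=; apply/eqP => U0; apply: vy0.
  move: U0; rewrite /vfield /G (getaK albe) /gproj (gxiK albe) (gtauK albe) -surjective_pairing.
  move=> /(dgpt_eq0 albe)[_ + _] => /eqP; rewrite mulf_eq0 => /orP[/eqP//|/eqP E].
  move: E; rewrite /cosbump u_eta0// => /eqP; rewrite expf_eq0 /= => /eqP E.
  by have := cos_u Dy; rewrite E ltxx.
have E : \forall y \near x, us s y = u y.
  have Dn := open_near oD Dx; apply: filterS2 vn Dn => y vy Dy.
  rewrite /us vy; have := shift_eta0 0 (u_eta0 Dy).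
  by rewrite /shift_eta !mulr0.
by rewrite /gdens /om !dxE !dyE !(near_eq_derive _ E) (nbhs_singleton E).
Qed.

Let dens_int s (A : set (plane R)) : measurable A -> A `<=` rect a b c d ->
  mu2.-integrable A (EFin \o gdens (us s)).
Proof.
move=> mA Ar; apply: (@integrableS _ _ _ mu2 _ _ _ (measurable_rect a b c d) mA Ar).
apply: (continuous_rect_integrable oD rectD) => x Dx.
by have [] := gdens_nonneg_cont oD (C1_on_varied s) Dx.
Qed.

(** The area of the portion differs from the integral over the full rectangle by a constant in s, so
    stationarity can be read on the rectangle and the shape of the support disappears. *)
Lemma area_varied s :
  fine (subriem_area (vflow al be eta0 v s \o F) (psi @` K)) =
  (\int[mu2]_(x in rect a b c d) gdens (us s) x)%R -
  (\int[mu2]_(x in rect a b c d `\` K) gdens u x)%R.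
Proof.
rewrite (area_graph albe (varied_chart s) mK KD) -/(Rintegral mu2 K (gdens (us s))).
have Kr : K `<=` rect a b c d by move=> x [].
have mrK : measurable (rect a b c d `\` K) by apply: measurableD => //; exact: measurable_rect.
have -> : (\int[mu2]_(x in rect a b c d) gdens (us s) x)%R =
    (\int[mu2]_(x in K) gdens (us s) x)%R + (\int[mu2]_(x in rect a b c d `\` K) gdens (us s) x)%R.
  rewrite -Rintegral_setU//; first by rewrite setDUK.
    by rewrite setDUK//; apply: dens_int => //; exact: measurable_rect.
  by apply/disj_setPS => x [Kx [_ nK]].
suff -> : (\int[mu2]_(x in rect a b c d `\` K) gdens (us s) x)%R =
    (\int[mu2]_(x in rect a b c d `\` K) gdens u x)%R by rewrite addrK.
by apply: eq_Rintegral => x /set_mem [/rectD Dx nK]; exact: unmoved.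
Qed.

Let f s x := gdens (us s) x.

(** Differentiation under the integral sign for s in ]-1, 1[, dominated by [vbound], which is
    continuous on the rectangle. *)
Lemma variation_integral0 :
  (\int[mu2]_(x in rect a b c d) ((om (us 0) x) / gdens (us 0) x *
     vW' eta0 (zf x) (v x) (dx zf x) (dx v x) (dy zf x) (dy v x) 0))%R = 0.
Proof.
pose W x := vW eta0 (zf x) (v x) (dx zf x) (dx v x) (dy zf x) (dy v x).
pose W' x := vW' eta0 (zf x) (v x) (dx zf x) (dx v x) (dy zf x) (dy v x).
have fE x s : D x -> f s x = Num.sqrt (1 + W x s ^+ 2).
  by move=> Dx; rewrite /f /gdens om_varied.
have df x (s : R) : D x -> is_derive s 1 (f ^~ x) (W x s * W' x s / Num.sqrt (1 + W x s ^+ 2)).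
  move=> Dx; rewrite (_ : f ^~ x = fun s => Num.sqrt (1 + W x s ^+ 2)).
    exact: is_derive_sqrt_vW.
  by apply/funext => t; exact: fE.
have d1f x s : D x -> partial1of2 f s x = W x s * W' x s / Num.sqrt (1 + W x s ^+ 2).
  by move=> Dx; rewrite /partial1of2 derive1E; have [_ ->] := df x s Dx.
pose B x := vbound eta0 (v x) (dx zf x) (dx v x) (dy zf x) (dy v x).
have intB : mu2.-integrable (rect a b c d) (EFin \o B).
  apply: (continuous_rect_integrable oD rectD) => x Dx.
  have n g : {for x, continuous g} -> {for x, continuous (fun x => `|g x : R|)}.
    by move=> cg; exact: (continuous_comp cg (@norm_continuous _ _ _)).
  have k (r : R) : {for x, continuous (fun=> r : R)} by exact: cst_continuous.
  have c1 := n _ (C1_on_continuous cvD Dx); have c2 := n _ (C1_on_dx cz Dx).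
  have c3 := n _ (C1_on_dx cvD Dx); have c4 := n _ (C1_on_dy cz Dx).
  have c5 := n _ (C1_on_dy cvD Dx).
  apply: cvgD.
    apply: cvgM; last exact: c1.
    apply: cvgD; first exact: (cvgD c2 c3).
    by apply: cvgM; [exact: k|exact: (cvgD c4 c5)].
  apply: cvgD; first by apply: cvgD; [exact: c3|apply: cvgM; [exact: k|exact: c5]].
  by apply: cvgM; [exact: (cvgD c4 c5)|exact: (cvgM (k 2) c1)].
have I0 : `](-1), 1[%classic (0 : R) by rewrite /= in_itv/= ltr01 oppr_lt0 ltr01.
have intf (s : R) : `](-1), 1[%classic s -> mu2.-integrable (rect a b c d) (EFin \o f s).
  by move=> _; apply: dens_int => //; exact: measurable_rect.
have der1 (s : R) (x : plane R) : `](-1), 1[%classic s -> rect a b c d x -> derivable (f ^~ x) s 1.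
  by move=> _ /rectD /(df x s)[].
have ub (s : R) (x : plane R) : `](-1), 1[%classic s -> rect a b c d x -> `|partial1of2 f s x| <= B x.
  rewrite /= in_itv/= => /andP[s1 s2] /rectD Dx; rewrite d1f//; apply: sqrt_vW_bound.
  by rewrite ler_norml !ltW.
have B0 x : 0 <= B x by exact: vbound_ge0.
have H := differentiation_under_integral (mu := mu2) (f := f) (measurable_rect a b c d) I0 intf der1 B0 intB ub.
have stat' := stat (C1_on_vfield al be eta0 cv) (compact_vf_support albe v0) (vflow_is_flow albe eta0 v) varied_portion.
have E : derive1 (fun s => (\int[mu2]_(x in rect a b c d) f s x)%R) 0 = 0.
  rewrite derive1E; pose C := (\int[mu2]_(x in rect a b c d `\` K) gdens u x)%R.
  rewrite (_ : (fun s => _) = (fun s => fine (subriem_area (vflow al be eta0 v s \o F) (psi @` K))) + cst C); last first.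
    by apply/funext => s; rewrite !fctE area_varied subrK.
  have [d1 d2] := stat'; rewrite (deriveD d1 (derivable_cst C _ _)).
  by rewrite d2 derive_cst addr0.
rewrite -[RHS]E H; apply: eq_Rintegral => x /set_mem /rectD Dx.
by rewrite d1f// om_varied// -/(f 0 x) fE// -/(W x 0) -/(W' x 0) mulrAC.
Qed.

End Vary.

Theorem first_variation (w : plane R -> R) : C1_on setT w ->
  (forall x, ~ rect a b c d x -> w x = 0) ->
  (\int[mu2]_(x in rect a b c d)
     (om u x / gdens u x * (dx w x + 2 * u x * dy w x + 2 * w x * dy u x)))%R = 0.
Proof.
(* At s = 0 the height moves at speed v / (1 + z^2), so this [v] realizes the variation [w]. Setting
   it to 0 off [D] is harmless, since [w] already vanishes off the rectangle. *)
move=> cw w0; pose v x := if asbool (D x) then w x * (1 + zf x ^+ 2) else 0.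
have oC : open (~` rect a b c d) by exact/closed_openC/closed_rect.
have cwD : C1_on D w by exact: C1_on_sub cw.
have k r := @C1_on_cst _ (plane R) R D r.
have vE x : D x -> v x = w x * (1 + zf x ^+ 2) by move=> Dx; rewrite /v asboolT.
have v0 x : ~ rect a b c d x -> v x = 0.
  by move=> /w0 wx; rewrite /v wx mul0r; case: ifP.
have cvD : C1_on D v.
  apply: (C1_on_eq (f := fun x => w x * (1 + zf x * zf x)) oD) => [x /vE->//|].
  by apply: (C1_onM oD cwD); apply: (C1_onD oD (k 1)); exact: (C1_onM oD cz cz).
have cv : C1_on setT v.
  rewrite (_ : setT = D `|` ~` rect a b c d).
    apply: C1_onU => //; apply: (C1_on_eq (f := fun=> 0) oC); last exact: C1_on_cst.
    by move=> x /v0.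
  apply/seteqP; split => // x _; have [Dx|nD] := pselect (D x); first by left.
  by right => rx; apply: nD; exact: rectD.
rewrite -[RHS](variation_integral0 cv v0); apply: eq_Rintegral => x /set_mem /rectD Dx.
have dv e : 'D_e v x = 'D_e w x * (1 + zf x ^+ 2) + w x * (2 * zf x * 'D_e zf x).
  have d1 := C1_on_diff cwD Dx; have d2 := C1_on_diff cz Dx.
  have d3 : differentiable (fun x => zf x * zf x) x by exact: differentiableM.
  have E : \forall y \near x, v y = w y * (1 + zf y * zf y).
    by apply: filterS (open_near oD Dx) => y /vE.
  rewrite (near_eq_derive _ E).
  rewrite (deriveM (f := w) (g := fun y => 1 + zf y * zf y)); last 2 first.
  - exact: diff_derivable.
  - by apply: diff_derivable; apply: differentiableD => //; exact: differentiable_cst.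
  rewrite (deriveD (f := fun=> 1 : R) (g := fun y => zf y * zf y)); last 2 first.
  - exact: derivable_cst.
  - exact: diff_derivable.
  rewrite derive_cst add0r (deriveM (f := zf)); last 2 first.
  - exact: diff_derivable.
  - exact: diff_derivable.
  by rewrite /GRing.scale /=; move: ('D_e w x) ('D_e zf x) (zf x) (w x) => p q r t; ring.
have u0 : u x = eta0 + atan (zf x).
  have := shift_eta0 0 (u_eta0 Dx).
  by rewrite /shift_eta mul0r addr0.
have [W0 W'0] := @vW'0 _ eta0 (zf x) (v x) (dx zf x) (dx v x) (dy zf x) (dy v x)
  (w x) (dx u x) (dy u x) (dx w x) (dy w x) (u x) u0 (vE _ Dx)
  ltac:(by rewrite !dxE dz) ltac:(by rewrite !dyE dz) ltac:(by rewrite !dxE dv) ltac:(by rewrite !dyE dv).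
by rewrite W'0 /gdens om_varied// W0.
Qed.

End FirstVariation.

(** * Transport along integral curves *)

Section SegmentIntegrals.
Context {R : realType}.
Notation mu := (@lebesgue_measure R).
Notation mu2 := (mu \x mu)%E.
Implicit Types (a b c d t r e : R).

Lemma continuous_at_seg (f : R -> R) a b :
  (forall x, a <= x <= b -> {for x, continuous f}) -> {within `[a, b], continuous f}.
Proof.
by move=> cf; apply: continuous_in_subspaceT => x /set_mem /=; rewrite in_itv/=; exact: cf.
Qed.

Lemma seg_integrable (f : R -> R) a b :
  (forall x, a <= x <= b -> {for x, continuous f}) -> mu.-integrable `[a, b]%classic (EFin \o f).
Proof.
move=> cf; apply: continuous_compact_integrable; first exact: segment_compact.
exact: continuous_at_seg.
Qed.

Lemma is_derive_continuous (f : R -> R) (x df : R) : is_derive x 1 f df -> {for x, continuous f}.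
Proof.
by move=> [dfx _]; have /derivable1_diffP := dfx; exact: differentiable_continuous.
Qed.

Lemma seg_FTC2 (f g : R -> R) a b : a < b ->
  (forall x, a <= x <= b -> is_derive x 1 g (f x)) ->
  (forall x, a <= x <= b -> {for x, continuous f}) ->
  (\int[mu]_(x in `[a, b]) f x)%R = g b - g a.
Proof.
move=> ab dg cf; have cg x : a <= x <= b -> {for x, continuous g}.
  by move=> /dg; exact: is_derive_continuous.
rewrite /Rintegral (continuous_FTC2 (F := g) ab (continuous_at_seg cf))//.
  split=> [x|| ]; first by rewrite in_itv/= => /andP[h1 h2]; have [] := dg x; rewrite ?ltW.
    by apply: cvg_at_right_filter; apply: cg; rewrite lexx ltW.
  by apply: cvg_at_left_filter; apply: cg; rewrite lexx ltW.
move=> x; rewrite in_itv/= => /andP[h1 h2]; rewrite derive1E.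
by have [|_ ->] := dg x; rewrite ?ltW.
Qed.

Lemma mu_seg a b : a <= b -> mu `[a, b]%classic = (b - a)%:E.
Proof.
move=> ab; rewrite lebesgue_measure_itv/= lte_fin; case: ltP => // ba.
by rewrite (le_anti (introT andP (conj ab ba))) subrr.
Qed.

Lemma seg_integral_le (f : R -> R) a b e : a <= b ->
  mu.-integrable `[a, b]%classic (EFin \o f) ->
  (forall x, a <= x <= b -> `|f x| <= e) ->
  `|(\int[mu]_(x in `[a, b]) f x)%R| <= e * (b - a).
Proof.
move=> ab intf fe; have m : measurable `[a, b]%classic by exact: measurable_itv.
apply: (le_trans (@le_normr_Rintegral _ _ _ mu _ _ m intf)).
have <- : (\int[mu]_(x in `[a, b]) e)%R = e * (b - a).
  by rewrite Rintegral_cst// -[b - a]/(fine (b - a)%:E) -(mu_seg ab).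
have i1 : mu.-integrable `[a, b]%classic (EFin \o (fun x => `|f x|)) by exact: (integrable_norm intf).
have i2 : mu.-integrable `[a, b]%classic (EFin \o (fun=> e)).
  by apply: seg_integrable => x _; exact: cst_continuous.
by apply: (@le_Rintegral _ _ _ mu _ _ _ m i1 i2) => x; rewrite /= in_itv/=; exact: fe.
Qed.

(** Replacing a factor that is within [e] of a constant by that constant costs at most [e] times the
    integral of the other factor's bound. It serves once across the tube and once along the
    curve. *)
Lemma seg_integral_freeze (f k : R -> R) a b (g e B : R) : a <= b -> 0 <= B ->
  (forall x, a <= x <= b -> {for x, continuous f}) ->
  (forall x, a <= x <= b -> {for x, continuous k}) ->
  (forall x, a <= x <= b -> `|f x - g| <= e) ->
  (forall x, a <= x <= b -> `|k x| <= B) ->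
  `|(\int[mu]_(x in `[a, b]) (f x * k x))%R - g * (\int[mu]_(x in `[a, b]) k x)%R|
    <= e * B * (b - a).
Proof.
move=> ab B0 cf ck fg kB; have m : measurable `[a, b]%classic by exact: measurable_itv.
have i1 := seg_integrable ck.
have i2 : mu.-integrable `[a, b]%classic (EFin \o (fun x => g * k x)).
  by apply: seg_integrable => x h; apply: cvgM; [exact: cst_continuous|exact: ck].
have i3 : mu.-integrable `[a, b]%classic (EFin \o (fun x => f x * k x)).
  by apply: seg_integrable => x h; apply: cvgM; [exact: cf|exact: ck].
rewrite -RintegralZl// -RintegralB//; apply: seg_integral_le => //.
  apply: seg_integrable => x h; apply: cvgB; apply: cvgM; [exact: cf|exact: ck| |exact: ck].
  exact: cst_continuous.
by move=> x h; rewrite -mulrBl normrM ler_pM// ?fg ?kB.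
Qed.

Lemma seg_integral_window (f : R -> R) a b c d : a <= c -> d <= b ->
  (forall x, a <= x <= b -> ~ (c <= x <= d) -> f x = 0) ->
  (\int[mu]_(x in `[a, b]) f x)%R = (\int[mu]_(x in `[c, d]) f x)%R.
Proof.
move=> ac db f0; rewrite Rintegral_mkcond [RHS]Rintegral_mkcond.
congr (Rintegral _ _ _); apply/funext => x; rewrite !patchE.
have p0 : point = 0 :> R by [].
rewrite p0; case: ifPn => [/set_mem/=|/negP xab]; rewrite ?in_itv/=.
  move=> xab; case: ifPn => // /negP ncd; apply: f0 => // xcd; apply: ncd; apply: mem_set.
  by rewrite /= in_itv.
case: ifPn => // /set_mem/=; rewrite in_itv/= => /andP[cx xd]; exfalso; apply: xab.
by apply: mem_set; rewrite /= in_itv/= (le_trans ac)// (le_trans xd).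
Qed.

Lemma continuous_sectr (f : plane R -> R) (x y : R) : {for (x, y), continuous f} ->
  {for y, continuous (fun z => f (x, z))}.
Proof.
move=> cf; apply: (continuous_comp (f := fun z : R => (x, z)) (g := f)) => //.
by apply: (@continuous_pair R R R (fun=> x) id y); [exact: cst_continuous|exact: cvg_id].
Qed.

Lemma fubini_rect (f : plane R -> R) (D : set (plane R)) a b c d : open D ->
  rect a b c d `<=` D -> (forall x, D x -> {for x, continuous f}) ->
  let J := fun x => (\int[mu]_(y in `[c, d]) f (x, y))%R in
  mu.-integrable `[a, b]%classic (EFin \o J) /\
  (\int[mu2]_(x in rect a b c d) f x)%R = (\int[mu]_(x in `[a, b]) J x)%R.
Proof.
move=> oD rD cf J; have mr := measurable_rect a b c d.
have mab : measurable `[a, b]%classic by exact: measurable_itv.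
have intf := continuous_rect_integrable oD rD cf.
have intg : mu2.-integrable setT ((EFin \o f) \_ (rect a b c d)).
  exact: (@integrable_mkcond _ _ _ mu2 _ _ mr).1.
have E : fubini_F mu ((EFin \o f) \_ (rect a b c d)) = (EFin \o J) \_ `[a, b]%classic.
  apply/funext => x; rewrite /fubini_F patchE; case: ifPn => [/set_mem xab|/negP xab].
    transitivity (\int[mu]_(y in `[c, d]) (f (x, y))%:E)%E.
      rewrite [RHS]integral_mkcond; apply: eq_integral => y _; rewrite !patchE.
      congr (if _ then _ else _); apply/idP/idP => /set_mem h; apply: mem_set; last by split.
      by case: h.
    rewrite /J /= /Rintegral fineK//; apply: integrable_fin_num; first exact: measurable_itv.
    apply: (seg_integrable (f := fun y => f (x, y))) => y cd; apply: continuous_sectr; apply: cf.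
    by apply: rD; split => //=; rewrite in_itv.
  apply: integral0_eq => y _; rewrite patchE; case: ifPn => // /set_mem[h _].
  by exfalso; apply: xab; apply: mem_set.
have F1 := integrable_fubini_F intg; have F2 := integral12_prod_meas1 intg.
set X := fubini_F _ _ in F1 F2; have EX : X = (EFin \o J) \_ `[a, b]%classic by exact: E.
rewrite EX in F1 F2; split.
  exact: (@integrable_mkcond _ _ _ mu _ _ mab).2.
by rewrite /Rintegral integral_mkcond -F2 -integral_mkcond.
Qed.

End SegmentIntegrals.

(* Cubic and quadratic B-splines: [spline] is a C^1 bump of mass 16 h^3
   supported in [-3h, 3h], with primitive [splineI]; [tent] is a tent of mass h^2
   supported in [-h, h], with C^1 primitive [tentI]. *)
Section Splines.
Context {R : realType}.
Implicit Types h x y t : R.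

Definition posp x : R := Num.max 0 x.

Definition cub x : R := x * sqp x / 3.

Lemma sqpE x : sqp x = posp x ^+ 2. Proof. by []. Qed.

Lemma cubE x : cub x = posp x ^+ 3 / 3.
Proof.
rewrite /cub sqpE /posp; have [x0|x0] := leP 0 x; last by rewrite !expr0n/= mulr0.
by rewrite exprS.
Qed.

Lemma is_derive_cub x : is_derive x 1 cub (sqp x).
Proof.
have d1 := isD_mul (is_derive_id x 1) (is_derive_sqp x).
apply: (is_derive_eq (isD_mul d1 (is_derive_cst (3^-1 : R) x 1))).
rewrite mulr0 add0r /cst sqpE /posp; have [x0|x0] := leP 0 x; first by field.
by rewrite expr0n /= !(mulr0, mul0r, addr0).
Qed.

Lemma is_derive_shift (f : R -> R) (df c x : R) : is_derive (x + c) 1 f df ->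
  is_derive x 1 (fun y => f (y + c)) df.
Proof.
move=> h; have d1 := isD_add (is_derive_id x 1) (is_derive_cst c x 1).
by apply: (is_derive_eq (isD_comp d1 h)); rewrite addr0 mulr1.
Qed.

(** The third central difference with step 2h. It annihilates quadratic polynomials and sends x^3 /
    3 to 6 (2h)^3 / 3 = 16 h^3, whence the compact support of the spline and its mass. *)
Definition comb3 (f : R -> R) h y : R :=
  f (y + 3 * h) - 3 * f (y + h) + 3 * f (y + (- h)) - f (y + (- (3 * h))).

Lemma is_derive_scale (f : R -> R) (c df x : R) : is_derive x 1 f df ->
  is_derive x 1 (fun y => c * f y) (c * df).
Proof.
move=> h; apply: (is_derive_eq (isD_mul (is_derive_cst c x 1) h)).
by rewrite mulr0 addr0.
Qed.

Lemma is_derive_sub (f g : R -> R) (a b x : R) : is_derive x 1 f a -> is_derive x 1 g b ->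
  is_derive x 1 (fun y => f y - g y) (a - b).
Proof. by move=> df dg; exact: (is_deriveB (f := f) (g := g)). Qed.

Lemma is_derive_comb3 (f df : R -> R) h y : (forall x, is_derive x 1 f (df x)) ->
  is_derive y 1 (comb3 f h) (comb3 df h y).
Proof.
move=> H; have s c : is_derive y 1 (fun y => f (y + c)) (df (y + c)) by exact: is_derive_shift.
have sc c := is_derive_scale 3 (s c).
exact: (is_derive_sub (isD_add (is_derive_sub (s _) (sc _)) (sc _)) (s _)).
Qed.

Definition spline h y : R := comb3 sqp h y.
Definition splineI h y : R := comb3 cub h y.
Definition dspline h y : R := comb3 (fun x => 2 * posp x) h y.

Lemma is_derive_splineI h y : is_derive y 1 (splineI h) (spline h y).
Proof. by apply: is_derive_comb3 => x; exact: is_derive_cub. Qed.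

Lemma is_derive_spline h y : is_derive y 1 (spline h) (dspline h y).
Proof. by apply: is_derive_comb3 => x; exact: is_derive_sqp. Qed.

Lemma continuous_comb3 (f : R -> R) h y : continuous f -> {for y, continuous (comb3 f h)}.
Proof.
move=> cf; have s c : {for y, continuous (fun z => f (z + c))}.
  apply: (continuous_comp (f := fun z => z + c) (g := f)); last exact: cf.
  by apply: cvgD; [exact: cvg_id|exact: cvg_cst].
have k (r : R) : {for y, continuous (fun=> r : R)} by exact: cst_continuous.
apply: (cvgB _ (s _)); apply: (cvgD _ (cvgM (k 3) (s _))).
exact: (cvgB (s _) (cvgM (k 3) (s _))).
Qed.

Lemma continuous_posp : continuous posp.
Proof. exact: continuous_maxr0. Qed.

Lemma continuous_dspline h y : {for y, continuous (dspline h)}.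
Proof.
apply: continuous_comb3 => x; apply: cvgM; first exact: cvg_cst.
exact: continuous_posp.
Qed.

Lemma continuous_spline h y : {for y, continuous (spline h)}.
Proof. exact: is_derive_continuous (is_derive_spline h y). Qed.

Lemma C1_on_spline h : C1_on setT (spline h).
Proof.
apply: (@C1_on_is_derive _ _ (spline h) (dspline h)); first exact: openT.
by move=> t _; split; [exact: is_derive_spline|exact: continuous_dspline].
Qed.

Lemma pospr x : 0 <= x -> posp x = x. Proof. by move=> h; rewrite /posp max_r. Qed.
Lemma posp0 x : x <= 0 -> posp x = 0. Proof. by move=> h; rewrite /posp max_l. Qed.

Lemma spline_right h y : 0 < h -> 3 * h <= y ->
  [/\ spline h y = 0, dspline h y = 0 & splineI h y = 16 * h ^+ 3].
Proof.
move=> h0 hy; rewrite /spline /dspline /splineI /comb3 !cubE !sqpE.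
by rewrite !pospr; try lra; split; field.
Qed.

Lemma spline_left h y : 0 < h -> y <= - (3 * h) ->
  [/\ spline h y = 0, dspline h y = 0 & splineI h y = 0].
Proof.
move=> h0 hy; rewrite /spline /dspline /splineI /comb3 !cubE !sqpE.
by rewrite !posp0; try lra; split; field.
Qed.

Lemma posp_ge0 x : 0 <= posp x. Proof. by rewrite /posp le_max lexx. Qed.

(** On the support the last of the four terms vanishes. The constants add up the other three: 36 + 3
    * 16 + 3 * 4 = 96, and 2 (6 + 3 * 4 + 3 * 2) = 48. *)
Lemma spline_bounds h y : 0 < h -> `|y| <= 3 * h ->
  `|spline h y| <= 96 * h ^+ 2 /\ `|dspline h y| <= 48 * h.
Proof.
move=> h0; rewrite ler_norml => /andP[y1 y2].
have P1 : 0 <= posp (y + 3 * h) <= 6 * h by rewrite posp_ge0 pospr; lra.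
have P2 : 0 <= posp (y + h) <= 4 * h by rewrite posp_ge0 /posp ge_max; lra.
have P3 : 0 <= posp (y + - h) <= 2 * h by rewrite posp_ge0 /posp ge_max; lra.
have P4 : posp (y + - (3 * h)) = 0 by rewrite posp0//; lra.
rewrite /spline /dspline /comb3 !sqpE P4.
move: (posp _) (posp _) (posp _) P1 P2 P3 => p q r /andP[p0 p1] /andP[q0 q1] /andP[r0 r1].
have S (x c : R) : 0 <= x -> x <= c * h -> 0 <= x ^+ 2 <= c ^+ 2 * h ^+ 2.
  by move=> x0 xc; rewrite sqr_ge0 -exprMn lerXn2r ?nnegrE// (le_trans x0).
have := S _ _ p0 p1; have := S _ _ q0 q1; have := S _ _ r0 r1.
move: (p ^+ 2) (q ^+ 2) (r ^+ 2) (h ^+ 2) => P Q T H /andP[t0 t1] /andP[q20 q21] /andP[p20 p21].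
by rewrite expr2 mulr0; split; rewrite ler_norml; lra.
Qed.

Definition tent h y : R := posp (y + h) - 2 * posp y + posp (y + (- h)).
Definition tentI h y : R := (sqp (y + h) - 2 * sqp y + sqp (y + (- h))) / 2.

Lemma is_derive_tentI h y : is_derive y 1 (tentI h) (tent h y).
Proof.
have s c : is_derive y 1 (fun y => sqp (y + c)) (2 * posp (y + c)).
  exact: is_derive_shift (is_derive_sqp _).
have := is_derive_scale 2^-1 (isD_add (is_derive_sub (s h) (is_derive_scale 2 (is_derive_sqp y))) (s (- h))).
rewrite (_ : tentI h = fun y => 2^-1 * (sqp (y + h) - 2 * sqp y + sqp (y + (- h)))); last first.
  by apply/funext => z; rewrite /tentI mulrC.
by move=> H; apply: (is_derive_eq H); rewrite /tent -/(posp y); field.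
Qed.

Lemma continuous_tent h y : {for y, continuous (tent h)}.
Proof.
have s c : {for y, continuous (fun z => posp (z + c))}.
  apply: (continuous_comp (f := fun z => z + c) (g := posp)); last exact: continuous_posp.
  by apply: cvgD; [exact: cvg_id|exact: cvg_cst].
have k (r : R) : {for y, continuous (fun=> r : R)} by exact: cst_continuous.
exact: (cvgD (cvgB (s h) (cvgM (k 2) (@continuous_posp y))) (s (- h))).
Qed.

Lemma tent_right h y : 0 < h -> h <= y -> tent h y = 0 /\ tentI h y = h ^+ 2.
Proof.
by move=> h0 hy; rewrite /tent /tentI !sqpE !pospr; try lra; split; field.
Qed.

Lemma tent_left h y : 0 < h -> y <= - h -> tent h y = 0 /\ tentI h y = 0.
Proof.
by move=> h0 hy; rewrite /tent /tentI !sqpE !posp0; try lra; split; field.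
Qed.

Lemma tent_bound h y : 0 < h -> `|y| <= h -> `|tent h y| <= 4 * h.
Proof.
move=> h0; rewrite ler_norml => /andP[y1 y2]; rewrite /tent.
have P1 : 0 <= posp (y + h) <= 2 * h by rewrite posp_ge0 pospr; lra.
have P2 : 0 <= posp y <= h by rewrite posp_ge0 /posp ge_max; lra.
have P4 : posp (y + - h) = 0 by rewrite posp0//; lra.
by rewrite P4 ler_norml; lra.
Qed.

End Splines.

(* [u] solves a transport equation weakly: [f] is constant along the
   characteristics [tb' = 2 u(xi, tb)].  Test functions are
   [a(xi) spline_h(tau - tb(xi))]; since [tb' = 2u] along the curve, replacing
   [f(xi, tau)] by [f(xi, tb(xi))] leaves an exact [tau]-derivative. *)
Section Transport.
Context {R : realType}.
Notation mu := (@lebesgue_measure R).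
Notation mu2 := (mu \x mu)%E.
Variables (D : set (plane R)) (u f : plane R -> R) (p q c d : R) (tb : R -> R).
Hypotheses (oD : open D) (cu : C1_on D u) (cf : forall x, D x -> {for x, continuous f}).
Hypothesis rD : rect p q c d `<=` D.
Hypothesis dtb : forall x, p <= x <= q -> is_derive x 1 tb (2 * u (x, tb x)).
Hypothesis tbcd : forall x, p <= x <= q -> c < tb x < d.
Hypothesis weak : forall w, C1_on setT w -> (forall x, ~ rect p q c d x -> w x = 0) ->
  (\int[mu2]_(x in rect p q c d)
     (f x * (dx w x + 2 * u x * dy w x + 2 * w x * dy u x)))%R = 0.

Let rectI x y : p <= x <= q -> c <= y <= d -> D (x, y).
Proof. by move=> hx hy; apply: rD; apply/rectP. Qed.

Let Dtb x : p <= x <= q -> D (x, tb x).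
Proof. by move=> hx; apply: rectI => //; have /andP[h1 h2] := tbcd hx; rewrite !ltW. Qed.

Let ctb x : p <= x <= q -> {for x, continuous tb}.
Proof. by move=> /dtb; exact: is_derive_continuous. Qed.

Let ccurve (h : plane R -> R) x : p <= x <= q -> {for (x, tb x), continuous h} ->
  {for x, continuous (fun z => h (z, tb z))}.
Proof.
move=> hx ch; apply: (continuous_comp (f := fun z : R => (z, tb z)) (g := h)) => //.
by apply: (@continuous_pair R R R id tb x); [exact: cvg_id|exact: ctb].
Qed.

(** Compactness of [p, q]: near each abscissa a suitable [h] exists by continuity of [f] and [tb],
    and finitely many neighbourhoods suffice. *)
Let uniform e : 0 < e -> exists2 h, 0 < h & forall x, p <= x <= q ->
  [/\ c <= tb x - 3 * h, tb x + 3 * h <= d &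
      forall y, `|y - tb x| <= 3 * h -> `|f (x, y) - f (x, tb x)| <= e].
Proof.
move=> e0; pose P h x := [/\ c <= tb x - 3 * h, tb x + 3 * h <= d &
      forall y, `|y - tb x| <= 3 * h -> `|f (x, y) - f (x, tb x)| <= e].
have /compact_near_coveringP K := @segment_compact _ p q.
have H : \forall h \near 0^'+, `[p, q]%classic `<=` P h.
  apply: K => x0; rewrite /= in_itv/= => hx0.
  have cf0 := cf (Dtb hx0); have e2 : 0 < e / 2 by rewrite divr_gt0.
  have /nbhs_box[r r0 hr] : \forall z \near (x0, tb x0), `|f z - f (x0, tb x0)| < e / 2.
    by have /cvgr_distC_lt := cf0; apply.
  have /andP[b1 b2] := tbcd hx0.
  pose m := Num.min (r / 2) (Num.min ((tb x0 - c) / 2) ((d - tb x0) / 2)).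
  have m0 : 0 < m by rewrite /m !lt_min; apply/and3P; split; lra.
  have [m1 m2 m3] : [/\ m <= r / 2, m <= (tb x0 - c) / 2 & m <= (d - tb x0) / 2].
    by rewrite /m !ge_min !lexx !orbT.
  have n1 : \forall x \near x0, `|tb x - tb x0| < m.
    by have /cvgr_distC_lt := ctb hx0; apply.
  have n2 : \forall x \near x0, `|x - x0| < r.
    by have /cvgr_distC_lt := @cvg_id _ (nbhs x0); apply.
  have n3 : \forall h \near 0^'+, h < m / 3 by apply: nbhs_right_lt; rewrite divr_gt0.
  exists ([set x | `|tb x - tb x0| < m /\ `|x - x0| < r], [set h | h < m / 3]).
    by split => //=; exact: filterI.
  case=> x h /= [[k1 k2] k3]; move: (k1); rewrite ltr_norml => /andP[k4 k5].
  split; [lra|lra|] => y yt.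
  have g1 : `|f (x, y) - f (x0, tb x0)| < e / 2.
    apply: hr; split => //=.
    have -> : y - tb x0 = (y - tb x) + (tb x - tb x0) by ring.
    by apply: (le_lt_trans (ler_normD _ _)); lra.
  have g2 : `|f (x, tb x) - f (x0, tb x0)| < e / 2.
    by apply: hr; split => //=; lra.
  have -> : f (x, y) - f (x, tb x) = (f (x, y) - f (x0, tb x0)) - (f (x, tb x) - f (x0, tb x0)) by ring.
  by apply: (le_trans (ler_normB _ _)); lra.
have n4 : \forall h \near 0^'+, 0 < h :> R by exact: nbhs_right_gt.
have [h [h0 hP]] := @filter_ex _ _ (at_right_proper_filter 0) _ (filterI n4 H).
by exists h => // x hx; apply: hP; rewrite /= in_itv.
Qed.

Section Test.
Variables (a da : R -> R) (p1 q1 Ca : R).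
Hypotheses (pp1 : p < p1) (q1q : q1 < q).
Hypothesis dera : forall x : R, is_derive x 1 a (da x).
Hypothesis cda : forall x, {for x, continuous da}.
Hypothesis a0 : forall x, ~ (p1 <= x <= q1) -> a x = 0 /\ da x = 0.
Hypothesis aC : forall x, `|a x| <= Ca /\ `|da x| <= Ca.

Variable h : R.
Hypothesis h0 : 0 < h.
Hypothesis hcd : forall x, p <= x <= q -> c <= tb x - 3 * h /\ tb x + 3 * h <= d.

Let W x := a x.1 * spline h (x.2 - tb x.1).
(** The curve [tb] is controlled on [p, q] only, so the product is cut off there; as [a] vanishes
    outside [p1, q1], which lies strictly inside, the result is C^1 on the plane. *)
Let w x := if p < x.1 < q then W x else 0.
Let A : set (plane R) := [set x | p < x.1 < q].
Let B : set (plane R) := [set x | ~ (p1 <= x.1 <= q1)].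

Let oA : open A.
Proof.
rewrite -[A]setTI (_ : A = fst @^-1` `]p, q[%classic).
  by apply: continuous_open_preimage; [exact: openT|exact: interval_open|move=> x _; exact: fst_continuous].
by apply/seteqP; split => x /=; rewrite /A /= in_itv.
Qed.

Let oB : open B.
Proof.
rewrite -[B]setTI (_ : B = fst @^-1` (~` `[p1, q1]%classic)).
  apply: continuous_open_preimage; [exact: openT| |move=> x _; exact: fst_continuous].
  by apply: closed_openC; exact: interval_closed.
by apply/seteqP; split => x /=; rewrite /B /= in_itv.
Qed.

Let wB x : B x -> w x = 0.
Proof. by move=> /a0[ax _]; rewrite /w /W ax mul0r; case: ifP. Qed.

Let wA x : A x -> w x = W x.
Proof. by rewrite /A /= /w => ->. Qed.

Let AB x : p <= x.1 <= q -> A x \/ B x.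
Proof.
move=> hx; have [h1|h1] := boolP (p < x.1 < q); first by left.
by right => h2; move/negP: h1; apply; have := pp1; have := q1q; lra.
Qed.

Let cWA : C1_on A W.
Proof.
pose I := `]p, q[%classic : set R.
have oI : open I by exact: interval_open.
have cI : C1_on I tb.
  apply: (C1_on_is_derive (dg := fun x => 2 * u (x, tb x)) oI) => t.
  rewrite /I /= in_itv/= => /andP[t1 t2].
  have ht : p <= t <= q by rewrite !ltW.
  split; first exact: dtb.
  apply: cvgM; first exact: cst_continuous.
  by apply: ccurve => //; exact: (C1_on_continuous cu (Dtb ht)).
have ca : C1_on setT a by apply: (C1_on_is_derive openT) => t _; split; [exact: dera|exact: cda].
have c1 := @C1_on_fst _ _ _ A; have c2 := @C1_on_snd _ _ _ A.
have AI x : A x -> I x.1 by rewrite /A /I /= in_itv.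
have c3 := C1_on_comp_real oA AI cI c1.
have c4 := C1_on_comp_real oA (fun _ _ => Logic.I) (C1_on_spline h) (C1_onB oA c2 c3).
exact: (C1_onM oA (C1_on_comp_real oA (fun _ _ => Logic.I) ca c1) c4).
Qed.

Let cw : C1_on setT w.
Proof.
have cA : C1_on A w by apply: (C1_on_eq oA) cWA => x /wA.
have cB : C1_on B w.
  by apply: (C1_on_eq (f := fun=> 0) oB); [move=> x /wB|exact: C1_on_cst].
rewrite (_ : setT = A `|` B); first exact: C1_onU.
apply/seteqP; split => // x _.
have [h1|h1] := boolP (p < x.1 < q); first by left.
by right => h2; move/negP: h1; apply; have := pp1; have := q1q; lra.
Qed.

Let w0 x : ~ rect p q c d x -> w x = 0.
Proof.
move=> nr; have [Bx|nB] := pselect (B x); first exact: wB.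
have hx : p1 <= x.1 <= q1 by apply: contrapT.
have [k1 k2] := (pp1, q1q); have k3 := h0; have hx' : p <= x.1 <= q by lra.
have [h1 h2] := hcd hx'; have ny : ~ (c <= x.2 <= d).
  by move=> hy; apply: nr; apply/rectP.
rewrite wA; last by rewrite /A /=; lra.
rewrite /W; have [yl|yl] := lerP (x.2) (tb x.1 - 3 * h).
  have [|-> _ _] := @spline_left _ h (x.2 - tb x.1) h0; first lra.
  by rewrite mulr0.
have [|-> _ _] := @spline_right _ h (x.2 - tb x.1) h0; last by rewrite mulr0.
by rewrite leNgt; apply/negP => yr; apply: ny; lra.
Qed.

(** The weak integrand without [f]. The difference of the two values of [u] comes from tb' = 2 u(x,
    tb x), the slope of the tube, subtracted from the transport speed 2 u(x, y). *)
Let k x y := da x * spline h (y - tb x) +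
  a x * (2 * (u (x, y) - u (x, tb x)) * dspline h (y - tb x) + 2 * dy u (x, y) * spline h (y - tb x)).

Let kE x : rect p q c d x ->
  dx w x + 2 * u x * dy w x + 2 * w x * dy u x = k x.1 x.2.
Proof.
move=> /rectP[hx hy]; have [Ax|Bx] := AB hx; last first.
  have E : \forall y \near x, w y = (fun=> 0) y by apply: filterS (open_near oB Bx) => y /wB.
  have [k1 k2] := a0 Bx.
  rewrite dxE dyE !(near_eq_derive _ E) !derive_cst (wB Bx) /k k1 k2.
  by rewrite !(mulr0, mul0r, addr0).
have E : \forall y \near x, w y = W y by apply: filterS (open_near oA Ax) => y /wA.
have dW := C1_on_diff cWA Ax.
rewrite dxE dyE !(near_eq_derive _ E) -dxE -dyE (wA Ax) /k.
case: x hx hy Ax E dW => x y /= hx hy Ax _ dW.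
have [_ <-] := is_derive_sectl dW; have [_ <-] := is_derive_sectr dW.
have d1 : is_derive x 1 (fun z => y - tb z) (0 - 2 * u (x, tb x)).
  exact: (is_derive_sub (is_derive_cst y x 1) (dtb hx)).
have d2 : is_derive y 1 (fun z => z - tb x) (1 - 0).
  exact: (is_derive_sub (is_derive_id y 1) (is_derive_cst (tb x) y 1)).
have [_ ->] := isD_mul (dera x) (isD_comp d1 (is_derive_spline h _)).
have [_ ->] := is_derive_scale (a x) (isD_comp d2 (is_derive_spline h _)).
rewrite /W /=; move: (spline _ _) (dspline _ _) (dy _ _) (u _) (u _) => s ds v u1 u2.
by ring.
Qed.

Let g x := f (x, tb x).
Variables (L e : R).
Hypothesis uL : forall x, rect p q c d x -> `|dy u x| <= L.
Hypothesis fe : forall x, p <= x <= q -> forall y, `|y - tb x| <= 3 * h -> `|f (x, y) - g x| <= e.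

Let J x := (\int[mu]_(y in `[c, d]) (f (x, y) * k x y))%R.

Let L0 x : p <= x <= q -> 0 <= L.
Proof.
move=> hx; have /andP[h1 h2] := tbcd hx.
by apply: (le_trans (normr_ge0 _)) (uL (x := (x, tb x)) _); apply/rectP; rewrite /= hx !ltW.
Qed.

Let Ca0 : 0 <= Ca. Proof. by have [h1 _] := aC p; exact: le_trans h1. Qed.

(** On a vertical slice [k] is an exact derivative whose integral is 16 h^3 [da], so freezing [f] at
    its value on the curve leaves an error of order h^3 [e], small relative to the main term. *)
Let inner x : p <= x <= q ->
  `|J x - 16 * h ^+ 3 * (g x * da x)| <= 16 * h ^+ 3 * (e * Ca * (36 + 180 * L)).
Proof.
move=> hx; have [h1 h2] := hcd hx; have k3 := h0; set t := tb x in h1 h2 *.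
have cdD y : t - 3 * h <= y <= t + 3 * h -> D (x, y).
  by move=> hy; apply: rectI => //; lra.
have cdr y : t - 3 * h <= y <= t + 3 * h -> rect p q c d (x, y).
  by move=> hy; apply/rectP; split => //=; lra.
have -> : J x = (\int[mu]_(y in `[t - 3 * h, t + 3 * h]) (f (x, y) * k x y))%R.
  apply: seg_integral_window => // y hy ny.
  have [S0 S1] : spline h (y - t) = 0 /\ dspline h (y - t) = 0.
    have [yl|yl] := lerP y (t - 3 * h).
      by have [|-> -> _] := @spline_left _ h (y - t) h0; first lra.
    have [|-> -> _ //] := @spline_right _ h (y - t) h0.
    by rewrite leNgt; apply/negP => yr; apply: ny; lra.
  by rewrite /k -/t S0 S1 !(mulr0, mul0r, addr0).
have csh (s : R -> R) y : (forall z, {for z, continuous s}) -> {for y, continuous (fun z => s (z - t))}.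
  move=> cs; apply: (continuous_comp (f := fun z => z - t) (g := s)); last exact: cs.
  by apply: cvgB; [exact: cvg_id|exact: cvg_cst].
have cst (r y : R) : {for y, continuous (fun=> r : R)} by exact: cst_continuous.
have ck y : t - 3 * h <= y <= t + 3 * h -> {for y, continuous (k x)}.
  move=> /cdD Dy.
  have cS := @csh (spline h) y (@continuous_spline _ h).
  have cdS := @csh (dspline h) y (@continuous_dspline _ h).
  have c1 := continuous_sectr (C1_on_continuous cu Dy).
  have c2 := continuous_sectr (C1_on_dy cu Dy).
  apply: (cvgD (cvgM (cst _ y) cS)); apply: (cvgM (cst _ y)).
  apply: cvgD; last exact: (cvgM (cvgM (cst _ y) c2) cS).
  exact: (cvgM (cvgM (cst _ y) (cvgB c1 (cst _ y))) cdS).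
have cfy y : t - 3 * h <= y <= t + 3 * h -> {for y, continuous (fun y => f (x, y))}.
  by move=> /cdD Dy; exact: (continuous_sectr (cf Dy)).
have duy y : t - 3 * h <= y <= t + 3 * h -> is_derive y 1 (fun y => u (x, y)) (dy u (x, y)).
  by move=> /cdD Dy; exact: is_derive_sectr (C1_on_diff cu Dy).
have h3 : 0 <= 3 * h by lra.
have itvE y : (t - 3 * h <= y <= t + 3 * h) = (`|y - t| <= 3 * h).
  by rewrite ler_norml; apply/idP/idP; lra.
(* The factor [dspline] is only of order h, one power short of [spline]; the Lipschitz bound on [u]
   supplies the missing power. *)
have u_lip y : t - 3 * h <= y <= t + 3 * h -> `|u (x, y) - u (x, t)| <= L * (3 * h).
  rewrite itvE => hy.
  have H := @mean_value_abs _ (fun y => u (x, y)) (fun y => dy u (x, y)) t y L t (3 * h).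
  have e1 z : `|z - t| <= 3 * h -> is_derive z 1 (fun y => u (x, y)) (dy u (x, z)) by rewrite -itvE; exact: duy.
  have e2 z : `|z - t| <= 3 * h -> `|dy u (x, z)| <= L by rewrite -itvE => /cdr; exact: uL.
  have e3 : `|t - t| <= 3 * h by rewrite subrr normr0.
  exact: (le_trans (H e1 e2 e3 hy) (ler_wpM2l (L0 hx) hy)).
(* The constant 480 is 2 * 3 * 48 + 2 * 96, from the two terms with [u]. Multiplying by the window
   length 6h gives 16 h^3 (36 + 180 L). *)
pose K := Ca * ((96 + 480 * L) * h ^+ 2).
have Lx := L0 hx.
have K0 : 0 <= K.
  exact: (mulr_ge0 Ca0 (mulr_ge0 (addr_ge0 (ler0n R 96) (mulr_ge0 (ler0n R 480) Lx)) (sqr_ge0 h))).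
have kK y : t - 3 * h <= y <= t + 3 * h -> `|k x y| <= K.
  move=> hy; have ul := u_lip _ hy; have dl := uL (cdr _ hy).
  have [s1 s2] : `|spline h (y - t)| <= 96 * h ^+ 2 /\ `|dspline h (y - t)| <= 48 * h.
    by apply: spline_bounds => //; rewrite -itvE.
  have [a1 a2] := aC x; rewrite /k -/t.
  move: (spline _ _) (dspline _ _) (dy _ _) (u (x, y) - u _) s1 s2 dl ul => s ds v du s1 s2 dl ul.
  have -> : K = Ca * (96 * h ^+ 2) + Ca * (2 * (L * (3 * h)) * (48 * h) + 2 * L * (96 * h ^+ 2)).
    by rewrite /K; ring.
  apply: (le_trans (ler_normD _ _)); apply: lerD; first by rewrite normrM ler_pM.
  rewrite normrM ler_pM//; apply: (le_trans (ler_normD _ _)); apply: lerD.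
    by rewrite !normrM (ger0_norm (ler0n _ 2)) ler_pM// ?mulr_ge0// ler_pM2l.
  by rewrite !normrM (ger0_norm (ler0n _ 2)) ler_pM// ?mulr_ge0// ler_pM2l.
have tt : t - 3 * h <= t + 3 * h by lra.
have fe' y : t - 3 * h <= y <= t + 3 * h -> `|f (x, y) - g x| <= e.
  by rewrite itvE; exact: fe.
have := seg_integral_freeze tt K0 cfy ck fe' kK.
have -> : (\int[mu]_(y in `[t - 3 * h, t + 3 * h]) k x y)%R = 16 * h ^+ 3 * da x.
  (* At both ends of the window the spline vanishes, so only the increment 16 h^3 of [splineI]
     survives. *)
  pose H y := da x * splineI h (y - t) + a x * (2 * (u (x, y) - u (x, t)) * spline h (y - t)).
  have dH y : t - 3 * h <= y <= t + 3 * h -> is_derive y 1 H (k x y).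
    move=> /duy du; have ds (s : R -> R) (s' : R) : is_derive (y - t) 1 s s' -> is_derive y 1 (fun z => s (z - t)) s'.
      exact: is_derive_shift.
    have dI := is_derive_scale (da x) (ds _ _ (is_derive_splineI h (y - t))).
    have d1 := is_derive_scale 2 (is_derive_sub du (is_derive_cst (u (x, t)) y 1)).
    have d2 := is_derive_scale (a x) (isD_mul d1 (ds _ _ (is_derive_spline h (y - t)))).
    apply: (is_derive_eq (isD_add dI d2)); rewrite /k /functions.cst -/t.
    by move: (spline _ _) (dspline _ _) (dy _ _) (u _) (u _) => *; ring.
  have t3 : t - 3 * h < t + 3 * h by lra.
  rewrite (seg_FTC2 t3 dH ck) /H.
  have [|r1 _ r2] := @spline_right _ h (t + 3 * h - t) h0; first lra.
  have [|l1 _ l2] := @spline_left _ h (t - 3 * h - t) h0; first lra.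
  by rewrite r1 r2 l1 l2; ring.
have -> : g x * (16 * h ^+ 3 * da x) = 16 * h ^+ 3 * (g x * da x) by ring.
move=> H; apply: (le_trans H); rewrite le_eqVlt; apply/orP; left; apply/eqP.
by rewrite /K; ring.
Qed.

(** By Fubini the slice integrals sum to 0, by the weak equation; dividing the estimate for each
    slice by 16 h^3 gives a bound in which [h] no longer appears. *)
Lemma test_bound : p <= q ->
  `|(\int[mu]_(x in `[p, q]) (g x * da x))%R| <= e * Ca * (36 + 180 * L) * (q - p).
Proof.
move=> pq; pose phi x := f x * (dx w x + 2 * u x * dy w x + 2 * w x * dy u x).
have cphi x : D x -> {for x, continuous phi}.
  move=> Dx; have cst (r : R) : {for x, continuous (fun=> r : R)} by exact: cst_continuous.
  have c1 := C1_on_dx cw (I : setT x); have c2 := C1_on_dy cw (I : setT x).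
  have c3 := C1_on_continuous cw (I : setT x); have c4 := C1_on_continuous cu Dx.
  have c5 := C1_on_dy cu Dx; have c6 := cf Dx.
  exact: (cvgM c6 (cvgD (cvgD c1 (cvgM (cvgM (cst 2) c4) c2)) (cvgM (cvgM (cst 2) c3) c5))).
have [iJ EJ] := fubini_rect oD rD cphi.
rewrite (weak cw w0) in EJ.
have JE x : p <= x <= q -> (\int[mu]_(y in `[c, d]) phi (x, y))%R = J x.
  move=> hx; apply: eq_Rintegral => y /set_mem/=; rewrite in_itv/= => hy.
  by rewrite /phi kE//; apply/rectP.
have cg x : p <= x <= q -> {for x, continuous (fun x => 16 * h ^+ 3 * (g x * da x))}.
  move=> hx; apply: cvgM; first exact: cst_continuous.
  by apply: cvgM; [apply: ccurve => //; exact: cf (Dtb hx)|exact: cda].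
have cg1 x : p <= x <= q -> {for x, continuous (fun x => g x * da x)}.
  by move=> hx; apply: cvgM; [apply: ccurve => //; exact: cf (Dtb hx)|exact: cda].
have ig := seg_integrable cg; have ig1 := seg_integrable cg1.
have m : measurable `[p, q]%classic by exact: measurable_itv.
have h3 : 0 < 16 * h ^+ 3 by rewrite mulr_gt0// exprn_gt0.
rewrite -(ler_pM2l h3) -{1}(gtr0_norm h3) -normrM -(@RintegralZl _ _ _ mu _ _ _ m ig1).
rewrite -normrN -sub0r EJ -(@RintegralB _ _ _ mu _ _ _ m iJ ig).
have -> : 16 * h ^+ 3 * (e * Ca * (36 + 180 * L) * (q - p)) =
    16 * h ^+ 3 * (e * Ca * (36 + 180 * L)) * (q - p) by ring.
apply: seg_integral_le => //.
  exact: (@integrableB _ _ _ mu _ m _ _ iJ ig).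
by move=> x hx; rewrite JE// inner.
Qed.

End Test.

(** The tube radius depends on [e], but the bound on the integral is [e] times a fixed constant, so
    letting [e] tend to 0 gives zero. *)
Lemma weak_along_curve (a da : R -> R) (p1 q1 Ca : R) :
  p < p1 -> q1 < q -> p1 <= q1 ->
  (forall x : R, is_derive x 1 a (da x)) -> (forall x, {for x, continuous da}) ->
  (forall x, ~ (p1 <= x <= q1) -> a x = 0 /\ da x = 0) ->
  (forall x, `|a x| <= Ca /\ `|da x| <= Ca) ->
  (\int[mu]_(x in `[p, q]) (f (x, tb x) * da x))%R = 0.
Proof.
move=> pp1 q1q p1q1 dera cda a0 aC; have pq : p <= q by lra.
have [L hL] : exists L, forall x, rect p q c d x -> `|dy u x| <= L.
  by apply: rect_bounded => x /rD; exact: C1_on_dy.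
have Lp : 0 <= L.
  have hp : p <= p <= q by rewrite lexx.
  have /andP[h1 h2] := tbcd hp.
  by apply: (le_trans (normr_ge0 _)) (hL (p, tb p) _); apply/rectP; rewrite /= hp !ltW.
have Cp : 0 <= Ca by have [h1 _] := aC p; exact: le_trans h1.
set X := Rintegral _ _ _; pose N := Ca * (36 + 180 * L) * (q - p).
have N0 : 0 <= N.
  have qp : 0 <= q - p by rewrite subr_ge0.
  exact: (mulr_ge0 (mulr_ge0 Cp (addr_ge0 (ler0n R 36) (mulr_ge0 (ler0n R 180) Lp))) qp).
have H e : 0 < e -> `|X| <= e * N.
  move=> /uniform[h h0 hh].
  have -> : e * N = e * Ca * (36 + 180 * L) * (q - p) by rewrite /N; ring.
  have H1 x : p <= x <= q -> c <= tb x - 3 * h /\ tb x + 3 * h <= d by move=> /hh[].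
  have H2 x : p <= x <= q -> forall y, `|y - tb x| <= 3 * h -> `|f (x, y) - f (x, tb x)| <= e.
    by move=> /hh[].
  exact: (test_bound pp1 q1q dera cda a0 aC h0 H1 hL H2 pq).
apply/eqP; rewrite -normr_le0 leNgt; apply/negP => X0.
have N1 : 0 < N + 1 by lra.
have e0 : 0 < `|X| / (N + 1) / 2 by rewrite !divr_gt0.
have := H _ e0; rewrite leNgt => /negP; apply.
have z0 : 0 < `|X| / (N + 1) by rewrite divr_gt0.
have XE : `|X| = `|X| / (N + 1) * (N + 1) by rewrite divfK// gt_eqF.
rewrite [X in _ < X]XE; move: (`|X| / (N + 1)) z0 => z z0.
have zN : 0 <= z * N by rewrite mulr_ge0// ltW.
lra.
Qed.

(** The du Bois-Reymond argument: the test function rises by s^2 around [x1] and falls back around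
    [x2], so its derivative is a difference of two tents. The weighted means of [f] along the curve
    near the two points therefore agree. *)
Lemma constant_along_curve x1 x2 : p < x1 < q -> p < x2 < q ->
  f (x1, tb x1) = f (x2, tb x2).
Proof.
wlog lt12 : x1 x2 / x1 < x2 => [H h1 h2|/andP[a1 b1] /andP[a2 b2]].
  by have [/H->//|/H->//|-> //] := ltgtP x1 x2.
pose g x := f (x, tb x); rewrite -/(g x1) -/(g x2).
have cg x : p <= x <= q -> {for x, continuous g}.
  by move=> hx; apply: ccurve => //; exact: cf (Dtb hx).
suff H e : 0 < e -> `|g x1 - g x2| <= 16 * e.
  apply/eqP; rewrite -subr_eq0 -normr_le0 leNgt; apply/negP => X0.
  have := H (`|g x1 - g x2| / 32) ltac:(by rewrite divr_gt0); lra.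
move=> e0.
have near_g z : p < z < q -> exists2 r, 0 < r & forall y, `|y - z| <= r -> `|g y - g z| <= e.
  move=> /andP[z1 z2]; have /cvgr_distC_le/(_ _ e0)/nbhs_ballP[r r0 hr] : {for z, continuous g} by apply: cg; rewrite !ltW.
  exists (r / 2); first by rewrite divr_gt0.
  move=> y hy; apply: hr; rewrite /ball/= distrC; apply: (le_lt_trans hy).
  by move: r0; rewrite /=; lra.
have [r1 r10 hr1] := near_g x1 ltac:(by rewrite a1).
have [r2 r20 hr2] := near_g x2 ltac:(by rewrite a2).
(* Both tents must fit in ]p, q[ and in the neighbourhoods where [g] varies by at most [e]. *)
pose s := Num.min (Num.min r1 r2) (Num.min ((x1 - p) / 2) ((q - x2) / 2)).
have s0 : 0 < s by rewrite /s !lt_min r10 r20 /=; apply/andP; split; lra.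
have [s1 s2 s3 s4] : [/\ s <= r1, s <= r2, s <= (x1 - p) / 2 & s <= (q - x2) / 2].
  by rewrite /s !ge_min !lexx !orbT.
pose a x := tentI s (x - x1) - tentI s (x - x2).
pose da x := tent s (x - x1) - tent s (x - x2).
have ct z x : {for x, continuous (fun x => tent s (x - z))}.
  apply: (continuous_comp (f := fun y => y - z) (g := tent s)); last exact: continuous_tent.
  by apply: cvgB; [exact: cvg_id|exact: cvg_cst].
have dera (x : R) : is_derive x 1 a (da x).
  exact: (is_derive_sub (is_derive_shift (is_derive_tentI s (x - x1))) (is_derive_shift (is_derive_tentI s (x - x2)))).
have cda x : {for x, continuous da} by exact: (cvgB (ct x1 x) (ct x2 x)).
have a0 x : ~ (x1 - s <= x <= x2 + s) -> a x = 0 /\ da x = 0.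
  move=> hx; rewrite /a /da; have [xl|xr] := lerP x (x1 - s).
    have [|t1 t2] := @tent_left _ s (x - x1) s0; first lra.
    have [|t3 t4] := @tent_left _ s (x - x2) s0; first lra.
    by rewrite t1 t2 t3 t4 subrr.
  have xr' : x2 + s <= x by rewrite leNgt; apply/negP => h; apply: hx; lra.
  have [|t1 t2] := @tent_right _ s (x - x1) s0; first lra.
  have [|t3 t4] := @tent_right _ s (x - x2) s0; first lra.
  by rewrite t1 t2 t3 t4 !subrr.
have [Ca aC] : exists Ca, forall x, `|a x| <= Ca /\ `|da x| <= Ca.
  have bd (k : R -> R) : (forall x, {for x, continuous k}) -> (forall x, ~ (x1 - s <= x <= x2 + s) -> k x = 0) ->
      exists C, forall x, `|k x| <= C.
    move=> ck k0; have cA : compact (k @` `[x1 - s, x2 + s]).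
      by apply: continuous_compact; [apply: continuous_at_seg => x _; exact: ck|exact: segment_compact].
    have [M [_ hM]] := compact_bounded cA; exists (`|M| + 1) => x.
    have [hx|hx] := pselect (x1 - s <= x <= x2 + s); last by rewrite k0// normr0 addr_ge0.
    by apply: hM; [rewrite (le_lt_trans (ler_norm _))// ltrDl|exists x; rewrite //= in_itv].
  have [C1 h1] : exists C, forall x, `|a x| <= C.
    by apply: bd => x; [exact: is_derive_continuous (dera x)|case/a0].
  have [C2 h2] : exists C, forall x, `|da x| <= C.
    by apply: bd => x; [exact: cda|case/a0].
  by exists (Num.max C1 C2) => x; rewrite !le_max h1 h2 orbT.
have := @weak_along_curve a da (x1 - s) (x2 + s) Ca ltac:(lra) ltac:(lra) ltac:(lra) dera cda a0 aC.
have ci z x : p <= x <= q -> {for x, continuous (fun x => g x * tent s (x - z))}.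
  by move=> hx; exact: (cvgM (cg x hx) (ct z x)).
have m : measurable `[p, q]%classic by exact: measurable_itv.
have -> : (\int[mu]_(x in `[p, q]) (f (x, tb x) * da x))%R =
    (\int[mu]_(x in `[p, q]) (g x * tent s (x - x1)))%R - (\int[mu]_(x in `[p, q]) (g x * tent s (x - x2)))%R.
  rewrite -(@RintegralB _ _ _ mu _ _ _ m (seg_integrable (ci x1)) (seg_integrable (ci x2))).
  by apply: eq_Rintegral => x _; rewrite /da mulrBr.
(* The error is [e] times the bound 4s of the tent times the window length 2s; twice this, divided
   by the mass s^2, is the 16 [e] announced above. *)
have main z : p <= z - s -> z + s <= q -> (forall y, `|y - z| <= s -> `|g y - g z| <= e) ->
    `|(\int[mu]_(x in `[p, q]) (g x * tent s (x - z)))%R - g z * s ^+ 2| <= 8 * e * s ^+ 2.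
  move=> pz zq hz; have zz : z - s < z + s by lra.
  rewrite (@seg_integral_window _ _ p q (z - s) (z + s))//; last first.
    move=> x hx nx; have [xl|xl] := lerP x (z - s).
      by have [|-> _] := @tent_left _ s (x - z) s0; [lra|rewrite mulr0].
    have [|-> _] := @tent_right _ s (x - z) s0; last by rewrite mulr0.
    by rewrite leNgt; apply/negP => xr; apply: nx; lra.
  have k1 x : z - s <= x <= z + s -> `|x - z| <= s by rewrite ler_norml; lra.
  have k2 x : z - s <= x <= z + s -> p <= x <= q by lra.
  have s4' : 0 <= 4 * s by lra.
  have := seg_integral_freeze (ltW zz) s4' (fun x h => cg x (k2 x h)) (fun x _ => ct z x)
    (fun x h => hz x (k1 x h)) (fun x h => tent_bound s0 (k1 x h)).
  have -> : (\int[mu]_(x in `[z - s, z + s]) tent s (x - z))%R = s ^+ 2.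
    have dT x : z - s <= x <= z + s -> is_derive x 1 (fun x => tentI s (x - z)) (tent s (x - z)).
      by move=> _; exact: is_derive_shift (is_derive_tentI s (x - z)).
    have -> := seg_FTC2 zz dT (fun x _ => ct z x).
    have [|_ ->] := @tent_right _ s (z + s - z) s0; first lra.
    have [|_ ->] := @tent_left _ s (z - s - z) s0; first lra.
    by rewrite subr0.
  by have -> : e * (4 * s) * (z + s - (z - s)) = 8 * e * s ^+ 2 by ring.
have M1 := main x1 ltac:(lra) ltac:(lra) (fun y h => hr1 y (le_trans h s1)).
have M2 := main x2 ltac:(lra) ltac:(lra) (fun y h => hr2 y (le_trans h s2)).
move: M1 M2; move: (Rintegral _ _ _) (Rintegral _ _ _) => I1 I2 M1 M2 /eqP.
rewrite subr_eq0 => /eqP I12; rewrite I12 in M1.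
have ss : 0 < s ^+ 2 by rewrite exprn_gt0.
rewrite -(ler_pM2l ss) -{1}(gtr0_norm ss) -normrM.
have -> : s ^+ 2 * (g x1 - g x2) = (I2 - g x2 * s ^+ 2) - (I2 - g x1 * s ^+ 2) by ring.
rewrite I12; apply: (le_trans (ler_normB _ _)); apply: (le_trans (lerD M2 M1)).
by have -> : 8 * e * s ^+ 2 + 8 * e * s ^+ 2 = s ^+ 2 * (16 * e) by ring.
Qed.

End Transport.

(** * Ordinary differential equations *)

Section ODE.
Context {R : realType}.
Notation mu := (@lebesgue_measure R).

(** The intervals of radius 2C / 2^n about y(n) are nested, since each step is at most half the
    current radius; the supremum of their left ends lies in all of them. *)
Lemma geometric_limit (y : nat -> R) (C : R) :
  (forall n, `|y n.+1 - y n| <= C / 2 ^+ n) -> exists l, forall n, `|l - y n| <= 2 * C / 2 ^+ n.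
Proof.
move=> Hy; pose w n := 2 * C / 2 ^+ n.
have wS n : w n = 2 * w n.+1.
  by rewrite /w exprS; field; rewrite expf_neq0.
have Hw n : - w n.+1 <= y n.+1 - y n <= w n.+1.
  rewrite -ler_norml (le_trans (Hy n))// /w exprS le_eqVlt; apply/orP; left; apply/eqP.
  by field; rewrite expf_neq0.
have up n k : y n - w n <= y (n + k)%N - w (n + k)%N /\ y (n + k)%N + w (n + k)%N <= y n + w n.
  elim: k => [|k [IH1 IH2]]; first by rewrite addn0.
  by rewrite addnS; have := Hw (n + k)%N; have := wS (n + k)%N; lra.
have w0 n : 0 <= w n by have := Hw n; have := wS n; lra.
have cross n m : y n - w n <= y m + w m.
  have [u1 _] := up n m; have [_ u2] := up m n; have := w0 (n + m)%N.
  by rewrite addnC in u2; lra.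
pose S := [set y n - w n | n in setT].
have hS : has_sup S.
  by split; [exists (y 0 - w 0), 0%N|exists (y 0 + w 0) => _ [n _ <-]; exact: cross].
exists (sup S) => n; rewrite -/(w n) ler_norml; apply/andP; split.
  by have := sup_upper_bound hS (ex_intro2 _ _ n I erefl); rewrite /=; lra.
have : sup S <= y n + w n by apply: ge_sup; [case: hS|move=> _ [m _ <-]; exact: cross].
lra.
Qed.

(** The base point a - 2 lies to the left of [a - 1, a + 1], so that the fundamental theorem of
    calculus applies on both sides of [a]; the subtraction makes the value at [a] zero. *)
Definition primitive (a : R) (g : R -> R) (x : R) : R :=
  (\int[mu]_(s in `[a - 2, x]) g s)%R - (\int[mu]_(s in `[a - 2, a]) g s)%R.

Lemma primitive0 a g : primitive a g a = 0.
Proof. by rewrite /primitive subrr. Qed.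

Lemma is_derive_primitive (a : R) (g : R -> R) (x : R) : (forall z, {for z, continuous g}) ->
  `|x - a| <= 1 -> is_derive x 1 (primitive a g) (g x).
Proof.
move=> cg; rewrite ler_norml => /andP[h1 h2].
have lt1 : x < x + 1 by lra.
have ig : mu.-integrable `[a - 2, x + 1]%classic (EFin \o g) by apply: seg_integrable => z _; exact: cg.
have lt2 : (BLeft (a - 2)%R < BRight x)%E.
  by rewrite lte_fin; lra.
have [d1 d2] := continuous_FTC1 lt1 ig lt2 (cg x); rewrite derive1E in d2.
have dF := DeriveDef d1 d2.
apply: (is_derive_eq (is_derive_sub dF (is_derive_cst (\int[mu]_(s in `[a - 2, a]) g s)%R x 1))).
by rewrite subr0.
Qed.

(** Retraction onto [a - e, a + e]. It lets the Picard iterates be functions on the whole line with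
    global bounds. *)
Definition clamp (a e x : R) : R :=
  if x < a - e then a - e else if a + e < x then a + e else x.

Lemma clamp_in a e x : 0 <= e -> `|clamp a e x - a| <= e.
Proof.
by move=> e0; rewrite /clamp ler_norml; case: (ltP x); [|case: (ltP (a + e))] => *; lra.
Qed.

Lemma clampK a e x : `|x - a| <= e -> clamp a e x = x.
Proof.
by rewrite ler_norml /clamp => /andP[h1 h2]; case: (ltP x); [|case: (ltP (a + e))] => *; lra.
Qed.

Lemma clamp_lip a e x y : 0 <= e -> `|clamp a e x - clamp a e y| <= `|x - y|.
Proof.
move=> e0; have h1 := ler_norm (x - y).
have h3 : y - x <= `|x - y| by rewrite distrC ler_norm.
rewrite ler_norml /clamp; move: (`|x - y|) h1 h3 (normr_ge0 (x - y)) => n h1 h3 n0.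
by case: (ltP x) => ?; case: (ltP y) => ?; case: (ltP (a + e) x) => ?; case: (ltP (a + e) y) => ?; lra.
Qed.

Lemma lipschitz_continuous (y : R -> R) (c : R) : (forall s t, `|y s - y t| <= c * `|s - t|) ->
  forall x, {for x, continuous y}.
Proof.
move=> yl x; apply/cvgrPdist_lt => e e0.
have c1 : 0 < `|c| + 1 by rewrite ltr_wpDl.
have d0 : 0 < e / (`|c| + 1) by rewrite divr_gt0.
have : \forall z \near x, `|x - z| < e / (`|c| + 1).
  by have /cvgr_dist_lt := @cvg_id _ (nbhs x); apply.
apply: filterS => z; rewrite ltr_pdivlMr// => hz; apply: le_lt_trans hz.
apply: (le_trans (yl x z)); rewrite mulrC; apply: ler_wpM2l => //.
by rewrite (le_trans (ler_norm c))// lerDl.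
Qed.

(** Picard iteration: the integral operator halves distances, so the iterates converge geometrically
    to a fixed point, which is differentiable by the fundamental theorem of calculus. *)
Lemma ode_exists (D : set (plane R)) (v : plane R -> R) (p : plane R) :
  open D -> C1_on D v -> D p ->
  exists e (y : R -> R), [/\ 0 < e, y p.1 = p.2 & forall x, `|x - p.1| < e ->
    D (x, y x) /\ is_derive x 1 y (v (x, y x))].
Proof.
case: p => a t0 oD cv Dp /=.
have /nbhs_box[r1 r10 hr1] := open_near oD Dp.
pose r := r1 / 2; have r0 : 0 < r by rewrite /r divr_gt0.
have inD x t : `|x - a| <= r -> `|t - t0| <= r -> D (x, t).
  by move=> h1 h2; apply: hr1; split => /=; rewrite /r in h1 h2 r0; lra.
clearbody r.
have rsub : rect (a - r) (a + r) (t0 - r) (t0 + r) `<=` D.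
  by move=> [x t] /rectP[h1 h2]; apply: inD; rewrite ler_norml; move: h1 h2 => /=; lra.
have inr x t : `|x - a| <= r -> `|t - t0| <= r -> rect (a - r) (a + r) (t0 - r) (t0 + r) (x, t).
  by rewrite !ler_norml => h1 h2; apply/rectP => /=; lra.
have [m hm] := rect_bounded (fun x hx => C1_on_continuous cv (rsub x hx)).
have [l hl] := rect_bounded (fun x hx => C1_on_dy cv (rsub x hx)).
have raa : `|a - a| <= r by rewrite subrr normr0 ltW.
have rtt : `|t0 - t0| <= r by rewrite subrr normr0 ltW.
have m0 : 0 <= m by apply: le_trans (hm _ (inr _ _ raa rtt)).
have l0 : 0 <= l by apply: le_trans (hl _ (inr _ _ raa rtt)).
have vlip x t t' : `|x - a| <= r -> `|t - t0| <= r -> `|t' - t0| <= r ->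
    `|v (x, t') - v (x, t)| <= l * `|t' - t|.
  move=> hx ht ht'.
  have e1 z : `|z - t0| <= r -> is_derive z 1 (fun t => v (x, t)) (dy v (x, z)).
    by move=> hz; exact: is_derive_sectr (C1_on_diff cv (inD _ _ hx hz)).
  have e2 z : `|z - t0| <= r -> `|dy v (x, z)| <= l by move=> hz; exact: hl (inr _ _ hx hz).
  exact: (mean_value_abs e1 e2 ht ht').
(* m e <= r keeps the iterates in the square, l e <= 1/2 makes the operator a contraction, and e <=
   1 is the range in which [primitive] is differentiable. *)
pose e := Num.min (Num.min r 1) (Num.min (r / (m + 1)) (2^-1 / (l + 1))).
have m1 : 0 < m + 1 by lra.
have l1 : 0 < l + 1 by lra.
have e0 : 0 < e.
  have i1 : 0 < r / (m + 1) by rewrite divr_gt0.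
  have i2 : 0 < 2^-1 / (l + 1) :> R by rewrite !divr_gt0// invr_gt0.
  by rewrite /e !lt_min r0 ltr01 i1 i2.
have [er e1 em el] : [/\ e <= r, e <= 1, e <= r / (m + 1) & e <= 2^-1 / (l + 1)].
  by rewrite /e !ge_min !lexx !orbT.
clearbody e; rewrite ler_pdivlMr// in em; rewrite ler_pdivlMr// in el.
have me : m * e <= r by lra.
have le : l * e <= 2^-1 by lra.
(* Functions that stay in the square and are Lipschitz with constant [m]. The Lipschitz bound passes
   to pointwise limits and ensures continuity of the integrand. *)
pose Y : set (R -> R) := [set y | (forall x, `|y x - t0| <= r) /\ forall x z, `|y x - y z| <= m * `|x - z|].
pose G (y : R -> R) s := v (clamp a e s, y s).
pose T (y : R -> R) x := t0 + primitive a (G y) (clamp a e x).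
have ka x : `|clamp a e x - a| <= r by apply: (le_trans (clamp_in _ _ (ltW e0))).
have cG y : Y y -> forall z, {for z, continuous (G y)}.
  move=> [y1 y2] z; apply: (continuous_comp (f := fun s => (clamp a e s, y s)) (g := v)).
    apply: (@continuous_pair R R R (clamp a e) y z); last exact: lipschitz_continuous y2 z.
    apply: (@lipschitz_continuous (clamp a e) 1) => s t; rewrite mul1r.
    exact: clamp_lip (ltW e0).
  exact: (C1_on_continuous cv (inD _ _ (ka z) (y1 z))).
have dP y : Y y -> forall x, `|x - a| <= e -> is_derive x 1 (primitive a (G y)) (G y x).
  move=> Yy x hx; apply: is_derive_primitive; first exact: cG.
  exact: le_trans e1.
have aae : `|a - a| <= e by rewrite subrr normr0 ltW.
have TY y : Y y -> Y (T y).
  move=> Yy; have P x z : `|x - a| <= e -> `|z - a| <= e ->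
      `|primitive a (G y) x - primitive a (G y) z| <= m * `|x - z|.
    move=> hx hz; apply: (mean_value_abs (dP _ Yy)) => // s hs.
    by apply: hm; apply: inr; [exact: ka|case: Yy].
  split=> [x|x z].
    rewrite /T addrAC subrr add0r.
    have := P (clamp a e x) a (clamp_in _ _ (ltW e0)) aae.
    rewrite primitive0 subr0 => H; apply: (le_trans H); apply: le_trans me.
    by apply: ler_wpM2l => //; exact: clamp_in (ltW e0).
  have -> : T y x - T y z = primitive a (G y) (clamp a e x) - primitive a (G y) (clamp a e z).
    by rewrite /T; ring.
  apply: (le_trans (P _ _ (clamp_in _ _ (ltW e0)) (clamp_in _ _ (ltW e0)))).
  by apply: ler_wpM2l => //; exact: clamp_lip (ltW e0).
have Tc y z K : Y y -> Y z -> (forall x, `|y x - z x| <= K) -> forall x, `|T y x - T z x| <= K / 2.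
  move=> Yy Yz yz x.
  pose Q s := primitive a (G y) s - primitive a (G z) s.
  have -> : T y x - T z x = Q (clamp a e x) - Q a.
    by rewrite /T /Q !primitive0; ring.
  have dQ s : `|s - a| <= e -> is_derive s 1 Q (G y s - G z s).
    by move=> hs; exact: is_derive_sub (dP _ Yy _ hs) (dP _ Yz _ hs).
  have K0 : 0 <= K by exact: le_trans (yz a).
  have bQ s : `|s - a| <= e -> `|G y s - G z s| <= l * K.
    move=> _; apply: (le_trans (vlip _ _ _ (ka s) (Yz.1 s) (Yy.1 s))).
    by apply: ler_wpM2l.
  apply: (le_trans (mean_value_abs dQ bQ aae (clamp_in a x (ltW e0)))).
  have lK : 0 <= l * K by rewrite mulr_ge0.
  apply: (le_trans (ler_wpM2l lK (clamp_in a x (ltW e0)))).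
  rewrite mulrAC; have := ler_wpM2r K0 le; lra.
pose y n := iter n T (fun=> t0).
have Yn n : Y (y n).
  elim: n => [|n IH]; last exact: TY.
  split=> [x|x z]; first by rewrite /y /=.
  by rewrite /y /= subrr normr0 mulr_ge0.
have yC n x : `|y n.+1 x - y n x| <= 2 * r / 2 ^+ n.
  elim: n x => [|n IH] x.
    rewrite expr0 divr1; have := (Yn 1%N).1 x; rewrite /y /= => h.
    by apply: (le_trans h); lra.
  by rewrite exprSr invfM mulrA; exact: (Tc _ _ _ (Yn n.+1) (Yn n) IH x).
have [yy hyy] : exists yy, forall x n, `|yy x - y n x| <= 2 * (2 * r) / 2 ^+ n.
  have H x := @geometric_limit (y ^~ x) (2 * r) (yC ^~ x).
  by exists (fun x => projT1 (cid (H x))) => x; exact: projT2 (cid (H x)).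
have small (A B : R) : 0 <= B -> (forall n, A <= B / 2 ^+ n) -> A <= 0.
  move=> B0 HA; rewrite leNgt; apply/negP => A0.
  have [n hn] : exists n, B / A < n%:R.
    by exists (Num.truncn (B / A)).+1; exact: truncnS_gt.
  have := HA n; rewrite ler_pdivlMr ?exprn_gt0// leNgt => /negP; apply.
  rewrite ltr_pdivrMr// in hn; rewrite mulrC; apply: (lt_trans hn).
  by rewrite ltr_pM2r// -natrX ltr_nat ltn_expl.
have Yyy : Y yy.
  split=> [x|x z]; rewrite -subr_le0; apply: (small _ (8 * r)); rewrite ?mulr_ge0 ?ltW// => n.
    have h1 := hyy x n; have h2 := (Yn n).1 x.
    have -> : yy x - t0 = (yy x - y n x) + (y n x - t0) by ring.
    have := ler_normD (yy x - y n x) (y n x - t0).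
    have : 0 <= r / 2 ^+ n by rewrite divr_ge0 ?exprn_ge0// ltW.
    by move: h1 h2; move: (2 ^- n) => w; lra.
  have h1 := hyy x n; have h2 := hyy z n; have h3 := (Yn n).2 x z.
  have -> : yy x - yy z = (yy x - y n x) + (y n x - y n z) - (yy z - y n z) by ring.
  have := ler_normB (yy x - y n x + (y n x - y n z)) (yy z - y n z).
  have := ler_normD (yy x - y n x) (y n x - y n z).
  by move: h1 h2; move: (2 ^- n) => w; lra.
have fix_yy x : T yy x = yy x.
  apply/eqP; rewrite -subr_eq0 -normr_le0; apply: (small _ (8 * r)).
    by rewrite mulr_ge0 ?ltW.
  move=> n; have h1 := Tc _ _ _ Yyy (Yn n) (hyy ^~ n) x; have h2 := hyy x n.+1.
  have -> : T yy x - yy x = (T yy x - y n.+1 x) - (yy x - y n.+1 x) by ring.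
  have := ler_normB (T yy x - y n.+1 x) (yy x - y n.+1 x).
  have : 0 <= r / 2 ^+ n by rewrite divr_ge0 ?exprn_ge0// ltW.
  rewrite -[T (y n)]/(y n.+1) in h1.
  by move: h1 h2; rewrite exprSr invfM; move: (2 ^- n) => w; lra.
exists e, yy; split=> //.
  by rewrite -fix_yy /T clampK// primitive0 addr0.
move=> x hx; have hx' := ltW hx.
have Yx := Yyy.1 x; split; first by apply: inD => //; exact: le_trans er.
have E : \forall z \near x, t0 + primitive a (G yy) z = yy z.
  have : \forall z \near x, `|z - a| < e by exact: open_nbhs_nbhs (conj (@open_dist_lt R a e) hx).
  by apply: filterS => z hz; rewrite -fix_yy /T clampK// ltW.
have := isD_add (is_derive_cst t0 x 1) (dP _ Yyy _ hx').
rewrite add0r => -[d1 d2]; apply: DeriveDef.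
  by apply: near_eq_derivable d1; last exact: E.
by rewrite -(near_eq_derive _ E) d2 /G clampK.
Qed.

(** At a maximum k of |f| the mean value inequality gives |f k| <= c r |f k| <= |f k| / 2. Smallness
    of the radius replaces the exponential of Gronwall's inequality. *)
Lemma gronwall_zero (f df : R -> R) (s0 r c : R) : 0 <= r -> c * r <= 2^-1 ->
  (forall s, `|s - s0| <= r -> is_derive s 1 f (df s)) ->
  (forall s, `|s - s0| <= r -> `|df s| <= c * `|f s|) -> f s0 = 0 ->
  forall s, `|s - s0| <= r -> f s = 0.
Proof.
move=> r0 cr dff dfb f0.
have itvE s : (`|s - s0| <= r) = (s0 - r <= s <= s0 + r).
  by rewrite ler_norml; apply/idP/idP; lra.
have cf : {within `[s0 - r, s0 + r], continuous (fun s => `|f s|)}.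
  apply: continuous_at_seg => s; rewrite -itvE => hs.
  exact: (continuous_comp (is_derive_continuous (dff _ hs)) (@norm_continuous _ _ _)).
have [|k] := EVT_max _ cf; first lra.
rewrite in_itv/= -itvE => hk kmax.
have fk s : `|s - s0| <= r -> `|f s| <= `|f k|.
  by move=> hs; apply: kmax; rewrite in_itv/= -itvE.
have s00 : `|s0 - s0| <= r by rewrite subrr normr0.
have [c0|c0] := leP 0 c; last first.
  have z s : `|s - s0| <= r -> f s = 0.
    move=> hs; apply/eqP; rewrite -normr_le0 leNgt; apply/negP => h.
    have := le_trans (normr_ge0 _) (dfb _ hs).
    by rewrite nmulr_rge0// leNgt h.
  exact: z.
have bd s : `|s - s0| <= r -> `|df s| <= c * `|f k|.
  by move=> hs; apply: (le_trans (dfb _ hs)); exact: ler_wpM2l (fk _ hs).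
have H := mean_value_abs dff bd s00 hk; rewrite f0 subr0 in H.
have ck : 0 <= c * `|f k| by rewrite mulr_ge0.
have H2 : `|f k| <= 2^-1 * `|f k|.
  apply: (le_trans H); apply: (le_trans (ler_wpM2l ck hk)).
  by rewrite mulrAC; apply: ler_wpM2r.
have fk0 : `|f k| <= 0 by lra.
by move=> s hs; apply/eqP; rewrite -normr_le0; exact: le_trans (fk _ hs) fk0.
Qed.

(** Uniqueness for a solution followed in an arbitrary parametrization, where [x] need be neither
    injective nor of nonzero speed. The difference t - y(x) has a derivative bounded by a constant
    times itself, so it vanishes. *)
Lemma ode_unique (D : set (plane R)) (v : plane R -> R) (y x t dx' : R -> R) (s0 : R) :
  open D -> C1_on D v -> D (x s0, t s0) -> y (x s0) = t s0 ->
  (\forall z \near x s0, is_derive (z : R) 1 y (v (z, y z))) ->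
  (\forall s \near s0, is_derive (s : R) 1 x (dx' s) /\ is_derive s 1 t (v (x s, t s) * dx' s)) ->
  {for s0, continuous dx'} ->
  \forall s \near s0, t s = y (x s).
Proof.
move=> oD cv Ds ys dy' dxt cdx.
have /nbhs_box[r r0 hr] := open_near oD Ds.
pose r2 := r / 2; have r20 : 0 < r2 by rewrite divr_gt0.
have inD a b : `|a - x s0| <= r2 -> `|b - t s0| <= r2 -> D (a, b).
  by move=> h1 h2; apply: hr; split => /=; rewrite /r2 in h1 h2 r20; lra.
pose a1 := x s0 - r2; pose a2 := x s0 + r2; pose b1 := t s0 - r2; pose b2 := t s0 + r2.
have rsub : rect a1 a2 b1 b2 `<=` D.
  by move=> [a b] /rectP[h1 h2]; apply: inD; rewrite ler_norml; move: h1 h2; rewrite /a1 /a2 /b1 /b2 /=; lra.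
have [l hl] := rect_bounded (fun x hx => C1_on_dy cv (rsub x hx)).
have dxs := nbhs_singleton dxt.
have cx : {for s0, continuous x} by case: dxs => h _; exact: is_derive_continuous h.
have ct : {for s0, continuous t} by case: dxs => _ h; exact: is_derive_continuous h.
have cy : {for x s0, continuous y} by exact: is_derive_continuous (nbhs_singleton dy').
have cyx : {for s0, continuous (fun s => y (x s))} by exact: (continuous_comp cx cy).
have n1 : \forall s \near s0, `|x s0 - x s| < r2 by have /cvgr_dist_lt := cx; apply.
have n2 : \forall s \near s0, `|t s0 - t s| < r2 by have /cvgr_dist_lt := ct; apply.
have n3 : \forall s \near s0, `|y (x s0) - y (x s)| < r2 by have /cvgr_dist_lt := cyx; apply.
have n4 : \forall s \near s0, `|dx' s0 - dx' s| < 1 by have /cvgr_dist_lt := cdx; apply.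
have n5 : \forall s \near s0, is_derive (x s) 1 y (v (x s, y (x s))) by exact: cx dy'.
have fI := @filterI _ _ (nbhs_filter s0).
have /nbhs_ballP[q q0 hq] := fI _ _ (fI _ _ (fI _ _ n1 n2) (fI _ _ n3 n4)) (fI _ _ n5 dxt).
pose c := (`|l| + 1) * (`|dx' s0| + 1).
have c0 : 0 < c by rewrite mulr_gt0// ltr_wpDl.
pose q2 := Num.min (q / 2) (2^-1 / c).
have q20 : 0 < q2 by rewrite /q2 lt_min !divr_gt0// invr_gt0.
have [h1 h2] : q2 <= q / 2 /\ q2 <= 2^-1 / c by rewrite /q2 !ge_min !lexx !orbT.
have q00 : 0 < q := q0.
have near_q s : `|s - s0| <= q2 -> [/\ `|x s0 - x s| < r2, `|t s0 - t s| < r2, `|y (x s0) - y (x s)| < r2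
   & [/\ `|dx' s0 - dx' s| < 1, is_derive (x s) 1 y (v (x s, y (x s))),
    is_derive s 1 x (dx' s) & is_derive s 1 t (v (x s, t s) * dx' s)]].
  move=> hs; have [|[[k1 k2] [k3 k4]] [k5 [k6 k7]]] := hq s; last by split.
  by rewrite /ball/= distrC; apply: (le_lt_trans hs); lra.
pose f s := t s - y (x s).
pose df s := (v (x s, t s) - v (x s, y (x s))) * dx' s.
suff Z : forall s, `|s - s0| <= q2 -> f s = 0.
  apply/nbhs_ballP; exists q2 => // s; rewrite /ball/= distrC => /ltW /Z /eqP.
  by rewrite subr_eq0 => /eqP.
apply: (@gronwall_zero f df s0 q2 c (ltW q20)).
- by rewrite mulrC -ler_pdivlMr.
- move=> s /near_q[_ _ _ [_ k5 k6 k7]].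
  by apply: (is_derive_eq (is_derive_sub k7 (isD_comp k6 k5))); rewrite /df mulrBl.
- move=> s /near_q[k1 k2 k3 [k4 _ _ _]]; rewrite /df normrM.
  rewrite distrC in k1; rewrite distrC in k2; rewrite ys distrC in k3.
  have /ltW k1' := k1; have /ltW k2' := k2; have /ltW k3' := k3.
  have d1 : `|dx' s| <= `|dx' s0| + 1.
    have -> : dx' s = dx' s0 - (dx' s0 - dx' s) by ring.
    by apply: (le_trans (ler_normB _ _)); lra.
  have d2 : `|v (x s, t s) - v (x s, y (x s))| <= (`|l| + 1) * `|f s|.
    have bl z : `|z - t s0| <= r2 -> `|dy v (x s, z)| <= `|l| + 1.
      move=> hz; have := hl (x s, z) _; have := ler_norm l; move=> l1 H.
      have hR : rect a1 a2 b1 b2 (x s, z).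
        by apply/rectP; rewrite /a1 /a2 /b1 /b2 /=; move: k1' hz; rewrite !ler_norml; lra.
      by have := H hR; lra.
    have e1 z : `|z - t s0| <= r2 -> is_derive z 1 (fun t => v (x s, t)) (dy v (x s, z)).
      by move=> hz; exact: is_derive_sectr (C1_on_diff cv (inD _ _ k1' hz)).
    exact: (mean_value_abs e1 bl k3' k2').
  rewrite /c mulrAC; apply: ler_pM => //.
- by rewrite /f ys subrr.
Qed.

End ODE.

(** * Horizontal lines in the surface *)

Section GraphLines.
Context {R : realType} (al be : R) {M : topologicalType}.
Hypothesis albe : al ^+ 2 + be ^+ 2 = 1.
Implicit Types (F : M -> heis R) (D E : set (plane R)) (psi : plane R -> M) (u : plane R -> R).

Lemma chart_sub D D' psi : open D' -> D' `<=` D -> open D -> chart D psi -> chart D' psi.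
Proof.
move=> oD' sD oD ch; have [_ ij cp op] := ch; split.
- by left.
- by move=> x y /set_mem D'x /set_mem D'y; apply: ij; apply: mem_set; exact: sD.
- by apply: continuous_in_subspaceT => x /set_mem /sD; exact: chart_continuous.
- move=> O oO; rewrite (_ : D' `&` O = D `&` (D' `&` O)); first by apply: op; exact: openI.
  by rewrite setIA (setIidr sD).
Qed.

Lemma graph_chart_sub F D D' psi u : open D' -> D' `<=` D ->
  graph_chart al be F D psi u -> graph_chart al be F D' psi u.
Proof.
move=> oD' sD [oD ch cu Fp]; split.
- exact: oD'.
- exact: chart_sub ch.
- exact: C1_on_sub cu.
- by move=> x /sD; exact: Fp.
Qed.

Lemma derive0_constant (f : R -> R) (a r : R) :
  (forall x, `|x - a| < r -> is_derive x 1 f 0) ->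
  forall x, `|x - a| < r -> f x = f a.
Proof.
move=> df x hx; apply/eqP; rewrite -subr_eq0 -normr_le0.
have d1 z : `|z - a| <= `|x - a| -> is_derive z 1 f ((fun=> 0) z).
  by move=> hz; apply: df; exact: le_lt_trans hx.
have d2 z : `|z - a| <= `|x - a| -> `|(fun=> 0 : R) z| <= 0 by rewrite normr0.
have aa : `|a - a| <= `|x - a| by rewrite subrr normr0.
by apply: (le_trans (mean_value_abs d1 d2 aa (lexx _))); rewrite mul0r.
Qed.

(** Cross-multiplying and squaring gives x^2 = y^2, hence equal denominators. It recovers [om] from
    the quantity that the weak equation shows to be constant. *)
Lemma ratio_sqrt_inj (x y : R) :
  x / Num.sqrt (1 + x ^+ 2) = y / Num.sqrt (1 + y ^+ 2) -> x = y.
Proof.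
have p z : 0 < Num.sqrt (1 + z ^+ 2) :> R by rewrite sqrtr_gt0 one_sqr_gt0.
have sq z : Num.sqrt (1 + z ^+ 2) ^+ 2 = 1 + z ^+ 2 :> R by rewrite sqr_sqrtr// ltW// one_sqr_gt0.
move: (p x) (p y) (sq x) (sq y); move: (Num.sqrt (1 + x ^+ 2)) (Num.sqrt (1 + y ^+ 2)) => a b a0 b0 ha hb /eqP.
rewrite (eqr_div _ _ (lt0r_neq0 a0) (lt0r_neq0 b0)) => /eqP E.
have E2 : x ^+ 2 = y ^+ 2.
  have : (x * b) ^+ 2 = (y * a) ^+ 2 by rewrite E.
  rewrite !exprMn ha hb; lra.
have ab : a = b.
  have : a ^+ 2 = b ^+ 2 by rewrite ha hb E2.
  by move=> /eqP; rewrite eqrXn2 ?ltW// => /eqP.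
by move: E; rewrite ab => /mulIf; apply; rewrite gt_eqF.
Qed.

Lemma near_dist_lt (a r : R) : 0 < r -> \forall x \near a, `|x - a| < r.
Proof. by move=> r0; have /cvgr_distC_lt := @cvg_id _ (nbhs a); apply. Qed.

Definition parabola (t0 v w x0 x : R) : R := t0 + 2 * v * (x - x0) + w * (x - x0) ^+ 2.

Lemma is_derive_parabola (t0 v w x0 x : R) :
  is_derive x 1 (parabola t0 v w x0) (2 * (v + w * (x - x0))).
Proof.
have d1 : is_derive x 1 (fun x => x - x0) (1 - 0).
  exact: (is_derive_sub (is_derive_id x 1) (is_derive_cst x0 x 1)).
have d2 := isD_add (isD_add (is_derive_cst t0 x 1) (is_derive_scale (2 * v) d1)) (is_derive_scale w (isD_mul d1 d1)).
by apply: (is_derive_eq d2); ring.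
Qed.

Lemma is_derive_along (u : plane R -> R) (y : R -> R) (x y' : R) : differentiable u (x, y x) ->
  is_derive x 1 y y' -> is_derive x 1 (fun x => u (x, y x)) (dx u (x, y x) + y' * dy u (x, y x)).
Proof.
move=> du [dy1 dy2]; have d1 : differentiable (id : R -> R) x by [].
have d2 : differentiable y x by apply/derivable1_diffP.
apply: DeriveDef.
  apply: diff_derivable; apply: (differentiable_comp (f := fun x => (x, y x)) (g := u)) => //.
  exact: differentiable_pair.
by rewrite (derive_comp2 _ d1 d2 du) dy2 derive_id mul1r.
Qed.

Lemma graph_line F D psi u p0 : area_stationary F -> graph_chart al be F D psi u -> D p0 ->
  exists e, 0 < e /\ forall x, `|x - p0.1| < e ->
    let y := parabola p0.2 (u p0) (om u p0) p0.1 x in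
    [/\ D (x, y), u (x, y) = u p0 + om u p0 * (x - p0.1) & om u (x, y) = om u p0].
Proof.
move=> stat gc Dp0; have [oD ch cu Fp] := gc.
(* Centring the flow at the height of [p0] and shrinking the domain keeps the graph strictly inside
   the strip that the flow moves. *)
pose eta0 := u p0; pose B := [set t : R | `|t - eta0| < pi / 2].
have oB : open B by exact: open_dist_lt.
pose D1 := D `&` u @^-1` B.
have oD1 : open D1.
  by apply: continuous_open_preimage; [exact: oD|exact: oB|move=> x; exact: C1_on_continuous cu].
have D1D : D1 `<=` D by move=> x [].
have D1p : D1 p0 by split => //; rewrite /preimage /B /= /eta0 subrr normr0 divr_gt0// pi_gt0.
have gc1 := graph_chart_sub oD1 D1D gc; have cu1 : C1_on D1 u by case: gc1.
have u_eta0 x : D1 x -> `|u x - eta0| < pi / 2 by case.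
have [x0 [t0 Ep]] : exists x0 t0, p0 = (x0, t0) by exists p0.1, p0.2; case: (p0).
rewrite Ep /= in D1p *.
have cv : C1_on D1 (fun x => 2 * u x) by exact: (C1_onM oD1 (@C1_on_cst _ (plane R) R D1 2) cu1).
have [e [y [e0 y0 ysol]]] := ode_exists oD1 cv D1p; rewrite /= in y0 ysol.
have /nbhs_box[r r0 hr] := open_near oD1 D1p.
have xx0 : `|x0 - x0| < e by rewrite subrr normr0.
have cy : {for x0, continuous y} by have [_ h] := ysol _ xx0; exact: is_derive_continuous h.
have r20 : 0 < r / 2 by rewrite divr_gt0.
have /nbhs_ballP[q q0 hq] : \forall x \near x0, `|y x - y x0| < r / 2.
  by have /cvgr_distC_lt := cy; apply.
have q00 : 0 < q := q0.
pose m := Num.min (Num.min (e / 2) (r / 2)) (q / 2).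
have m0 : 0 < m by rewrite /m !lt_min !divr_gt0.
have [me mr mq] : [/\ m <= e / 2, m <= r / 2 & m <= q / 2] by rewrite /m !ge_min !lexx !orbT.
clearbody m.
have itvE x : (x0 - m <= x <= x0 + m) = (`|x - x0| <= m).
  by rewrite ler_norml; apply/idP/idP; lra.
have rD1 : rect (x0 - m) (x0 + m) (t0 - r / 2) (t0 + r / 2) `<=` D1.
  by move=> [a b] /rectP/= [h1 h2]; apply: hr; split => /=; rewrite ltr_norml; lra.
have dtb x : x0 - m <= x <= x0 + m -> is_derive x 1 y (2 * u (x, y x)).
  by rewrite itvE => hx; have [|_ h] := ysol x; [lra|].
have tbcd x : x0 - m <= x <= x0 + m -> t0 - r / 2 < y x < t0 + r / 2.
  rewrite itvE => hx; have : `|y x - y x0| < r / 2.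
    by apply: hq; rewrite /ball/= distrC; lra.
  by rewrite y0 ltr_norml; lra.
pose f x := om u x / gdens u x.
have cf x : D1 x -> {for x, continuous f}.
  move=> Dx; have cst (k : R) : {for x, continuous (fun=> k : R)} by exact: cst_continuous.
  have c0 := C1_on_continuous cu1 Dx; have c1 := C1_on_dx cu1 Dx; have c2 := C1_on_dy cu1 Dx.
  have com : {for x, continuous (om u)} by exact: (cvgD c1 (cvgM (cvgM (cst 2) c0) c2)).
  have [_ cg] := gdens_nonneg_cont oD1 cu1 Dx.
  apply: (cvgM com); apply: cvgV; last exact: cg.
  by rewrite gt_eqF// sqrtr_gt0 one_sqr_gt0.
have weak w : C1_on setT w -> (forall x, ~ rect (x0 - m) (x0 + m) (t0 - r / 2) (t0 + r / 2) x -> w x = 0) -> _ :=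
  fun cw w0 => first_variation albe stat gc1 u_eta0 rD1 cw w0.
have fconst x : `|x - x0| < m -> f (x, y x) = f (x0, y x0).
  move=> hx; apply: (constant_along_curve oD1 cu1 cf rD1 dtb tbcd weak); rewrite -ltr_distl//.
  by rewrite subrr normr0.
have omc x : `|x - x0| < m -> om u (x, y x) = om u (x0, y x0).
  by move=> /fconst; exact: ratio_sqrt_inj.
have D1y x : `|x - x0| < m -> D1 (x, y x).
  by move=> hx; have [] := ysol x; [lra|].
have duy x : `|x - x0| < m -> is_derive x 1 (fun x => u (x, y x)) (om u (x0, y x0)).
  move=> hx; have hx' : x0 - m <= x <= x0 + m by rewrite itvE ltW.
  apply: (is_derive_eq (is_derive_along (C1_on_diff cu1 (D1y _ hx)) (dtb _ hx'))).
  by rewrite -(omc _ hx).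
have uE x : `|x - x0| < m -> u (x, y x) = u (x0, t0) + om u (x0, t0) * (x - x0).
  move=> hx; pose g x := u (x, y x) - om u (x0, t0) * x.
  have dg z : `|z - x0| < m -> is_derive z 1 g 0.
    move=> hz; apply: (is_derive_eq (is_derive_sub (duy _ hz) (is_derive_scale (om u (x0, t0)) (is_derive_id z 1)))).
    by rewrite y0; ring.
  have := derive0_constant dg hx; rewrite /g y0 => /eqP; rewrite subr_eq => /eqP ->; ring.
have yE x : `|x - x0| < m -> y x = parabola t0 (u (x0, t0)) (om u (x0, t0)) x0 x.
  move=> hx; pose g x := y x - parabola t0 (u (x0, t0)) (om u (x0, t0)) x0 x.
  have dg z : `|z - x0| < m -> is_derive z 1 g 0.
    move=> hz; have hz' : x0 - m <= z <= x0 + m by rewrite itvE ltW.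
    apply: (is_derive_eq (is_derive_sub (dtb _ hz') (is_derive_parabola _ _ _ _ _))).
    by rewrite (uE _ hz); ring.
  have := derive0_constant dg hx; rewrite /g y0 {2}/parabola subrr expr0n /= !mulr0 !addr0 subrr.
  by move=> /eqP; rewrite subr_eq0 => /eqP.
exists m; split=> // x hx; rewrite -yE//; split; first exact: D1D (D1y _ hx).
- exact: uE.
- by rewrite omc// y0.
Qed.

End GraphLines.

(** * The contact form and the choice of a vertical plane *)

Section ContactForm.
Context {R : realType}.
Implicit Types (q w a b : heis R).

(** The T-component of [w], that is, the contact form dt - y dx + x dy. *)
Definition contact q w : R := (frame_coord q w).2.

Lemma horizontal_planeP q w : horizontal_plane q w <-> contact q w = 0.
Proof.
rewrite /contact; split=> [[a [b ->]]|w0].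
  by rewrite /frame_coord /fieldX /fieldY /=; rewrite /GRing.scale /=; ring.
exists w.1.1, w.1.2; rewrite -[LHS](frame_coordK q) /of_frame w0 scale0r addr0.
by [].
Qed.

Lemma contactD q a b (s t : R) : contact q (s *: a + t *: b) = s * contact q a + t * contact q b.
Proof. by rewrite /contact /frame_coord /= /GRing.scale /=; ring. Qed.

Lemma lincomb_fst a b (s t : R) :
  (s *: a + t *: b).1 = (s * a.1.1 + t * b.1.1, s * a.1.2 + t * b.1.2).
Proof. by case: a b => [[? ?] ?] [[? ?] ?]. Qed.

Lemma horizontal_eq q a b : contact q a = 0 -> contact q b = 0 -> a.1 = b.1 -> a = b.
Proof.
case: a b => [[a1 a2] a3] [[b1 b2] b3]; rewrite /contact /frame_coord /= => ha hb [E1 E2].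
by rewrite E1 E2 in ha *; congr (_, _); move: ha hb; move: (b1 * _) (b2 * _) => *; lra.
Qed.

End ContactForm.

Section ContactGraph.
Context {R : realType} (al be : R).
Hypothesis albe : al ^+ 2 + be ^+ 2 = 1.

Lemma contact_dgpt xi eta tau x y t :
  contact (gpt al be xi eta tau) (dgpt al be xi eta x y t) = t - 2 * eta * x.
Proof.
rewrite /contact /frame_coord /gpt /dgpt /=.
transitivity (t - xi * y - eta * x + (al ^+ 2 + be ^+ 2) * (xi * y - eta * x)); first by ring.
by rewrite albe; ring.
Qed.

Lemma gxi_dgpt xi eta x y t : gxi al be (dgpt al be xi eta x y t) = x.
Proof. by rewrite -[RHS]mul1r -albe /gxi /dgpt /=; ring. Qed.

Lemma differentiable_gxi {V : normedModType R} (f : V -> heis R) p : differentiable f p ->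
  [/\ differentiable (fun x => gxi al be (f x)) p, differentiable (fun x => geta al be (f x)) p &
      differentiable (fun x => gtau al be (f x)) p].
Proof.
move=> df; have cst k : differentiable (fun=> k : R) p by exact: differentiable_cst.
have fd (W1 W2 : normedModType R) (g : V -> W1 * W2) : differentiable g p -> differentiable (fun x => (g x).1) p.
  move=> dg; have d : differentiable (fst : W1 * W2 -> W1) (g p) by case: (@C1_on_fst _ _ _ setT (g p)).
  exact: (differentiable_comp dg d).
have sd (W1 W2 : normedModType R) (g : V -> W1 * W2) : differentiable g p -> differentiable (fun x => (g x).2) p.
  move=> dg; have d : differentiable (snd : W1 * W2 -> W2) (g p) by case: (@C1_on_snd _ _ _ setT (g p)).
  exact: (differentiable_comp dg d).
have d0 := fd _ _ f df; have d1 := fd _ _ _ d0; have d2 := sd _ _ _ d0; have d3 := sd _ _ f df.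
have h1 : differentiable (fun x => gxi al be (f x)) p.
  exact: (differentiableD (differentiableM (cst al) d1) (differentiableM (cst be) d2)).
have h2 : differentiable (fun x => geta al be (f x)) p.
  exact: (differentiableD (differentiableM (cst (- be)) d1) (differentiableM (cst al) d2)).
split; [exact: h1|exact: h2|exact: (differentiableD d3 (differentiableM h1 h2))].
Qed.

Lemma derive_heis {V : normedModType R} (f : V -> heis R) p v : differentiable f p ->
  'D_v f p = dgpt al be (gxi al be (f p)) (geta al be (f p))
    ('D_v (fun x => gxi al be (f x)) p) ('D_v (fun x => geta al be (f x)) p)
    ('D_v (fun x => gtau al be (f x)) p).
Proof.
move=> df; have [d1 d2 d3] := differentiable_gxi df.
rewrite -(derive_gpt al be v d1 d2 d3); congr ('D_v _ p).
by apply/funext => x; rewrite gptK.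
Qed.

Lemma derive_gxi {V : normedModType R} (f : V -> heis R) p v : differentiable f p ->
  'D_v (fun x => gxi al be (f x)) p = gxi al be ('D_v f p).
Proof. by move=> df; rewrite (derive_heis v df) gxi_dgpt. Qed.

Lemma derive_gtau {V : normedModType R} (f : V -> heis R) p v : differentiable f p ->
  'D_v (fun x => gtau al be (f x)) p =
  contact (f p) ('D_v f p) + 2 * geta al be (f p) * gxi al be ('D_v f p).
Proof.
move=> df; rewrite (derive_heis v df) gxi_dgpt.
move: ('D_v (fun x => gxi _ _ _) p) ('D_v (fun x => geta _ _ _) p) ('D_v _ p) => x y t.
have := contact_dgpt (gxi al be (f p)) (geta al be (f p)) (gtau al be (f p)) x y t.
by rewrite gptK// => ->; ring.
Qed.

(** The Jacobian is d xi wedge d tau on the tangent vectors, and d tau equals the contact form plus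
    2 eta d xi, whose last term drops out of the wedge. *)
Lemma jac_gproj (G : plane R -> heis R) p : differentiable G p ->
  jac (fun x => gproj al be (G x)) p =
  gxi al be (dx G p) * contact (G p) (dy G p) - gxi al be (dy G p) * contact (G p) (dx G p).
Proof.
move=> dG; have [d1 _ d3] := differentiable_gxi dG.
rewrite /gproj (jac_pair d1 d3) !dxE !dyE !derive_gxi// !derive_gtau//.
by move: ('D_ _ G p) ('D_ _ G p) (geta _ _ _) => a b e; move: (gxi _ _ a) (gxi _ _ b) => *; ring.
Qed.

(** In the third coordinate tau - xi eta the quadratic terms in x cancel, so the lift of the
    parabola is straight. *)
Lemma gpt_parabola x0 u0 t0 w x :
  gpt al be x (u0 + w * (x - x0)) (parabola t0 u0 w x0 x) =
  horizontal_line (gpt al be x0 u0 t0) (al - be * w) (be + al * w) (x - x0).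
Proof.
rewrite /gpt /horizontal_line /parabola /=; congr (_, _, _); [by ring|by ring|].
transitivity (t0 - x0 * u0 + (al ^+ 2 + be ^+ 2) * ((u0 - w * x0) * (x - x0))); last by ring.
by rewrite albe; ring.
Qed.

Lemma line_direction_neq0 w : (al - be * w, be + al * w) != (0, 0).
Proof.
apply/eqP => -[h1 h2]; have : al * (al - be * w) + be * (be + al * w) = 0 by rewrite h1 h2; ring.
have -> : al * (al - be * w) + be * (be + al * w) = al ^+ 2 + be ^+ 2 by ring.
by rewrite albe => /eqP; rewrite oner_eq0.
Qed.

Context {M : topologicalType}.
Implicit Types (F : M -> heis R) (D : set (plane R)) (psi : plane R -> M).

(** The given chart is reparametrized by the local inverse of the projection to (xi, tau); the
    height is then the eta-coordinate of the immersion. *)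
Lemma graph_chart_of_immersion F D psi G x : open D -> chart D psi ->
  C1_immersion_ext F D psi G -> D x -> jac (fun y => gproj al be (G y)) x != 0 ->
  exists V psi' u y, [/\ graph_chart al be F V psi' u, V y & psi' y = psi x].
Proof.
move=> oD ch [[W [oW DW cG]] GF _] Dx jx; set k := fun y => _ in jx.
have ck : C1_on D k by apply: C1_on_gproj => //; exact: C1_on_sub cG.
have [N [V [g [Nx ND [dk _]]]]] := local_change_of_variables oD Dx ck jx.
have [oN oV NV VN [_ cg]] := dk.
exists V, (psi \o g), (fun y => geta al be (G (g y))), (k x).
have [Vkx gkx] := NV _ Nx; split; [|exact: Vkx|by rewrite /= gkx].
have [_ ij cp op] := ch.
have gD y : V y -> D (g y) by move=> /VN[/ND].
split.
- exact: oV.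
- split.
  + by left.
  + move=> y z /set_mem Vy /set_mem Vz /= E.
    have {}E : g y = g z by apply: ij => //; apply: mem_set; exact: gD.
    by rewrite -(VN _ Vy).2 -(VN _ Vz).2 E.
  + apply: continuous_in_subspaceT => y /set_mem Vy.
    apply: (continuous_comp (f := g) (g := psi)); first exact: (C1_on_continuous cg Vy).
    exact: (chart_continuous oD ch (gD _ Vy)).
  + move=> O oO; rewrite (_ : (psi \o g) @` (V `&` O) = psi @` (D `&` (N `&` k @^-1` O))).
      apply: op; apply: continuous_open_preimage; [exact: oN|exact: oO|].
      by move=> z Nz; exact: (C1_on_continuous ck (ND _ Nz)).
    apply/seteqP; split => [_ [y [Vy Oy] <-]|_ [z [Dz [Nz Oz]] <-]].
      exists (g y) => //; have [Ng kg] := VN _ Vy; split; first exact: gD.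
      by split => //; rewrite /preimage /= kg.
    have [Vk gk] := NV _ Nz; exists (k z); last by rewrite /= gk.
    by [].
- have cG' : C1_on D (fun y => geta al be (G y)) by apply: C1_on_geta => //; exact: C1_on_sub cG.
  exact: (C1_on_comp_plane oV gD cG' cg).
- move=> y Vy; have [Ng kg] := VN _ Vy.
  rewrite /= -GF; last exact: gD.
  by rewrite -(congr1 fst kg) -(congr1 snd kg) gptK.
Qed.

End ContactGraph.

(** * Tangent planes in arbitrary charts and regular points *)

Section TangentPlanes.
Context {R : realType} {M : topologicalType}.
Implicit Types (F : M -> heis R) (D : set (plane R)) (psi : plane R -> M).

Lemma derive_one_sided {V W : normedModType R} (f g : V -> W) (x v : V) :
  derivable f x v -> derivable g x v -> f x = g x ->
  (\forall s \near 0^'+, f (s *: v + x) = g (s *: v + x)) -> 'D_v f x = 'D_v g x.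
Proof.
move=> df dg fg E.
have c1 : (fun h : R => h^-1 *: (f (h *: v + x) - f x)) h @[h --> 0^'+] --> 'D_v f x.
  exact: cvg_dnbhs_at_right.
have c2 : (fun h : R => h^-1 *: (g (h *: v + x) - g x)) h @[h --> 0^'+] --> 'D_v g x.
  exact: cvg_dnbhs_at_right.
have c3 : (fun h : R => h^-1 *: (f (h *: v + x) - f x)) h @[h --> 0^'+] --> 'D_v g x.
  apply: cvg_trans c2; apply: near_eq_cvg; apply: filterS E => s /= ->.
  by rewrite fg.
exact: (cvg_unique _ c1 c3).
Qed.

(* Where the projection of [G] to the plane of the first two coordinates is a
   local diffeomorphism, every other chart is, on its domain, [G] composed with
   a differentiable map; on a boundary chart this determines derivatives in the
   inward directions only. *)
Lemma tangent_plane_image F D psi G x :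
  open D -> chart D psi -> C1_immersion_ext F D psi G -> D x ->
  jac (fst \o G) x != 0 ->
  forall w, tangent_plane F (psi x) w -> exists v, w = 'D_v G x.
Proof.
move=> oD ch [[U [oU DU cG]] GF _] Dx jx w [D1 [psi1 [G1 [x1 [v]]]]].
move=> [ch1 [[U1 [oU1 DU1 cG1]] GF1 _] D1x1 E ->].
pose pr := fst : heis R -> plane R.
have cGD : C1_on D G by exact: C1_on_sub cG.
have cP : C1_on D (pr \o G).
  exact: (C1_on_fst_comp oD cGD).
have [N [V [g [Nx ND [dk _]]]]] := local_change_of_variables oD Dx cP jx.
have [oN oV NV VN [_ cg]] := dk.
have GE : G1 x1 = G x by rewrite GF1// GF// E.
have [Vx gx] := NV _ Nx.
pose H := G \o (g \o (pr \o G1)).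
have dG1 : differentiable G1 x1 := C1_on_diff cG1 (DU1 _ D1x1).
have dpr : differentiable pr (G1 x1) := C1_on_diff (@C1_on_fst _ _ _ setT) (I : setT (G1 x1)).
have d1 : differentiable (pr \o G1) x1 by exact: differentiable_comp.
have E1 : (pr \o G1) x1 = (pr \o G) x by rewrite /= GE.
have d2 : differentiable (g \o (pr \o G1)) x1.
  by apply: differentiable_comp; [exact: d1|rewrite E1; exact: C1_on_diff cg Vx].
have E2 : (g \o (pr \o G1)) x1 = x by rewrite /= GE -/((pr \o G) x) gx.
have dG : differentiable G x := C1_on_diff cGD Dx.
have dH : differentiable H x1 by apply: differentiable_comp; [exact: d2|rewrite E2; exact: dG].
have near1 : \forall z \near x1, D1 z -> G1 z = H z.
  have [_ ij cp op] := ch; have [cd1 _ cp1 _] := ch1.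
  have oN' : open (psi @` (D `&` N)) by exact: op.
  have pN' : (psi @` (D `&` N)) (psi1 x1) by rewrite E; exists x.
  have nN : nbhs (psi1 x1) (psi @` (D `&` N)) by exact: open_nbhs_nbhs.
  (* The chart [psi1] is continuous within [D1] only, which may be a piece of the half-plane, so the
     factorization is obtained on [D1] alone. *)
  have h : within D1 (nbhs x1) [set z | (psi @` (D `&` N)) (psi1 z)].
    by rewrite (nbhs_subspace_in D1x1); exact: (cp1 x1 _ nN).
  apply: (@filterS _ (nbhs x1) _ _ _ _ h) => z {}h D1z; have [n [Dn Nn] En] := h D1z.
  have Gz : G1 z = G n by rewrite GF1// -En GF.
  by rewrite /H /= Gz; have [_ /= ->] := NV _ Nn.
(* Both basis vectors keep a point of the half-plane inside it for positive times, and two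
   derivatives determine the linear differential. *)
have ray e : e = ((1, 0) : plane R) \/ e = ((0, 1) : plane R) -> 'D_e G1 x1 = 'D_e H x1.
  move=> he; apply: derive_one_sided; [exact: diff_derivable|exact: diff_derivable|by rewrite /H /= GE -/((pr \o G) x) gx|].
  have cray : (fun s : R => s *: e + x1) s @[s --> 0^'+] --> x1.
    apply: cvg_at_right_filter.
    have x1E : 0 *: e + x1 = x1 by rewrite scale0r add0r.
    rewrite -[X in _ --> X]x1E; apply: cvgD; last exact: cvg_cst.
    by apply: cvgZr_tmp; exact: cvg_id.
  have D1ray : \forall s \near 0^'+, D1 (s *: e + x1).
    have [cd1 _ _ _] := ch1; case: cd1 => [oD1|[U2 oU2 D1E]].
      by apply: cray; exact: open_nbhs_nbhs.
    have U2x : U2 x1 by move: D1x1; rewrite D1E => -[].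
    have hx : 0 <= x1.2 by move: D1x1; rewrite D1E => -[].
    have n1 : \forall s \near 0^'+, U2 (s *: e + x1) by apply: cray; exact: open_nbhs_nbhs.
    have n2 : \forall s \near 0^'+, 0 < s :> R by exact: nbhs_right_gt.
    apply: filterS2 n1 n2 => s h1 h2; rewrite D1E; split => //; rewrite /half_plane /=.
    by apply: addr_ge0 => //; apply: mulr_ge0; [exact: ltW|case: he => -> /=].
  have n3 : \forall s \near 0^'+, D1 (s *: e + x1) -> G1 (s *: e + x1) = H (s *: e + x1).
    exact: cray near1.
  by apply: filterS2 D1ray n3 => s h1; apply.
have vE : 'D_v G1 x1 = 'D_v H x1.
  by rewrite (derive_plane _ dG1) (derive_plane _ dH) !dxE !dyE (ray _ (or_introl erefl)) (ray _ (or_intror erefl)).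
exists ('D_v (g \o (pr \o G1)) x1).
have dG2 : differentiable G ((g \o (pr \o G1)) x1) by rewrite E2; exact: dG.
by rewrite vE -[LHS]/('D_v (G \o (g \o (pr \o G1))) x1) (derive_comp v d2 dG2) E2.
Qed.

(** If the projections for the angles (1, 0) and (0, 1) were both degenerate, the contact form would
    vanish on the tangent vectors, and the tangent plane would be the horizontal one, against
    regularity. *)
Lemma regular_graph_chart F p : surface_interior F p -> regular_part F p ->
  exists al be D psi u x, [/\ al ^+ 2 + be ^+ 2 = 1, graph_chart al be F D psi u, D x & psi x = p].
Proof.
move=> [D [psi [oD [ch [G Gext]] [x Dx <-]]]] reg.
have [[U [oU DU cG]] GF imm] := Gext.
have dG : differentiable G x := C1_on_diff cG (DU _ Dx).
have [a aE] : exists a : heis R, dx G x = a by eexists.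
have [b bE] : exists b : heis R, dy G x = b by eexists.
have [q qE] : exists q, G x = q by eexists.
have DE v : 'D_v G x = v.1 *: a + v.2 *: b by rewrite -aE -bE; exact: derive_plane.
have inj v : v.1 *: a + v.2 *: b = 0 -> v = 0 by rewrite -DE; exact: imm.
suff [al [be [E J]]] : exists al be, al ^+ 2 + be ^+ 2 = 1 /\ jac (fun y => gproj al be (G y)) x != 0.
  have [V [psi' [u [y [gc Vy Ey]]]]] := graph_chart_of_immersion E oD ch Gext Dx J.
  by exists al, be, V, psi', u, y.
have e10 : (1 : R) ^+ 2 + 0 ^+ 2 = 1 by rewrite expr1n expr0n addr0.
have e01 : (0 : R) ^+ 2 + 1 ^+ 2 = 1 by rewrite expr1n expr0n add0r.
have [J10|/eqP J10] := pselect (jac (fun y => gproj 1 0 (G y)) x = 0); last first.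
  by exists 1, 0; split; [exact: e10|exact: J10].
have [J01|/eqP J01] := pselect (jac (fun y => gproj 0 1 (G y)) x = 0); last first.
  by exists 0, 1; split; [exact: e01|exact: J01].
have [ca caE] : exists c, contact q a = c by eexists.
have [cb cbE] : exists c, contact q b = c by eexists.
have {}J10 : a.1.1 * cb - b.1.1 * ca = 0.
  have := jac_gproj e10 dG; rewrite J10 aE bE qE caE cbE => K; rewrite [RHS]K /gxi.
  by ring.
have {}J01 : a.1.2 * cb - b.1.2 * ca = 0.
  have := jac_gproj e01 dG; rewrite J01 aE bE qE caE cbE => K; rewrite [RHS]K /gxi.
  by ring.
have kill (s t : R) : s * ca + t * cb = 0 -> s * a.1.1 + t * b.1.1 = 0 ->
    s * a.1.2 + t * b.1.2 = 0 -> s = 0 /\ t = 0.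
  move=> h0 h1 h2; have [] : (s, t) = 0 :> plane R; last by move=> -> ->.
  apply: inj; apply: (@horizontal_eq _ q); first by rewrite contactD caE cbE.
    by rewrite /contact /frame_coord /= !mul0r subr0 addr0.
  by rewrite lincomb_fst /= h1 h2.
(* The combination cb a - ca b has zero contact form, and its first two coordinates are the
   degenerate Jacobians, so injectivity of the differential applies. *)
have [cb0 ca0] : cb = 0 /\ ca = 0.
  have [||| -> /eqP] := kill cb (- ca); [by ring|by rewrite -[RHS]J10; ring|by rewrite -[RHS]J01; ring|].
  by rewrite oppr_eq0 => /eqP.
have hz v : contact q ('D_v G x) = 0 by rewrite DE contactD caE cbE ca0 cb0 !mulr0 addr0.
exfalso; apply: reg.
have {}kill (s t : R) : s * a.1.1 + t * b.1.1 = 0 -> s * a.1.2 + t * b.1.2 = 0 -> s = 0 /\ t = 0.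
  by apply: kill; rewrite ca0 cb0 !mulr0 addr0.
(* Horizontal vectors are determined by their first two coordinates, so independence of [a] and [b]
   passes to their projections. *)
pose J := a.1.1 * b.1.2 - b.1.1 * a.1.2.
have J0 : J != 0.
  apply/eqP => J0.
  have [||b11 /eqP] := kill b.1.1 (- a.1.1); [by ring|by rewrite -[RHS]oppr0 -J0 /J; ring|].
  rewrite oppr_eq0 => /eqP a11.
  have [||b12 /eqP] := kill b.1.2 (- a.1.2); [by rewrite -[RHS]J0 /J; ring|by ring|].
  rewrite oppr_eq0 => /eqP a12.
  have [||/eqP] := kill 1 0; [by rewrite a11 b11 !mulr0 addr0|by rewrite a12 b12 !mulr0 addr0|].
  by rewrite oner_eq0.
have dP : jac (fst \o G) x = J.
  rewrite /jac !dxE !dyE !(derive_fst_comp _ dG) -!dxE -!dyE aE bE /J; ring.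
(* The tangent plane collects vectors from all charts, so one inclusion needs the comparison of
   charts; the other one is Cramer's rule in the present chart. *)
apply/seteqP; split => w.
  move=> /(tangent_plane_image oD ch Gext Dx); rewrite dP => /(_ J0)[v ->].
  by apply/horizontal_planeP; rewrite -GF// qE hz.
move=> /horizontal_planeP; rewrite -GF// qE => hw.
pose v : plane R := ((w.1.1 * b.1.2 - b.1.1 * w.1.2) / J, (a.1.1 * w.1.2 - w.1.1 * a.1.2) / J).
exists D, psi, G, x, v; split => //.
apply: (@horizontal_eq _ q) => //; rewrite ?hz// DE lincomb_fst /v /=.
rewrite [LHS]surjective_pairing; move: J0; rewrite /J => J0.
by congr (_, _); field; exact: J0.
Qed.

(** The tau-derivative of the graph map has contact form 1, so the tangent plane is not
    horizontal. *)
Lemma graph_chart_regular (al be : R) F D psi u x : al ^+ 2 + be ^+ 2 = 1 ->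
  graph_chart al be F D psi u -> D x -> surface_interior F (psi x) /\ regular_part F (psi x).
Proof.
move=> albe gc Dx; have [oD ch cu Fp] := gc; split.
  by exists D, psi; split; [exact: oD|exact: graph_local_param gc|exists x].
move=> sing; pose G y := gpt al be y.1 (u y) y.2.
have tw : tangent_plane F (psi x) ('D_((0, 1) : plane R) G x).
  by exists D, psi, G, x, (0, 1); split => //; exact: (graph_immersion_ext albe gc).
move: tw; rewrite sing => /horizontal_planeP; rewrite Fp// (derive_graph _ _ _ cu Dx) contact_dgpt//.
by move/eqP; rewrite /= mulr0 subr0 oner_eq0.
Qed.

End TangentPlanes.

(** * Leaves of an intrinsic graph and their uniqueness *)

Section Leaves.
Context {R : realType}.
Implicit Types (q w : heis R).

Definition line_direction q (A B : R) : heis R := (A, B, A * q.1.2 - B * q.1.1).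

Lemma horizontal_lineE q A B s : horizontal_line q A B s = q + s *: line_direction q A B.
Proof.
case: q => [[q1 q2] q3]; rewrite /horizontal_line /line_direction /=.
by congr (_, _, _); rewrite /= /GRing.scale /=; ring.
Qed.

Lemma horizontal_line_direction q w : contact q w = 0 -> w = line_direction q w.1.1 w.1.2.
Proof.
move=> hw; apply: (horizontal_eq hw); last by rewrite /line_direction /= -surjective_pairing.
by rewrite /contact /frame_coord /line_direction /=; ring.
Qed.

Lemma is_derive_ray {V : normedModType R} (k : R -> R) (q w : V) (s k' : R) :
  is_derive s 1 k k' -> is_derive s 1 (fun r => q + k r *: w) (k' *: w).
Proof.
move=> [dk Ek]; have dk' : differentiable k s by apply/derivable1_diffP.
have d1 : differentiable (fun r => k r *: w) s by exact: differentiableZl.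
have d0 : differentiable (fun=> q : V) s by exact: differentiable_cst.
apply: DeriveDef; first by apply: diff_derivable; exact: (differentiableD d0 d1).
rewrite (deriveD (f := fun=> q) (derivable_cst _ _ _) (diff_derivable d1)) derive_cst add0r.
by rewrite deriveE// diffZl//= -deriveE// Ek.
Qed.

Context {M : topologicalType} (al be : R).
Hypothesis albe : al ^+ 2 + be ^+ 2 = 1.
Variables (F : M -> heis R) (D : set (plane R)) (psi : plane R -> M) (u : plane R -> R).
Variables (p0 : plane R) (e : R).
Hypotheses (gc : graph_chart al be F D psi u) (Dp0 : D p0) (e0 : 0 < e).

Let y x := parabola p0.2 (u p0) (om u p0) p0.1 x.

Hypothesis leafP : forall x, `|x - p0.1| < e ->
  [/\ D (x, y x), u (x, y x) = u p0 + om u p0 * (x - p0.1) & om u (x, y x) = om u p0].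

Let oD : open D. Proof. by case: gc. Qed.
Let cu : C1_on D u. Proof. by case: gc. Qed.
Let Fpsi x : D x -> F (psi x) = gpt al be x.1 (u x) x.2. Proof. by case: gc => _ _ _; apply. Qed.

Let A := al - be * om u p0.
Let B := be + al * om u p0.
Let V := line_direction (F (psi p0)) A B.

Let psi_leaf x : `|x - p0.1| < e -> F (psi (x, y x)) = horizontal_line (F (psi p0)) A B (x - p0.1).
Proof. by move=> /leafP[Dx ux _]; rewrite !Fpsi//= ux gpt_parabola. Qed.

Definition leaf s := psi (p0.1 + s, parabola p0.2 (u p0) (om u p0) p0.1 (p0.1 + s)).

Let ball_e s : `|s| < e -> `|p0.1 + s - p0.1| < e.
Proof. by rewrite addrAC subrr add0r. Qed.

Lemma leaf_line s : `|s| < e -> F (leaf s) = horizontal_line (F (psi p0)) A B s.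
Proof. by move=> /ball_e /psi_leaf; rewrite addrAC subrr add0r. Qed.

Let V_neq0 : V != 0.
Proof.
apply/eqP => -[h1 h2 _]; have := line_direction_neq0 albe (om u p0).
by rewrite -/A -/B h1 h2 eqxx.
Qed.

Lemma leaf_characteristic : characteristic_curve F (- e) e leaf.
Proof.
move=> s; rewrite -ltr_norml => hs; have [Dx ux omx] := leafP (ball_e hs).
have [h1 h2] := graph_chart_regular albe gc Dx.
have nearL (r : R) : `|r| < e -> \forall t \near r, F (leaf t) = F (psi p0) + t *: V.
  move=> hr; apply: filterS (open_nbhs_nbhs (conj (@open_norm_lt R e) hr)) => t ht.
  by rewrite leaf_line// horizontal_lineE.
have dL (r : R) : `|r| < e -> is_derive r 1 (F \o leaf) V.
  move=> hr; have E : \forall t \near r, F (psi p0) + t *: V = (F \o leaf) t.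
    by apply: filterS (nearL _ hr) => t /= ->.
  have [d1 d2] := is_derive_ray (F (psi p0)) V (is_derive_id r 1).
  apply: DeriveDef; first by apply: near_eq_derivable d1; last exact: E.
  by rewrite -(near_eq_derive _ E) d2 scale1r.
have [dFs EFs] := dL s hs.
split; [exact: h1|exact: h2| |exact: dFs|split].
- apply: (continuous_comp (f := fun s => (p0.1 + s, y (p0.1 + s))) (g := psi)); last first.
    by have [_ ch _ _] := gc; exact: (chart_continuous oD ch Dx).
  have cp : {for s, continuous (fun s : R => p0.1 + s)} by apply: cvgD; [exact: cvg_cst|exact: cvg_id].
  apply: (@continuous_pair R R R (fun s => p0.1 + s) (fun s => y (p0.1 + s)) s); first exact: cp.
  apply: (continuous_comp (f := fun s => p0.1 + s) (g := y)); first exact: cp.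
  exact: is_derive_continuous (is_derive_parabola _ _ _ _ _).
- apply: cvg_near_cst; rewrite EFs.
  apply: filterS (open_nbhs_nbhs (conj (@open_norm_lt R e) hs)) => t ht.
  by have [_ ->] := dL t ht.
- by rewrite EFs.
(* The velocity has increments (1, om, 2u) in (xi, eta, tau): the contact form gives 2u - 2u = 0,
   and constancy of [om] along the leaf makes it the differential of the graph in the direction (1,
   2u). *)
rewrite EFs; set x := (_, _) in Dx ux omx; have VE : V = dgpt al be x.1 (u x) 1 (om u p0) (2 * u x).
  rewrite /V /line_direction Fpsi// /dgpt /gpt ux /x /=; congr (_, _, _); [by rewrite /A; ring|by rewrite /B; ring|].
  transitivity ((al ^+ 2 + be ^+ 2) * (u p0 - p0.1 * om u p0)); first by rewrite /A /B; ring.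
  by rewrite albe; ring.
split; last first.
  by apply/horizontal_planeP; rewrite /leaf -/(y _) Fpsi// VE contact_dgpt// mulr1 subrr.
exists D, psi, (fun x => gpt al be x.1 (u x) x.2), x, (1, 2 * u x).
split; [by case: gc|exact: (graph_immersion_ext albe gc)|exact: Dx|by []|].
rewrite (derive_graph _ _ _ cu Dx) (derive_plane _ (C1_on_diff cu Dx)) VE /=; congr dgpt.
by rewrite -omx /om scale1r.
Qed.

(** Horizontality means tau' = 2 eta xi', and eta = u(xi, tau) on the surface. The projected curve
    thus follows the same equation as the parabola, in a parametrization that [ode_unique]
    allows. *)
Lemma curve_in_leaf (a b s0 : R) (eta : R -> M) : a < s0 < b ->
  characteristic_curve F a b eta -> eta s0 = psi p0 ->
  let xi s := gxi al be (F (eta s)) in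
  \forall s \near s0, [/\ `|xi s - p0.1| < e, eta s = psi (xi s, y (xi s)) &
    is_derive s 1 xi (gxi al be ('D_(1 : R) (F \o eta) s))].
Proof.
move=> abs0 ce es xi; pose c := F \o eta; pose tau s := gtau al be (c s).
have [_ _ ceta _ [cdc _ _]] := ce _ abs0.
have n1 : \forall s \near s0, (psi @` D) (eta s).
  apply: ceta; apply: open_nbhs_nbhs; split.
    by apply: chart_image_open; case: gc.
  by rewrite es; exists p0.
have n2 : \forall s \near s0, a < s < b by exact: open_nbhs_nbhs (conj (@open_oo R a b) abs0).
have inP s : (psi @` D) (eta s) ->
    [/\ D (xi s, tau s), eta s = psi (xi s, tau s) & geta al be (c s) = u (xi s, tau s)].
  move=> [x Dx E]; have Ex : (xi s, tau s) = x.
    by rewrite /xi /tau /c /= -E Fpsi// gxiK// gtauK// -surjective_pairing.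
  by rewrite Ex; split => //; rewrite /c /= -E Fpsi// getaK.
have dP s : a < s < b -> is_derive s 1 xi (gxi al be ('D_(1 : R) c s)) /\
    is_derive s 1 tau (2 * geta al be (c s) * gxi al be ('D_(1 : R) c s)).
  move=> hs; have [_ _ _ dc [_ _ [_ /horizontal_planeP hc]]] := ce _ hs.
  have dc' : differentiable c s by apply/derivable1_diffP.
  have [d1 _ d3] := differentiable_gxi al be dc'.
  split; apply: DeriveDef; [exact: diff_derivable d1|exact: derive_gxi|exact: diff_derivable d3|].
  by rewrite (derive_gtau albe _ dc') hc add0r.
have xs0 : xi s0 = p0.1 by rewrite /xi es Fpsi// gxiK.
have ts0 : tau s0 = p0.2 by rewrite /tau /c /= es Fpsi// gtauK.
have n3 : \forall s \near s0, tau s = y (xi s).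
  apply: (@ode_unique R D (fun x => 2 * u x) y xi tau (fun s => gxi al be ('D_(1 : R) c s)) s0 oD).
  - exact: (C1_onM oD (@C1_on_cst _ (plane R) R D 2) cu).
  - by rewrite xs0 ts0 -surjective_pairing.
  - by rewrite xs0 ts0 /y /parabola subrr expr0n /= !mulr0 !addr0.
  - rewrite xs0; apply: filterS (near_dist_lt p0.1 e0) => z /leafP[_ uz _].
    by rewrite uz; exact: is_derive_parabola.
  - apply: filterS2 n1 n2 => s /inP[_ _ <-] /dP[d1 d2]; split; [exact: d1|exact: d2].
  - have ci := @C1_on_linear _ (heis R) (heis R) setT idfun (fun x => cvg_id).
    have cx := C1_on_continuous (C1_on_gxi al be openT ci) (I : setT ('D_(1 : R) c s0)).
    exact: (continuous_comp cdc cx).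
have cxi : {for s0, continuous xi} by have [d1 _] := dP _ abs0; exact: is_derive_continuous d1.
have n4 : \forall s \near s0, `|xi s - p0.1| < e.
  by rewrite -xs0; have /cvgr_distC_lt := cxi; apply.
have n12 := @filterI _ _ (nbhs_filter s0) _ _ n1 n2.
have n34 := @filterI _ _ (nbhs_filter s0) _ _ n3 n4.
apply: filterS2 n12 n34 => s [h1 h2] [h3 h4]; have [_ E _] := inP _ h1; have [d1 _] := dP _ h2.
by split; [exact: h4|rewrite E h3|exact: d1].
Qed.

Lemma curve_unique_leaf (a b s0 : R) (eta : R -> M) : a < s0 < b ->
  characteristic_curve F a b eta -> eta s0 = psi p0 ->
  \forall s \near s0, (leaf @` `]- e, e[) (eta s).
Proof.
move=> h1 h2 h3; apply: filterS (curve_in_leaf h1 h2 h3) => s [hx E _].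
exists (gxi al be (F (eta s)) - p0.1); first by rewrite /= in_itv/= -ltr_norml.
by rewrite [RHS]E /leaf [p0.1 + _]addrC subrK.
Qed.

(** Position and velocity are both controlled by the fixed vector [V] on a neighbourhood; this is
    what propagates along a long curve. *)
Lemma curve_near_line (a b s0 : R) (eta : R -> M) : a < s0 < b ->
  characteristic_curve F a b eta -> eta s0 = psi p0 ->
  \forall s \near s0, exists r k : R,
    F (eta s) - F (eta s0) = r *: V /\ 'D_(1 : R) (F \o eta) s = k *: V.
Proof.
move=> h1 h2 h3; have /near_join := curve_in_leaf h1 h2 h3.
set xi := fun s => gxi al be (F (eta s)).
apply: filterS => s N; have [hx E d1] := nbhs_singleton N.
have FE t : `|xi t - p0.1| < e -> eta t = psi (xi t, y (xi t)) -> F (eta t) = F (psi p0) + (xi t - p0.1) *: V.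
  by move=> k1 k2; rewrite {1}k2 psi_leaf// horizontal_lineE.
exists (xi s - p0.1), (gxi al be ('D_(1 : R) (F \o eta) s)); split.
  by rewrite (FE _ hx E) h3 addrAC subrr add0r.
have En : \forall t \near s, (F \o eta) t = F (psi p0) + (xi t - p0.1) *: V.
  by apply: filterS N => t [k1 k2 _]; exact: FE.
have d2 := is_derive_sub d1 (is_derive_cst p0.1 s 1).
rewrite [LHS](near_eq_derive _ En).
by have [_ ->] := is_derive_ray (F (psi p0)) V d2; rewrite subr0.
Qed.

End Leaves.

(** * From local leaves to whole characteristic curves *)

Section Foliation.
Context {R : realType} {M : topologicalType}.
Variable (F : M -> heis R).
Hypothesis stat : area_stationary F.

Lemma leaf_through p : surface_interior F p -> regular_part F p ->
  exists al be D psi u p0 e, [/\ al ^+ 2 + be ^+ 2 = 1, graph_chart al be F D psi u, D p0, psi p0 = p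
    & 0 < e /\ forall x, `|x - p0.1| < e ->
    let y := parabola p0.2 (u p0) (om u p0) p0.1 x in
    [/\ D (x, y), u (x, y) = u p0 + om u p0 * (x - p0.1) & om u (x, y) = om u p0]].
Proof.
move=> ip rp; have [al [be [D [psi [u [p0 [E gc Dp0 Ep]]]]]]] := regular_graph_chart ip rp.
have [e He] := graph_line E stat gc Dp0.
by exists al, be, D, psi, u, p0, e.
Qed.

Lemma local_foliation p : surface_interior F p -> regular_part F p ->
  exists (A B e : R) (gamma : R -> M),
    [/\ 0 < e, gamma 0 = p, characteristic_curve F (- e) e gamma,
        forall s, - e < s < e -> F (gamma s) = horizontal_line (F p) A B s &
        forall (a b s0 : R) (eta : R -> M), a < s0 < b ->
          characteristic_curve F a b eta -> eta s0 = p ->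
          \forall s \near s0, (gamma @` `]- e, e[) (eta s)].
Proof.
move=> ip rp; have [al [be [D [psi [u [p0 [e [E gc Dp0 <- [e0 H]]]]]]]]] := leaf_through ip rp.
exists (al - be * om u p0), (be + al * om u p0), e, (leaf psi u p0); split.
- exact: e0.
- by rewrite /leaf addr0 /parabola subrr expr0n /= !mulr0 !addr0 -surjective_pairing.
- exact: (leaf_characteristic E gc Dp0 H).
- by move=> s; rewrite -ltr_norml; exact: (leaf_line E gc Dp0 H).
- by move=> a b s0 eta; exact: (curve_unique_leaf E gc Dp0 e0 H).
Qed.

Definition parallel (W w : heis R) := exists k : R, w = k *: W.

Lemma parallelD W v w : parallel W v -> parallel W w -> parallel W (v + w).
Proof. by move=> [k ->] [l ->]; exists (k + l); rewrite scalerDl. Qed.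

Lemma parallelN W v : parallel W v -> parallel W (- v).
Proof. by move=> [k ->]; exists (- k); rewrite scaleNr. Qed.

Lemma parallelZ W v k : parallel W v -> parallel W (k *: v).
Proof. by move=> [l ->]; exists (k * l); rewrite scalerA. Qed.

(* The set of parameters at which the curve has the position and the direction of
   the line through its midpoint is open and closed. *)
Lemma characteristic_curve_line (a b : R) (gamma : R -> M) : characteristic_curve F a b gamma ->
  exists q A B, (A, B) != (0, 0) /\
    forall s, a < s < b -> exists r, F (gamma s) = horizontal_line q A B r.
Proof.
move=> cg; have [ab|ba] := ltP a b; last first.
  (* The parameter interval is empty, so any line will do. *)
  exists (0, 0, 0), 1, 0; split; first by apply/eqP => -[/eqP]; rewrite oner_eq0.
  by move=> s /andP[h1 h2]; have := lt_trans h1 h2; rewrite ltNge ba.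
pose m := (a + b) / 2; pose l := (b - a) / 2.
have itvE s : (a < s < b) = (`|s - m| < l).
  by rewrite ltr_norml /m /l; apply/idP/idP; lra.
have hm : a < m < b by rewrite /m; lra.
pose c := F \o gamma; pose W := 'D_(1 : R) c m.
have [_ _ _ _ [_ W0 [_ /horizontal_planeP hW]]] := cg _ hm.
pose S s := parallel W ('D_(1 : R) c s) /\ parallel W (c s - c m).
(* The indicator function of the good parameters. Being locally constant it has zero derivative, so
   the mean value theorem takes the place of a connectedness argument. *)
pose f (s : R) : R := if asbool (S s) then 1 else 0.
have df s : `|s - m| < l -> is_derive s 1 f 0.
  rewrite -itvE => hs; have [ip rp _ _ [_ cs0 _]] := cg _ hs.
  have [al [be [D [psi [u [p0 [e [E gc Dp0 Ep [e0 H]]]]]]]]] := leaf_through ip rp.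
  have N := curve_near_line E gc Dp0 e0 H hs cg (esym Ep).
  set V := line_direction _ _ _ in N.
  have inI := open_nbhs_nbhs (conj (@open_oo R a b) hs).
  have [r0 [k0 [_ E0]]] := nbhs_singleton N.
  (* The velocity does not vanish, so the factor [k] is invertible and the local direction [V] is
     itself a multiple of [W]. *)
  have par_V t k : a < t < b -> 'D_(1 : R) c t = k *: V -> parallel W ('D_(1 : R) c t) -> parallel W V.
    move=> ht Et; rewrite Et => -[j Ej]; have [_ _ _ _ [_ ct0 _]] := cg _ ht.
    exists (k^-1 * j); rewrite -scalerA -Ej scalerA mulVf ?scale1r//.
    by apply: contra_neq ct0 => k00; rewrite Et k00 scale0r.
  have fE : \forall t \near s, f t = f s.
    apply: filterS2 N inI => t [r [k [E1 E2]]] ht.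
    have E3 : c t - c m = r *: V + (c s - c m) by rewrite -E1 addrA subrK.
    rewrite /f; congr (if _ then _ else _); apply: asbool_equiv_eq; split => -[P1 P2].
      have PV := par_V t k ht E2 P1; split; first by rewrite E0; exact: parallelZ.
      have -> : c s - c m = (c t - c m) - r *: V by rewrite E3 addrAC subrr add0r.
      by apply: parallelD => //; apply: parallelN; exact: parallelZ.
    have PV := par_V s k0 hs E0 P1; split; first by rewrite [X in parallel _ X]E2; exact: parallelZ.
    by rewrite E3; apply: parallelD => //; exact: parallelZ.
  apply: is_derive_eps => eps eps0; apply: filterS fE => t ->.
  by rewrite subrr mul0r subrr normr0 mulr_ge0// ltW.
have fm : f m = 1.
  rewrite /f asboolT//; split; first by exists 1; rewrite scale1r.
  by exists 0; rewrite subrr scale0r.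
have WE := horizontal_line_direction hW.
exists (c m), W.1.1, W.1.2; split.
  apply: contra_neq W0 => -[w1 w2]; rewrite [LHS]WE /line_direction w1 w2 !mul0r subrr.
  by [].
move=> s; rewrite itvE => /(derive0_constant df); rewrite fm /f.
case: ifP => [/asboolP[_ [r Er]] _|_ /eqP]; last by rewrite eq_sym oner_eq0.
by exists r; rewrite horizontal_lineE -WE -Er addrC subrK.
Qed.

End Foliation.

Theorem theorem3p5 (R : realType) (M : topologicalType) (F : M -> heis R)
    (F_surface : immersed_surface F) (F_stationary : area_stationary F) :
  foliated_by_horizontal_lines F.
Proof.
split; first by move=> p; exact: local_foliation.
by move=> a b gamma; exact: characteristic_curve_line.
Qed.
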